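(* Let $f_0:\mathbb{C}\to\hat{\mathbb{C}}$ be a transcendental meromorphic function of finite order $\rho>0$ such that: (1) $\infty$ is not an asymptotic value of $f_0$; (2) there exist $R^*>0$ and a co-finite subset $\mathcal{P}^*$ of the set $\mathcal{P}$ of poles of $f_0$ (i.e. $\mathcal{P}\setminus\mathcal{P}^*$ finite) such that $\mathrm{dist}(\mathrm{Sing}(f_0^{-1}),a)>R^*$ for all $a\in\mathcal{P}^*$; (3) there exists $R^\dagger>0$ such that $B(a_1,R^\dagger)\cap B(a_2,R^\dagger)=\emptyset$ for distinct poles $a_1,a_2\in\mathcal{P}$; (4) there exist $M\in\mathbb{N}$ and $\beta\geq0$ such that for each $a\in\mathcal{P}^*$ we have $1\leq m(a)\leq M$ and $$|f_0(z)|\asymp\frac{|a|^{-\beta}}{|z-a|^{m(a)}},\qquad |f_0'(z)|\asymp\frac{m(a)|a|^{-\beta}}{|z-a|^{m(a)+1}}\quad\text{for }z\in B(a,R^\dagger).$$ Then there is $\varepsilon>0$ such that if $(c_n)$ is a sequence in $\mathbb{C}$ with $|c_n|<\varepsilon$ for all $n$, then $$\frac{\rho M^*}{\beta+M^*+1}\leq \mathrm{HD}(I_\infty(F_+))\leq \mathrm{ED}(F_+)\leq\frac{\rho M}{\beta+M+1}\quad\text{and}\quad \frac{\rho M^*}{\beta+M^*+1}\leq \mathrm{EHD}(F_+)\leq \mathrm{ED}(F_+).$$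
   Context: $m(a)$ is the multiplicity of the pole $a$; $\mathrm{Sing}(f^{-1})$ is the set of finite critical and asymptotic values. $A\asymp B$ means there is a constant $C\geq1$, independent of $a$ and $z$, with $C^{-1}A\leq B\leq CA$. $M^*$ is the largest integer $1\leq M^*\leq M$ such that $\sum_{a\in\mathcal{P},\,m(a)=M^*}|a|^{-t}$ converges for $t>\rho$ and diverges for $t<\rho$. Given $(c_n)$, $f_n(z)=f_0(z)+c_n$ and $F_+^n=f_n\circ\dots\circ f_1$. For a sequence of compositions $F^n$: the Fatou set is the set of $z\in\mathbb{C}$ having a neighborhood on which all $F^n$ are defined and normal, $\mathcal{J}(F)$ its complement; $I_\infty(F)=\{z\in\mathcal{J}(F):F^n(z)\to\infty\}$; the radial Julia set $\mathcal{J}_r(F)$ is the set of $z\in\mathcal{J}(F)$ with all $F^n(z)$ defined and some $\delta>0$ such that for infinitely many $n$ the disk $B(F^n(z),\delta)$ pulls back univalently along the orbit of $z$; $\mathrm{ED}(F)=\lim_{R\to\infty}\mathrm{HD}\{z\in\mathcal{J}(F):|F^n(z)|>R\ \forall n\geq1\}$ and $\mathrm{EHD}(F)=\lim_{R\to\infty}\mathrm{HD}\{z\in\mathcal{J}_r(F):|F^n(z)|>R\ \forall n\geq1\}$. HD is Hausdorff dimension. *)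

(* Defs.v *)
(* C := R[i] (real-closed complex numbers over an
   arbitrary realType R); the Riemann sphere is option C, None = infinity. *)
From HB Require Import structures.
From mathcomp Require Import all_boot all_order all_algebra.
From mathcomp Require Import all_classical all_reals all_analysis.
From mathcomp Require Import complex.
Set Implicit Arguments. Unset Strict Implicit. Unset Printing Implicit Defensive.
Import Order.TTheory GRing.Theory Num.Theory numFieldNormedType.Exports.
Local Open Scope classical_set_scope.
Local Open Scope ring_scope.

Section Defs.
Variable R : realType.
Local Notation C := R[i].
Local Notation Chat := (option C).

Definition cabs (z : C) : R := let: Complex a b := z in Num.sqrt (a ^+ 2 + b ^+ 2).

Definition cball (a : C) (r : R) : set C := [set z | cabs (z - a) < r].

Definition copen (U : set C) : Prop :=
  forall x, U x -> exists r : R, 0 < r /\ cball x r `<=` U.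

Definition is_cderiv (g : C -> C) (z l : C) : Prop :=
  forall e : R, 0 < e -> exists d : R, 0 < d /\
    forall h : C, 0 < cabs h < d -> cabs ((g (z + h) - g z) / h - l) < e.

Definition cdiff (g : C -> C) (z : C) : Prop := exists l, is_cderiv g z l.

Definition fin (u : Chat) : C := if u is Some w then w else 0.

Definition regular_at (f : C -> Chat) (z0 : C) : Prop :=
  exists r : R, 0 < r /\ forall z, cabs (z - z0) < r ->
    f z <> None /\ cdiff (fun x => fin (f x)) z.

Definition pole_of_order (f : C -> Chat) (a : C) (m : nat) : Prop :=
  (1 <= m)%N /\ f a = None /\
  exists r : R, 0 < r /\ exists g : C -> C, g a != 0 /\
    (forall z, cabs (z - a) < r -> cdiff g z) /\
    (forall z, 0 < cabs (z - a) < r -> f z = Some (g z / (z - a) ^+ m)).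

Definition poles (f : C -> Chat) : set C := [set a | exists m, pole_of_order f a m].

Definition meromorphic (f : C -> Chat) : Prop :=
  forall z, regular_at f z \/ exists m, pole_of_order f z m.

Definition rational_fun (f : C -> Chat) : Prop :=
  exists p q : {poly C}, q != 0 /\
    forall z, q.[z] != 0 -> f z = Some (p.[z] / q.[z]).

Definition transcendental_meromorphic (f : C -> Chat) : Prop :=
  meromorphic f /\ ~ rational_fun f.

Definition twopi : R := 2 * pi.

Definition logplus (x : R) : R := Num.max 0 (ln x).

Definition circ (r t : R) : C := Complex (r * cos t) (r * sin t).

Definition prox (f : C -> Chat) (r : R) : \bar R :=
  (twopi^-1)%:E *
  (\int[@lebesgue_measure R]_(t in `[0%R, twopi]%classic)
     (if f (circ r t) is Some w then (logplus (cabs w))%:E else +oo%E))%E.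

Definition npoles (f : C -> Chat) (t : R) : \bar R :=
  (\esum_(p in [set p : C * nat | pole_of_order f p.1 p.2 /\ (cabs p.1 <= t)%R])
     (p.2)%:R%:E)%E.

Definition countN (f : C -> Chat) (r : R) : \bar R :=
  (\int[@lebesgue_measure R]_(t in `]0%R, r]%classic)
     ((npoles f t - npoles f 0) * (t^-1)%:E) + npoles f 0 * (ln r)%:E)%E.

Definition charT (f : C -> Chat) (r : R) : R := fine (prox f r + countN f r)%E.

Definition limsup_infty (g : R -> R) : \bar R :=
  ereal_inf [set ereal_sup [set (g r)%:E | r in [set r | r0 <= r]] | r0 in [set: R]].

Definition has_order (f : C -> Chat) (rho : R) : Prop :=
  limsup_infty (fun r => ln (charT f r) / ln r) = rho%:E.

Definition chordal (u v : Chat) : R :=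
  match u, v with
  | Some z, Some w => 2 * cabs (z - w) / Num.sqrt ((1 + cabs z ^+ 2) * (1 + cabs w ^+ 2))
  | Some z, None | None, Some z => 2 / Num.sqrt (1 + cabs z ^+ 2)
  | None, None => 0
  end.

Definition asymptotic_value (f : C -> Chat) (w : Chat) : Prop :=
  exists gam : R -> C,
    (forall t, 0 <= t < 1 -> forall e : R, 0 < e -> exists d : R, 0 < d /\
       forall s, 0 <= s < 1 -> `|s - t| < d -> cabs (gam s - gam t) < e) /\
    (forall K : R, exists d : R, 0 < d /\ forall t, 1 - d < t < 1 -> K < cabs (gam t)) /\
    (forall e : R, 0 < e -> exists d : R, 0 < d /\
       forall t, 1 - d < t < 1 -> chordal (f (gam t)) w < e).

Definition critical_value (f : C -> Chat) (w : C) : Prop :=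
  exists z, f z = Some w /\ is_cderiv (fun x => fin (f x)) z 0.

Definition Sing (f : C -> Chat) : set C :=
  [set w | critical_value f w \/ asymptotic_value f (Some w)].

(* F n = f_n o ... o f_1, f_k = f0 + c k ; None = undefined or infinity *)
Fixpoint Fseq (f0 : C -> Chat) (c : nat -> C) (n : nat) (z : C) : Chat :=
  match n with
  | 0 => Some z
  | n'.+1 => if Fseq f0 c n' z is Some w then omap (fun v => v + c n) (f0 w) else None
  end.

Definition defined_all (F : nat -> C -> Chat) (z : C) : Prop := forall n, F n z <> None.

Definition normal_on (F : nat -> C -> Chat) (U : set C) : Prop :=
  forall phi : nat -> nat, exists psi : nat -> nat,
    (forall k, (psi k < psi k.+1)%N) /\
    exists g : C -> Chat, forall z0, U z0 -> exists r : R, 0 < r /\ cball z0 r `<=` U /\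
      forall e : R, 0 < e -> exists k0, forall k, (k0 <= k)%N ->
        forall z, cball z0 r z -> chordal (F (phi (psi k)) z) (g z) < e.

Definition Fatou (F : nat -> C -> Chat) : set C :=
  [set z0 | exists r : R, 0 < r /\ (forall z, cball z0 r z -> defined_all F z) /\
            normal_on F (cball z0 r)].

Definition Julia (F : nat -> C -> Chat) : set C := ~` Fatou F.

Definition Iinf (F : nat -> C -> Chat) : set C :=
  [set z | Julia F z /\ defined_all F z /\
     forall K : R, exists n0, forall n, (n0 <= n)%N -> exists w, F n z = Some w /\ K < cabs w].

Definition univ_pullback (F : nat -> C -> Chat) (n : nat) (z : C) (d : R) : Prop :=
  exists U : set C, copen U /\ U z /\ (forall x, U x -> F n x <> None) /\
    (forall x y, U x -> U y -> F n x = F n y -> x = y) /\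
    (forall w, cball (fin (F n z)) d w <-> exists x, U x /\ F n x = Some w).

Definition radialJ (F : nat -> C -> Chat) : set C :=
  [set z | Julia F z /\ defined_all F z /\
     exists d : R, 0 < d /\ forall N, exists n, (N <= n)%N /\ univ_pullback F n z d].

Definition cdiam (U : set C) : \bar R :=
  ereal_sup ([set 0%E] `|` [set e | exists x y, U x /\ U y /\ e = (cabs (x - y))%:E]).

Definition Hdelta (s d : R) (A : set C) : \bar R :=
  ereal_inf [set (\sum_(i <oo) ((fine (cdiam (U i))) `^ s)%:E)%E
            | U in [set U : nat -> set C | A `<=` \bigcup_i U i /\
                                           forall i, (cdiam (U i) <= d%:E)%E]].

Definition Hmeas (s : R) (A : set C) : \bar R :=
  ereal_sup [set Hdelta s d A | d in [set d : R | 0 < d]].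

Definition HD (A : set C) : \bar R :=
  ereal_inf [set s%:E | s in [set s : R | 0 <= s /\ Hmeas s A = 0%E]].

Definition escaping (F : nat -> C -> Chat) (J : set C) (r0 : R) : set C :=
  [set z | J z /\ forall n, (1 <= n)%N -> exists w, F n z = Some w /\ r0 < cabs w].

(* lim_{R->oo} of a nonincreasing quantity = its infimum over R > 0 *)
Definition ED (F : nat -> C -> Chat) : \bar R :=
  ereal_inf [set HD (escaping F (Julia F) r0) | r0 in [set r0 : R | 0 < r0]].

Definition EHD (F : nat -> C -> Chat) : \bar R :=
  ereal_inf [set HD (escaping F (radialJ F) r0) | r0 in [set r0 : R | 0 < r0]].

Definition mult_class_exponent (f : C -> Chat) (rho : R) (k : nat) : Prop :=
  forall t : R,
    (rho < t -> (\esum_(a in [set a | pole_of_order f a k]) ((cabs a) `^ (- t))%:E < +oo)%E) /\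
    (t < rho -> (\esum_(a in [set a | pole_of_order f a k]) ((cabs a) `^ (- t))%:E = +oo)%E).

Definition is_Mstar (f : C -> Chat) (rho : R) (M Ms : nat) : Prop :=
  (1 <= Ms <= M)%N /\ mult_class_exponent f rho Ms /\
  forall k, (Ms < k <= M)%N -> ~ mult_class_exponent f rho k.

End Defs.

(* Main.v *)
(* Only the poles matter: since infinity is not an asymptotic value, large values of [f0] are taken
   only in small discs around poles, for otherwise a component of [{|f0| > R}] missing these discs
   would contain, by Phragmen-Lindelof, a path to infinity along which [f0] tends to infinity.  Near
   a pole [a] of order [m], the preimage of the scale [X] is an annulus of radius
   [p = (|a|^-beta / X)^(1/m)] on which [|f0'|] is comparable to [X / p], so [f0] expands strongly
   and orbits that stay near large poles are Julia and radial.

   Upper bound: let [s] be the exponent.  Covering the annuli by boundedly many cells, pulling back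
   an [s]-content bound multiplies it by a constant times the sum over the poles [b] of
   [|b|^-(s (beta + M + 1) / M)].  The order of [f0] bounds the number of poles, so for
   [s > rho M / (beta + M + 1)] the tail of this sum is at most [1/2]; the content of the set of
   orbits staying near large poles is therefore halved repeatedly, hence zero.

   Lower bounds: if [t < rho], divergence of the pole series yields infinitely many dyadic annuli
   [|b| ~ 2^j] with at least [2^(jt)] poles of order [M^*].  Prescribing itineraries through such
   annuli, with [j] tending to infinity slowly, gives by contraction of inverse branches a Cantor set
   of escaping radial points, whose gaps and branching numbers give positive [s]-content for
   [s (beta + M^* + 1) / M^* < t].

   Escaping points are compared with points escaping beyond a fixed radius by going forward and then
   pulling back through a single large pole; both operations preserve null sets, because critical
   points are isolated. *)
Require Import Defs.
From HB Require Import structures.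
From mathcomp Require Import all_boot all_order all_algebra.
From mathcomp Require Import all_classical all_reals all_analysis.
From mathcomp Require Import complex.
From mathcomp Require Import ring lra.
Import Order.TTheory GRing.Theory Num.Theory numFieldNormedType.Exports.
Local Open Scope classical_set_scope.
Local Open Scope ring_scope.
Set Implicit Arguments. Unset Strict Implicit. Unset Printing Implicit Defensive.
Local Notation Re := complex.Re.
Local Notation Im := complex.Im.
Arguments cabs : simpl never.

(** * Complex calculus *)

Section ComplexBasics.
Variable R : realType.
Local Notation C := R[i].
Implicit Types (x y z w : C) (g h : C -> C).

(** The complex analysis starts from the definition of the derivative and uses no power series.
    Goursat's theorem for rectangles, read in log-polar coordinates, gives the mean value property
    and thus the maximum principle; bounds on difference quotients then do the work of Cauchy's
    formula. A difference quotient is at first known to be differentiable only off its base point,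
    so the maximum principle is stated for continuous functions with isolated exceptional points.

    Dimension is treated through Hausdorff content: for a positive exponent it has the same null
    sets as the measure, and covers need no mesh control. The recursion of the upper bound closes
    because a pole [a] of order [m] is charged the weight [|a|^(-beta s / m)], which factors out of
    the contraction at [a]. The lower bound builds no measure: a point outside a cover of small
    total mass is found digit by digit.

    As the maps vary with time, an orbit cannot be restarted at time zero. Estimates are therefore
    uniform in the sequence [c], or points are moved forward and back by the same number of
    steps. *)

Lemma cabs_ge0 z : 0 <= cabs z.
Proof. by case: z => a b; exact: sqrtr_ge0. Qed.

Lemma cabs0 : cabs (0 : C) = 0.
Proof. exact: ComplexField.Normc.normc0. Qed.

Lemma cabs1 : cabs (1 : C) = 1.
Proof. exact: ComplexField.Normc.normc1. Qed.

Lemma cabsM x y : cabs (x * y) = cabs x * cabs y.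
Proof. exact: ComplexField.Normc.normcM. Qed.

Lemma cabsV x : cabs x^-1 = (cabs x)^-1.
Proof. exact: ComplexField.Normc.normcV. Qed.

Lemma cabs_div x y : cabs (x / y) = cabs x / cabs y.
Proof. by rewrite cabsM cabsV. Qed.

Lemma cabsD x y : cabs (x + y) <= cabs x + cabs y.
Proof. exact: le_normcD. Qed.

Lemma cabsN x : cabs (- x) = cabs x.
Proof. exact: normcN. Qed.

Lemma cabsX x n : cabs (x ^+ n) = cabs x ^+ n.
Proof. by elim: n => [|n IH]; rewrite ?expr0 ?cabs1// !exprS cabsM IH. Qed.

Lemma cabs_eq0 z : (cabs z == 0) = (z == 0).
Proof.
apply/eqP/eqP => [/ComplexField.Normc.eq0_normc //|->]; exact: cabs0.
Qed.

Lemma cabs_gt0 z : (0 < cabs z) = (z != 0).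
Proof. by rewrite lt_neqAle cabs_ge0 andbT eq_sym cabs_eq0. Qed.

Lemma cabs_distC x y : cabs (x - y) = cabs (y - x).
Proof. by rewrite -opprB cabsN. Qed.

Lemma cabsB x y : cabs (x - y) <= cabs x + cabs y.
Proof. by rewrite -(cabsN y); exact: cabsD. Qed.

Lemma cabs_triangle y x z : cabs (x - z) <= cabs (x - y) + cabs (y - z).
Proof. have -> : x - z = (x - y) + (y - z) by ring.
exact: cabsD. Qed.

Lemma cabs_le_sub x y : cabs x <= cabs y + cabs (x - y).
Proof. by rewrite -{1}(subrK y x) addrC cabsD. Qed.

Lemma cabs_real (r : R) : cabs (r%:C)%C = `|r|.
Proof. by rewrite /cabs /= expr0n /= addr0 sqrtr_sqr. Qed.

Lemma cabs_i : cabs (Complex 0 1 : C) = 1.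
Proof. by rewrite /cabs expr0n expr1n add0r sqrtr1. Qed.

Lemma Re_le_cabs z : `|Re z| <= cabs z.
Proof.
by case: z => a b; rewrite /cabs /= -sqrtr_sqr ler_sqrt ?addr_ge0 ?sqr_ge0 // lerDl sqr_ge0.
Qed.

Lemma Im_le_cabs z : `|Im z| <= cabs z.
Proof.
by case: z => a b; rewrite /cabs /= -sqrtr_sqr ler_sqrt ?addr_ge0 ?sqr_ge0 // lerDr sqr_ge0.
Qed.

Lemma cabs_ReIm z : cabs z <= `|Re z| + `|Im z|.
Proof.
case: z => a b; have {1}-> : Complex a b = (a%:C)%C + (b%:C)%C * Complex 0 1.
  by apply/eqP; rewrite eq_complex /=; apply/andP; split; apply/eqP; ring.
by apply: le_trans (cabsD _ _) _; rewrite cabsM cabs_i mulr1 !cabs_real.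
Qed.

Lemma Re_sub x y : Re (x - y) = Re x - Re y.
Proof. by case: x y => a b [c d]. Qed.
Lemma Im_sub x y : Im (x - y) = Im x - Im y.
Proof. by case: x y => a b [c d]. Qed.

Lemma cabs_natmul n : cabs (n%:R : C) = n%:R.
Proof.
have -> : (n%:R : C) = (n%:R : R)%:C%C by rewrite rmorph_nat.
by rewrite cabs_real ger0_norm.
Qed.

Definition ccont_at g z := forall e : R, 0 < e -> exists d : R, 0 < d /\
  forall x, cabs (x - z) < d -> cabs (g x - g z) < e.

Lemma ccont_near g h z (r : R) : 0 < r ->
  (forall x, cabs (x - z) < r -> g x = h x) -> ccont_at g z -> ccont_at h z.
Proof.
move=> r0 gh cg e e0; have [d [d0 Hd]] := cg e e0.
exists (Num.min d r); split; first by rewrite lt_min d0.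
move=> x; rewrite lt_min => /andP[xd xr].
by rewrite -!gh ?subrr ?cabs0 //; exact: Hd.
Qed.

Lemma ccont_cst (c : C) z : ccont_at (fun=> c) z.
Proof. by move=> e e0; exists 1; split=> // x _; rewrite subrr cabs0. Qed.

Lemma ccont_id z : ccont_at id z.
Proof. by move=> e e0; exists e; split. Qed.

Lemma ccontD g h z : ccont_at g z -> ccont_at h z -> ccont_at (fun x => g x + h x) z.
Proof.
move=> cg ch e e0; have e2 : 0 < e / 2 by rewrite divr_gt0.
have [d [d0 Hd]] := cg _ e2; have [d' [d0' Hd']] := ch _ e2.
exists (Num.min d d'); split; first by rewrite lt_min d0.
move=> x; rewrite lt_min => /andP[/Hd A /Hd' B].
rewrite opprD addrACA; apply: le_lt_trans (cabsD _ _) _.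
by rewrite (splitr e) ltrD.
Qed.

Lemma ccontN g z : ccont_at g z -> ccont_at (fun x => - g x) z.
Proof.
move=> cg e /cg[d [d0 Hd]]; exists d; split=> // x /Hd.
by rewrite -opprD cabsN.
Qed.

Lemma ccontB g h z : ccont_at g z -> ccont_at h z -> ccont_at (fun x => g x - h x) z.
Proof. by move=> cg /ccontN; exact: ccontD. Qed.

Lemma ccont_bound g z : ccont_at g z -> exists d : R, 0 < d /\
  forall x, cabs (x - z) < d -> cabs (g x) < cabs (g z) + 1.
Proof.
move=> /(_ 1 ltr01)[d [d0 Hd]]; exists d; split => // x /Hd A.
by apply: le_lt_trans (cabs_le_sub _ (g z)) _; rewrite ltrD2l.
Qed.

Lemma ccontM g h z : ccont_at g z -> ccont_at h z -> ccont_at (fun x => g x * h x) z.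
Proof.
move=> cg ch e e0.
have [b [b0 Hb]] := ccont_bound cg.
have A0 : 0 < cabs (g z) + 1 by rewrite ltr_wpDl ?cabs_ge0.
have B0 : 0 < cabs (h z) + 1 by rewrite ltr_wpDl ?cabs_ge0.
have [d [d0 Hd]] := cg _ (divr_gt0 (divr_gt0 e0 (ltr0Sn _ 1)) B0).
have [d' [d0' Hd']] := ch _ (divr_gt0 (divr_gt0 e0 (ltr0Sn _ 1)) A0).
exists (Num.min b (Num.min d d')); split; first by rewrite !lt_min b0 d0.
move=> x; rewrite !lt_min => /andP[/Hb A /andP[/Hd B /Hd' D]].
have -> : g x * h x - g z * h z = g x * (h x - h z) + (g x - g z) * h z by ring.
apply: le_lt_trans (cabsD _ _) _; rewrite !cabsM (splitr e) ltr_leD //.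
  apply: (@le_lt_trans _ _ ((cabs (g z) + 1) * cabs (h x - h z))).
    by rewrite ler_wpM2r ?cabs_ge0 // ltW.
  by rewrite mulrC -ltr_pdivlMr.
apply: (@le_trans _ _ (cabs (g x - g z) * (cabs (h z) + 1))).
  by rewrite ler_wpM2l ?cabs_ge0 // lerDl.
by rewrite -ler_pdivlMr // ltW.
Qed.

Lemma ccontV g z : g z != 0 -> ccont_at g z -> ccont_at (fun x => (g x)^-1) z.
Proof.
move=> gz cg e e0; have a0 : 0 < cabs (g z) by rewrite cabs_gt0.
have a2 : 0 < cabs (g z) / 2 by rewrite divr_gt0.
have [d [d0 Hd]] := cg _ a2.
have [d' [d0' Hd']] := cg _ (mulr_gt0 e0 (mulr_gt0 a0 a2)).
exists (Num.min d d'); split; first by rewrite lt_min d0.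
move=> x; rewrite lt_min => /andP[/Hd A /Hd' B].
have gx : cabs (g z) / 2 < cabs (g x).
  have := cabs_le_sub (g z) (g x); rewrite cabs_distC; lra.
have gx0 : g x != 0 by rewrite -cabs_gt0 (lt_trans a2).
have -> : (g x)^-1 - (g z)^-1 = (g z - g x) / (g x * g z).
  by field; rewrite gx0 gz.
rewrite cabs_div cabsM cabs_distC ltr_pdivrMr ?mulr_gt0 ?cabs_gt0 //.
apply: lt_le_trans B _; rewrite ler_pM2l // [leRHS]mulrC ler_pM2l //; exact: ltW.
Qed.

Lemma ccont_comp g h z : ccont_at g z -> ccont_at h (g z) -> ccont_at (fun x => h (g x)) z.
Proof.
move=> cg ch e /ch[d [d0 Hd]]; have [d' [d0' Hd']] := cg _ d0.
by exists d'; split=> // x /Hd'; exact: Hd.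
Qed.

(* Caratheodory's form of differentiability, which makes the rules of calculus algebraic. *)
Lemma cderivP g z l : is_cderiv g z l <->
  exists p : C -> C, [/\ ccont_at p z, p z = l & forall x, g x = g z + p x * (x - z)].
Proof.
split=> [gl|[p [cp <- gp]] e e0]; last first.
  have [d [d0 Hd]] := cp _ e0; exists d; split=> // h /andP[h0 hd].
  have hn : h != 0 by rewrite -cabs_gt0.
  have -> : (g (z + h) - g z) / h - p z = p (z + h) - p z.
    by rewrite gp (addrC (g z)) addrK (addrC z h) addrK mulfK.
  by apply: Hd; rewrite addrC addKr.
exists (fun x => if x == z then l else (g x - g z) / (x - z)); split.
- move=> e e0; have [d [d0 Hd]] := gl e e0; exists d; split=> // x xd.
  rewrite eqxx; case: eqVneq => [_|xz]; first by rewrite subrr cabs0.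
  have := Hd (x - z); rewrite (addrC z) subrK; apply.
  by rewrite xd cabs_gt0 subr_eq0 xz.
- by rewrite eqxx.
- move=> x; case: eqVneq => [->|xz]; first by rewrite subrr mulr0 addr0.
  by rewrite divfK ?subr_eq0 // addrC subrK.
Qed.

Lemma cderiv_near g h z l (r : R) : 0 < r ->
  (forall x, cabs (x - z) < r -> g x = h x) -> is_cderiv g z l -> is_cderiv h z l.
Proof.
move=> r0 gh gl e /gl[d [d0 Hd]]; exists (Num.min d r); split; first by rewrite lt_min d0.
move=> k; rewrite lt_min => /and3P[k0 kd kr].
rewrite -!gh ?subrr ?cabs0 // ?[z + k]addrC ?addrK // [k + z]addrC.
by apply: Hd; rewrite k0.
Qed.

Lemma cdiff_near g h z (r : R) : 0 < r ->
  (forall x, cabs (x - z) < r -> g x = h x) -> cdiff g z -> cdiff h z.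
Proof. by move=> r0 gh [l gl]; exists l; exact: cderiv_near r0 gh gl. Qed.

Lemma cderiv_cont g z l : is_cderiv g z l -> ccont_at g z.
Proof.
move=> /cderivP[p [cp _ gp]]; rewrite (_ : g = fun x => g z + p x * (x - z)).
  apply: ccontD (ccont_cst _ _) _; apply: ccontM cp _.
  by apply: ccontB (ccont_id _) (ccont_cst _ _).
by apply/funext => x.
Qed.

Lemma cdiff_cont g z : cdiff g z -> ccont_at g z.
Proof. by move=> [l /cderiv_cont]. Qed.

Lemma cderiv_cst (c : C) z : is_cderiv (fun=> c) z 0.
Proof.
apply/cderivP; exists (fun=> 0); split=> //; first exact: ccont_cst.
by move=> x; rewrite mul0r addr0.
Qed.

Lemma cderiv_id z : is_cderiv id z 1.
Proof.
apply/cderivP; exists (fun=> 1); split=> //; first exact: ccont_cst.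
by move=> x; rewrite mul1r addrC subrK.
Qed.

Lemma cderivD g h z l m : is_cderiv g z l -> is_cderiv h z m ->
  is_cderiv (fun x => g x + h x) z (l + m).
Proof.
move=> /cderivP[p [cp pz gp]] /cderivP[q [cq qz hq]]; apply/cderivP.
exists (fun x => p x + q x); split; rewrite ?pz ?qz //; first exact: ccontD.
by move=> x; rewrite (gp x) (hq x); ring.
Qed.

Lemma cderivM g h z l m : is_cderiv g z l -> is_cderiv h z m ->
  is_cderiv (fun x => g x * h x) z (l * h z + g z * m).
Proof.
move=> gl hm; have ch := cderiv_cont hm.
move: gl hm => /cderivP[p [cp pz gp]] /cderivP[q [cq qz hq]]; apply/cderivP.
exists (fun x => p x * h x + g z * q x); split; rewrite ?pz ?qz //.
  by apply: ccontD; apply: ccontM => //; exact: ccont_cst.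
by move=> x; rewrite {1}(gp x); have := hq x => ->; ring.
Qed.

Lemma cderivN g z l : is_cderiv g z l -> is_cderiv (fun x => - g x) z (- l).
Proof.
move=> /cderivP[p [cp pz gp]]; apply/cderivP.
exists (fun x => - p x); split; rewrite ?pz //; first exact: ccontN.
by move=> x; rewrite (gp x); ring.
Qed.

Lemma cderivB g h z l m : is_cderiv g z l -> is_cderiv h z m ->
  is_cderiv (fun x => g x - h x) z (l - m).
Proof. by move=> gl /cderivN; exact: cderivD. Qed.

Lemma cderivV g z l : g z != 0 -> is_cderiv g z l ->
  is_cderiv (fun x => (g x)^-1) z (- l / g z ^+ 2).
Proof.
move=> gz gl; have [d [d0 Hd]] : exists d : R, 0 < d /\
    forall x, cabs (x - z) < d -> g x != 0.
  have a0 : 0 < cabs (g z) by rewrite cabs_gt0.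
  have [d [d0 Hd]] := cderiv_cont gl a0; exists d; split=> // x /Hd.
  by apply: contraTneq => ->; rewrite sub0r cabsN ltxx.
(* Caratheodory's identity must hold at every [x], not only near [z]; [k] agrees with [g] near [z]
   and vanishes nowhere. *)
pose k x := if g x == 0 then g z else g x.
have kg x : cabs (x - z) < d -> g x = k x.
  by move=> /Hd; rewrite /k => /negbTE ->.
have kl : is_cderiv k z l by exact: cderiv_near d0 kg gl.
have kn x : k x != 0 by rewrite /k; case: ifPn.
suff : is_cderiv (fun x => (k x)^-1) z (- l / g z ^+ 2).
  by apply: cderiv_near d0 _ => x xd; rewrite kg.
have ck := cderiv_cont kl.
have kz : k z = g z by rewrite /k (negbTE gz).
move: kl => /cderivP[p [cp pz kp]]; apply/cderivP.
exists (fun x => - p x * (k x)^-1 * (k z)^-1); split.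
- apply: ccontM (ccont_cst _ _); apply: ccontM (ccontN cp) _; exact: ccontV.
- by rewrite pz kz expr2 invfM mulrA.
- move=> x; have e : p x * (x - z) = k x - k z by rewrite (kp x) (addrC (k z)) addrK.
  have -> : - p x / k x / k z * (x - z) = - (p x * (x - z)) / k x / k z by ring.
  by rewrite e; field; rewrite !kn.
Qed.

Lemma cdiffM g h z : cdiff g z -> cdiff h z -> cdiff (fun x => g x * h x) z.
Proof. by move=> [l gl] [m hm]; exists (l * h z + g z * m); exact: cderivM. Qed.

Lemma cdiffB g h z : cdiff g z -> cdiff h z -> cdiff (fun x => g x - h x) z.
Proof. by move=> [l gl] [m hm]; exists (l - m); exact: cderivB. Qed.

Lemma cdiffV g z : g z != 0 -> cdiff g z -> cdiff (fun x => (g x)^-1) z.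
Proof. by move=> gz [l gl]; exists (- l / g z ^+ 2); exact: cderivV. Qed.

Lemma cdiff_cst (c : C) z : cdiff (fun=> c) z.
Proof. by exists 0; exact: cderiv_cst. Qed.

Lemma cdiff_id z : cdiff id z.
Proof. by exists 1; exact: cderiv_id. Qed.

Lemma cdiffX g z n : cdiff g z -> cdiff (fun x => g x ^+ n) z.
Proof.
move=> dg; elim: n => [|n IH].
  by under eq_fun do rewrite expr0; exact: cdiff_cst.
by under eq_fun do rewrite exprS; exact: cdiffM.
Qed.

Lemma cderiv_comp g h z l m : is_cderiv g z l -> is_cderiv h (g z) m ->
  is_cderiv (fun x => h (g x)) z (m * l).
Proof.
move=> gl hm; have cg := cderiv_cont gl.
move: gl hm => /cderivP[p [cp pz gp]] /cderivP[q [cq qz hq]]; apply/cderivP.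
exists (fun x => q (g x) * p x); split; rewrite ?pz ?qz //.
  by apply: ccontM => //; exact: ccont_comp.
move=> x; rewrite (hq (g x)) (_ : g x - g z = p x * (x - z)) ?mulrA //.
by rewrite (gp x) (addrC (g z)) addrK.
Qed.

Lemma cderiv_unique g z l m : is_cderiv g z l -> is_cderiv g z m -> l = m.
Proof.
move=> gl gm; apply/eqP/negPn/negP; rewrite -subr_eq0 -cabs_gt0 => lm.
have [d [d0 Hd]] := gl _ (divr_gt0 lm (ltr0Sn _ 1)).
have [d' [d0' Hd']] := gm _ (divr_gt0 lm (ltr0Sn _ 1)).
pose k := (Num.min d d' / 2)%:C%C : C.
have m0 : 0 < Num.min d d' by rewrite lt_min d0.
have ck : cabs k = Num.min d d' / 2 by rewrite cabs_real gtr0_norm ?divr_gt0.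
have k0 : 0 < cabs k by rewrite ck divr_gt0.
have km : cabs k < Num.min d d' by rewrite ck gtr_pMr // invf_lt1 // ltr1n.
move: (km); rewrite lt_min => /andP[kd kd'].
have A := Hd k; rewrite k0 kd in A; have {}A := A isT.
have B := Hd' k; rewrite k0 kd' in B; have {}B := B isT.
set q := (_ / k) in A B.
have := cabs_triangle q l m; rewrite (cabs_distC l q); lra.
Qed.

Lemma cderiv_le g z l (K d : R) : is_cderiv g z l -> 0 < d ->
  (forall x, cabs (x - z) < d -> cabs (g x - g z) <= K * cabs (x - z)) -> cabs l <= K.
Proof.
move=> gl d0 H; apply/ler_addgt0Pr => e e0.
have [d' [d0' Hd']] := gl _ e0.
pose k := (Num.min d d' / 2)%:C%C : C.
have m0 : 0 < Num.min d d' by rewrite lt_min d0.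
have ck : cabs k = Num.min d d' / 2 by rewrite cabs_real gtr0_norm ?divr_gt0.
have k0 : 0 < cabs k by rewrite ck divr_gt0.
have km : cabs k < Num.min d d' by rewrite ck gtr_pMr // invf_lt1 // ltr1n.
move: (km); rewrite lt_min => /andP[kd kd'].
have B := Hd' k; rewrite k0 kd' in B; have {}B := B isT.
have A := H (z + k); rewrite (addrC z k) addrK in A; have {}A := A kd.
rewrite [k + z]addrC in A.
have := cabs_le_sub l ((g (z + k) - g z) / k); rewrite cabs_distC cabs_div.
move/le_trans; apply; apply: lerD; last exact: ltW.
by rewrite ler_pdivrMr.
Qed.


End ComplexBasics.

(** * Sequential compactness and extreme values in the plane *)

Section Compactness.
Variable R : realType.
Local Notation C := R[i].
Implicit Types (x y z w : C) (A : set C) (u : nat -> C).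

Definition ccvg u l := forall e : R, 0 < e -> exists N, forall n, (N <= n)%N -> cabs (u n - l) < e.

Definition cclosed A := forall u l, (forall n, A (u n)) -> ccvg u l -> A l.

Lemma increasing_seq_ge (f : nat -> nat) : increasing_seq f -> forall n, (n <= f n)%N.
Proof.
move=> incf; elim=> // n IH; apply: leq_ltn_trans IH _.
by rewrite ltnNge; have := incf n.+1 n; rewrite !leEnat => ->; rewrite ltnn.
Qed.

Lemma real_bolzano (v : nat -> R) (B : R) : (forall n, `|v n| <= B) ->
  exists f : nat -> nat, increasing_seq f /\ exists l : R,
    forall e : R, 0 < e -> exists N, forall n, (N <= n)%N -> `|v (f n) - l| < e.
Proof.
move=> vB; have bv : bounded_fun (v : R^nat).
  by exists B; split; [exact: num_real|move=> M BM n _; apply: le_trans (vB n) (ltW BM)].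
have [f incf /cvg_ex[l /cvgrPdist_lt cl]] := bolzano_weierstrass bv.
exists f; split=> //; exists l => e e0.
have [N _ HN] := cl e e0; exists N => n Nn.
by rewrite distrC; exact: HN.
Qed.

Lemma complex_bolzano u (B : R) : (forall n, cabs (u n) <= B) ->
  exists f : nat -> nat, (forall n, (n <= f n)%N) /\ exists l, ccvg (fun n => u (f n)) l.
Proof.
move=> uB.
have [f [incf [a Ha]]] := @real_bolzano (fun n => Re (u n)) B
  (fun n => le_trans (Re_le_cabs _) (uB n)).
have [g [incg [b Hb]]] := @real_bolzano (fun n => Im (u (f n))) B
  (fun n => le_trans (Im_le_cabs _) (uB (f n))).
exists (fun n => f (g n)); split.
  by move=> n; apply: leq_trans (increasing_seq_ge incg n) (increasing_seq_ge incf _).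
exists (Complex a b) => e e0.
have [N1 HN1] := Ha _ (divr_gt0 e0 (ltr0Sn _ 1)).
have [N2 HN2] := Hb _ (divr_gt0 e0 (ltr0Sn _ 1)).
exists (maxn N1 N2) => n; rewrite geq_max => /andP[n1 n2].
apply: le_lt_trans (cabs_ReIm _) _; rewrite Re_sub Im_sub /= (splitr e) ltrD //.
  by apply: HN1; apply: leq_trans n1 (increasing_seq_ge incg _).
exact: HN2.
Qed.

Lemma ccvg_unique u l m : ccvg u l -> ccvg u m -> l = m.
Proof.
move=> ul um; apply/eqP/negPn/negP; rewrite -subr_eq0 -cabs_gt0 => lm.
have [N HN] := ul _ (divr_gt0 lm (ltr0Sn _ 1)).
have [N' HN'] := um _ (divr_gt0 lm (ltr0Sn _ 1)).
have := HN _ (leq_maxl N N'); have := HN' _ (leq_maxr N N').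
have := cabs_triangle (u (maxn N N')) l m; rewrite (cabs_distC l (u _)); lra.
Qed.

Lemma ccvg_shift u l k : ccvg u l -> ccvg (fun n => u (n + k)%N) l.
Proof.
move=> ul e /ul[N HN]; exists N => n Nn; apply: HN.
exact: leq_trans Nn (leq_addr _ _).
Qed.

Lemma ccvg_le u l x (B : R) : ccvg u l -> (exists N, forall n, (N <= n)%N -> cabs (u n - x) <= B) ->
  cabs (l - x) <= B.
Proof.
move=> ul [N0 H]; apply/ler_addgt0Pr => e e0; have [N HN] := ul _ e0.
have := H _ (leq_maxl N0 N); have := HN _ (leq_maxr N0 N).
have := cabs_triangle (u (maxn N0 N)) l x; rewrite (cabs_distC l (u _)); lra.
Qed.

(** The sequence is bounded, so Bolzano-Weierstrass supplies a limit along a subsequence, and the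
    tail bound carries it over to the whole sequence. *)
Lemma geom_cauchy u (B : R) : (forall n, cabs (u n.+1 - u n) <= B * 2^-1 ^+ n) ->
  exists l, ccvg u l.
Proof.
move=> H.
have B0 : 0 <= B by have := H 0%N; rewrite expr0 mulr1; apply: le_trans; exact: cabs_ge0.
(* The exact value of the finite geometric sum is kept, so that the induction on [k] closes without
   loss. *)
have D n k : cabs (u (n + k)%N - u n) <= B * 2^-1 ^+ n * (2 - 2 * 2^-1 ^+ k).
  elim: k => [|k IH]; first by rewrite addn0 subrr cabs0 expr0 mulr1 subrr mulr0.
  apply: le_trans (cabs_triangle (u (n + k)%N) _ _) _.
  rewrite addnS; apply: le_trans (lerD (H _) IH) _.
  rewrite exprD exprS; set p := 2^-1 ^+ n; set q := 2^-1 ^+ k.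
  by rewrite le_eqVlt; apply/orP; left; apply/eqP; field.
have half_ge0 k : 0 <= (2^-1 : R) ^+ k by rewrite exprn_ge0 // invr_ge0.
have D2 n k : cabs (u (n + k)%N - u n) <= 2 * B * 2^-1 ^+ n.
  apply: le_trans (D n k) _; rewrite -subr_ge0.
  have -> : 2 * B * 2^-1 ^+ n - B * 2^-1 ^+ n * (2 - 2 * 2^-1 ^+ k) =
    2 * (B * 2^-1 ^+ n * 2^-1 ^+ k) by set p := 2^-1 ^+ n; set q := 2^-1 ^+ k; ring.
  by rewrite !mulr_ge0.
have bd n : cabs (u n) <= cabs (u 0%N) + 2 * B.
  apply: le_trans (cabs_le_sub _ (u 0%N)) _; rewrite lerD2l.
  by have := D2 0%N n; rewrite add0n expr0 mulr1.
have [f [fn [l fl]]] := complex_bolzano bd.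
exists l => e e0.
have [N HN] := fl _ (divr_gt0 e0 (ltr0Sn _ 1)).
have [M HM] : exists M, 2 * B * 2^-1 ^+ M < e / 4.
  have [M HM] : exists M, (2 * B) / (e / 4) < 2 ^+ M.
    exists (Num.bound (2 * B / (e / 4))); apply: upper_nthrootP.
    exact: leqnn.
  exists M; rewrite exprVn ltr_pdivrMr ?exprn_gt0 // [ltRHS]mulrC -ltr_pdivrMr //.
  by rewrite divr_gt0.
exists M => n Mn.
pose k := maxn N n.
have nf : (n <= f k)%N by apply: leq_trans (fn k); exact: leq_maxr.
have A1 := HN k (leq_maxl _ _).
have mono_half : 2^-1 ^+ n <= (2^-1 : R) ^+ M.
  by apply: ler_wiXn2l => //; rewrite ?invr_ge0 // invf_le1 // ler1n.
have A2 : cabs (u (f k) - u n) < e / 4.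
  have := D2 n (f k - n)%N; rewrite subnKC // => /le_lt_trans; apply.
  apply: le_lt_trans HM; apply: ler_wpM2l => //; exact: mulr_ge0.
have := cabs_triangle (u (f k)) (u n) l; rewrite (cabs_distC (u n) (u (f k))); lra.
Qed.

(** A sequence along which [phi] tends to its supremum, or to infinity, clusters at a point of [A],
    and upper semicontinuity there bounds the supremum by the value at that point. *)
Lemma cclosed_EVT A (phi : C -> R) (B : R) x0 : A x0 ->
  (forall x, A x -> cabs x <= B) -> cclosed A ->
  (forall x, A x -> forall e : R, 0 < e -> exists d : R, 0 < d /\
     forall y, A y -> cabs (y - x) < d -> phi y < phi x + e) ->
  exists x, A x /\ forall y, A y -> phi y <= phi x.
Proof.
move=> Ax0 AB Acl usc.
have lim u : (forall n, A (u n)) -> exists l, A l /\ forall e : R, 0 < e -> forall N,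
    exists n, (N <= n)%N /\ phi (u n) < phi l + e.
  move=> Au; have [f [fn [l fl]]] := complex_bolzano (fun n => AB _ (Au n)).
  have Al : A l by apply: (Acl _ _ _ fl) => n; exact: Au.
  exists l; split=> // e e0 N; have [d [d0 Hd]] := usc l Al e e0.
  have [M HM] := fl d d0; exists (f (maxn M N)); split.
    by apply: leq_trans (fn _); exact: leq_maxr.
  by apply: Hd; [exact: Au|apply: HM; exact: leq_maxl].
pose S := [set phi x | x in A].
have [hub|nub] := pselect (has_ubound S).
  have hs : has_sup S by split=> //; exists (phi x0), x0.
  have /choice[u Hu] : forall n : nat, exists x, A x /\ sup S - n.+1%:R^-1 < phi x.
    move=> n; have n0 : 0 < n.+1%:R^-1 :> R by rewrite invr_gt0.
    have [_ [x Ax <-] H] := sup_adherent n0 hs.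
    by exists x.
  have [l [Al Hl]] := lim u (fun n => (Hu n).1).
  exists l; split=> // y Ay; apply: (@le_trans _ _ (sup S)).
    by apply: ub_le_sup => //; exists y.
  apply/ler_addgt0Pr => e e0.
  have [N HN] : exists N : nat, N.+1%:R^-1 < e / 2.
    exists (Num.bound (e / 2)^-1); rewrite invf_plt ?posrE ?divr_gt0 //.
    apply: lt_le_trans (archi_boundP _) _; first by rewrite invr_ge0 divr_ge0 // ltW.
    by rewrite ler_nat.
  have [n [Nn phin]] := Hl _ (divr_gt0 e0 (ltr0Sn _ 1)) N.
  have := (Hu n).2; have : n.+1%:R^-1 <= N.+1%:R^-1 :> R by rewrite lef_pV2 ?posrE // ler_nat.
  move: HN phin; move: (n.+1%:R^-1) (N.+1%:R^-1) => a b; lra.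
have /choice[u Hu] : forall n : nat, exists x, A x /\ n%:R < phi x.
  move=> n; apply: contrapT => H; apply: nub; exists n%:R => _ [x Ax <-].
  by rewrite leNgt; apply/negP => nx; apply: H; exists x.
have [l [Al Hl]] := lim u (fun n => (Hu n).1).
have [n [Nn phin]] := Hl 1 ltr01 (Num.bound (phi l + 1)).
exfalso; have := (Hu n).2; apply/negP; rewrite -leNgt; apply: le_trans (ltW phin) _.
have [p0|p0] := leP 0 (phi l + 1); last by apply: le_trans (ltW p0) _.
apply: le_trans (ltW (archi_boundP p0)) _; by rewrite ler_nat.
Qed.

Definition ccont_on A (h : C -> C) := forall x, A x -> forall e : R, 0 < e ->
  exists d : R, 0 < d /\ forall y, A y -> cabs (y - x) < d -> cabs (h y - h x) < e.

Lemma cabs_max A h (B : R) x0 : A x0 -> (forall x, A x -> cabs x <= B) -> cclosed A ->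
  ccont_on A h -> exists x, A x /\ forall y, A y -> cabs (h y) <= cabs (h x).
Proof.
move=> Ax0 AB Acl ch; apply: (cclosed_EVT Ax0 AB Acl) => x Ax e e0.
have [d [d0 Hd]] := ch x Ax e e0; exists d; split=> // y Ay yx.
by apply: le_lt_trans (cabs_le_sub _ (h x)) _; rewrite ltrD2l; exact: Hd.
Qed.

Lemma cabs_bounded A h (B : R) : (forall x, A x -> cabs x <= B) -> cclosed A ->
  ccont_on A h -> exists M : R, 0 < M /\ forall y, A y -> cabs (h y) <= M.
Proof.
move=> AB Acl ch; have [[x0 Ax0]|nA] := pselect (exists x, A x); last first.
  by exists 1; split=> // y Ay; exfalso; apply: nA; exists y.
have [x [Ax Hx]] := cabs_max Ax0 AB Acl ch.
exists (cabs (h x) + 1); split; first by rewrite ltr_wpDl ?cabs_ge0.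
by move=> y /Hx H; apply: le_trans H _; rewrite lerDl.
Qed.

Lemma ccont_at_on A h : (forall x, A x -> ccont_at h x) -> ccont_on A h.
Proof.
move=> H x Ax e e0; have [d [d0 Hd]] := H x Ax e e0.
by exists d; split=> // y _; exact: Hd.
Qed.

Lemma cclosed_cball z (r : R) : cclosed [set x | cabs (x - z) <= r].
Proof. by move=> u l Hu ul /=; apply: ccvg_le ul _; exists 0%N => n _; exact: Hu. Qed.

Lemma cclosed_cobball z (r : R) : cclosed [set x | r <= cabs (x - z)].
Proof.
move=> u l Hu ul /=; apply/ler_addgt0Pr => e e0; have [N HN] := ul _ e0.
have := HN _ (leqnn N); have := Hu N => /=.
have := cabs_triangle l (u N) z; lra.
Qed.

Lemma cclosedI A A' : cclosed A -> cclosed A' -> cclosed (A `&` A').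
Proof. by move=> cA cA' u l Hu ul; split; [apply: cA ul|apply: cA' ul] => n; case: (Hu n). Qed.

Definition cclosure A : set C := [set x | forall e : R, 0 < e -> exists y, A y /\ cabs (y - x) < e].

Lemma cclosed_closure A : cclosed (cclosure A).
Proof.
move=> u l Hu ul e e0; have [N HN] := ul _ (divr_gt0 e0 (ltr0Sn _ 1)).
have [y [Ay yu]] := Hu N _ (divr_gt0 e0 (ltr0Sn _ 1)); exists y; split=> //.
have := HN _ (leqnn N); have := cabs_triangle (u N) y l; lra.
Qed.

Lemma sub_cclosure A : A `<=` cclosure A.
Proof. by move=> x Ax e e0; exists x; rewrite subrr cabs0. Qed.

Lemma cball_bound z (r : R) x : cabs (x - z) <= r -> cabs x <= cabs z + r.
Proof. by move=> H; apply: le_trans (cabs_le_sub _ z) _; rewrite lerD2l. Qed.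

End Compactness.

(** * Goursat's theorem *)

Section Goursat.
Variable R : realType.
Local Notation C := R[i].
Local Notation ii := (Complex 0 1 : C).

Definition primitive (f F : R -> R) (A : R) := forall x, -A < x < A -> is_derive x 1 F (f x).

Lemma primitive_exists (f : R -> R) (A : R) : 0 < A -> continuous f -> exists F, primitive f F A.
Proof.
move=> A0 cf; exists (fun x => (\int[@lebesgue_measure R]_(t in [set` `[-A, x]]) (f t))%R).
move=> x /andP[Ax xA].
have fi : (@lebesgue_measure R).-integrable `[-A, A] (EFin \o f).
  apply: continuous_compact_integrable; first exact: segment_compact.
  by apply: continuous_subspaceT => y; exact: cf.
have [dF F'] := continuous_FTC1_closed xA fi Ax (cf x).
by apply: (DeriveDef dF); rewrite -F' derive1E.
Qed.

Lemma primitive_cont f F A (a b : R) : primitive f F A -> -A < a -> b < A ->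
  {within `[a, b], continuous F}.
Proof.
move=> pF Aa bA; apply: derivable_within_continuous => x.
rewrite in_itv /= => /andP[ax xb].
have /pF[] // : - A < x < A by rewrite (lt_le_trans Aa ax) (le_lt_trans xb bA).
Qed.

Lemma primitive_bounds f F A (a b m M : R) : primitive f F A -> -A < a -> a <= b -> b < A ->
  (forall x, a <= x <= b -> m <= f x <= M) ->
  m * (b - a) <= F b - F a <= M * (b - a).
Proof.
move=> pF Aa ab bA H.
have [|c + ->] := MVT_segment (f := F) (df := f) ab _ (primitive_cont pF Aa bA).
  move=> x; rewrite in_itv /= => /andP[ax xb]; apply: pF.
  by rewrite (lt_trans Aa ax) (lt_trans xb bA).
rewrite in_itv /= => /H/andP[mf fM].
by rewrite !ler_wpM2r // subr_ge0.
Qed.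

Lemma primitiveD f F g G A : primitive f F A -> primitive g G A ->
  primitive (fun x => f x + g x) (fun x => F x + G x) A.
Proof. by move=> pF pG x xA; have := pF x xA; have := pG x xA => ? ?; exact: is_deriveD. Qed.

Lemma primitiveZ (k : R) f F A : primitive f F A ->
  primitive (fun x => k * f x) (fun x => k * F x) A.
Proof. by move=> pF x xA; have := pF x xA => ?; exact: is_deriveZ. Qed.

Lemma primitive_sub f F A B : B <= A -> primitive f F A -> primitive f F B.
Proof.
move=> BA pF x /andP[Bx xB]; apply: pF.
by rewrite (lt_le_trans xB BA) andbT (le_lt_trans _ Bx) // lerN2.
Qed.

(** The integral as the increment of any primitive on an interval around both endpoints: the
    orientation [b < a] needs no separate case, and linearity is inherited from primitives. The
    default [0] is never met for a continuous function. *)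
Definition rint (f : R -> R) (a b : R) : R :=
  xget 0 [set v | exists F A, [/\ primitive f F A, -A < a < A, -A < b < A & v = F b - F a]].

Lemma primitive_unique f F G A B a b : primitive f F A -> primitive f G B ->
  -A < a < A -> -A < b < A -> -B < a < B -> -B < b < B -> F b - F a = G b - G a.
Proof.
wlog ab : a b / a <= b.
  move=> W pF pG aA bA aB bB; have [/W ab|/ltW/W ab] := leP a b; first exact: ab.
  by have := ab pF pG bA aA bB aB => H; apply: oppr_inj; rewrite !opprB.
move=> pF pG /andP[aA _] /andP[_ bA] /andP[aB _] /andP[_ bB].
pose D := Num.min A B.
have := primitiveD (primitive_sub (_ : D <= A) pF) (primitiveZ (-1) (primitive_sub (_ : D <= B) pG)).
rewrite /D !ge_min !lexx orbT => /(_ isT isT) pD.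
have m1 : - Num.min A B < a by case: (leP A B) => _.
have m2 : b < Num.min A B by rewrite lt_min bA.
have := primitive_bounds (m := 0) (M := 0) pD m1 ab m2.
case/(_ _)/andP.
  by move=> x _; rewrite mulN1r subrr lexx.
rewrite !mul0r => H1 H2; lra.
Qed.

Lemma rintE f F A a b : primitive f F A -> -A < a < A -> -A < b < A -> rint f a b = F b - F a.
Proof.
move=> pF aA bA; rewrite /rint; case: xgetP => [v _ [G [B [pG aB bB ->]]]|/(_ (F b - F a))[]].
  exact: primitive_unique pG pF _ _ _ _.
by exists F, A.
Qed.

Lemma rint_range (a b c : R) : exists A : R, [/\ 0 < A, -A < a < A, -A < b < A & -A < c < A].
Proof.
exists (`|a| + `|b| + `|c| + 1).
have h (x : R) : - `|x| <= x <= `|x| by rewrite -ler_norml.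
have /andP[a1 a2] := h a; have /andP[b1 b2] := h b; have /andP[c1 c2] := h c.
have a0 := normr_ge0 a; have b0 := normr_ge0 b; have c0 := normr_ge0 c.
split; last 3 [by apply/andP; split; lra]; lra.
Qed.

Lemma rint_chasles f a b c : continuous f -> rint f a b + rint f b c = rint f a c.
Proof.
move=> cf; have [A [A0 aA bA cA]] := rint_range a b c.
have [F pF] := primitive_exists A0 cf.
by rewrite !(rintE pF) //; ring.
Qed.

Lemma rintD f g a b : continuous f -> continuous g ->
  rint (fun x => f x + g x) a b = rint f a b + rint g a b.
Proof.
move=> cf cg; have [A [A0 aA bA _]] := rint_range a b 0.
have [F pF] := primitive_exists A0 cf; have [G pG] := primitive_exists A0 cg.
by rewrite (rintE pF) // (rintE pG) // (rintE (primitiveD pF pG)) //; ring.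
Qed.

Lemma rintZ (k : R) (f : R -> R) a b : continuous f -> rint (fun x => k * f x) a b = k * rint f a b.
Proof.
move=> cf; have [A [A0 aA bA _]] := rint_range a b 0.
have [F pF] := primitive_exists A0 cf.
by rewrite (rintE pF) // (rintE (primitiveZ k pF)) //; ring.
Qed.

Lemma rint_cst (k : R) a b : rint (fun=> k) a b = k * (b - a).
Proof.
have [A [A0 aA bA _]] := rint_range a b 0.
have pF : primitive (fun=> k) (fun x => k * x) A.
  by move=> x _; have := @is_deriveZ R R R id k x 1 1 (is_derive_id _ _) => h; rewrite -[X in is_derive _ _ _ X]mulr1.
by rewrite (rintE pF) //; ring.
Qed.

Lemma rint_lin (s0 : R) a b : rint (fun s => s - s0) a b = ((b - s0) ^+ 2 - (a - s0) ^+ 2) / 2.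
Proof.
have [A [A0 aA bA _]] := rint_range a b 0.
have pF : primitive (fun s => s - s0) (fun x => (x - s0) ^+ 2 / 2) A.
  move=> x _; apply: is_derive_eq; rewrite /GRing.scale /=.
  by field.
by rewrite (rintE pF) //; field.
Qed.

Lemma rint_bounds (f : R -> R) (a b m M : R) : continuous f -> a <= b -> (forall x, a <= x <= b -> m <= f x <= M) ->
  m * (b - a) <= rint f a b <= M * (b - a).
Proof.
move=> cf ab H; have [A [A0 aA bA _]] := rint_range a b 0.
have [F pF] := primitive_exists A0 cf.
rewrite (rintE pF) //; apply: (primitive_bounds pF) => //; first by case/andP: aA.
by case/andP: bA.
Qed.

Definition rccont (p : R -> C) := forall t (e : R), 0 < e -> exists d : R, 0 < d /\
  forall s, `|s - t| < d -> cabs (p s - p t) < e.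

Lemma rccont_Re p : rccont p -> continuous (fun t => Re (p t)).
Proof.
move=> cp t; apply/cvgrPdist_lt => e /(cp t)[d [d0 Hd]].
exists d => // s; rewrite /ball /= distrC => /Hd; rewrite distrC -Re_sub.
exact: le_lt_trans (Re_le_cabs _).
Qed.

Lemma rccont_Im p : rccont p -> continuous (fun t => Im (p t)).
Proof.
move=> cp t; apply/cvgrPdist_lt => e /(cp t)[d [d0 Hd]].
exists d => // s; rewrite /ball /= distrC => /Hd; rewrite distrC -Im_sub.
exact: le_lt_trans (Im_le_cabs _).
Qed.

Lemma rccontD p q : rccont p -> rccont q -> rccont (fun t => p t + q t).
Proof.
move=> cp cq t e e0; have e2 : 0 < e / 2 by rewrite divr_gt0.
have [d [d0 Hd]] := cp t _ e2; have [d' [d0' Hd']] := cq t _ e2.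
exists (Num.min d d'); split; first by rewrite lt_min d0.
move=> x; rewrite lt_min => /andP[/Hd A /Hd' B].
rewrite opprD addrACA; apply: le_lt_trans (cabsD _ _) _.
by rewrite (splitr e) ltrD.
Qed.

Lemma rccontZ (k : C) p : rccont p -> rccont (fun t => k * p t).
Proof.
move=> cp t e e0; have k0 : 0 < cabs k + 1 by rewrite ltr_wpDl ?cabs_ge0.
have [d [d0 Hd]] := cp t _ (divr_gt0 e0 k0).
exists d; split=> // x /Hd; rewrite -mulrBr cabsM ltr_pdivlMr // mulrC.
apply: le_lt_trans; rewrite ler_wpM2r ?cabs_ge0 // lerDl //.
Qed.

Lemma rccont_cst (k : C) : rccont (fun=> k).
Proof. by move=> t e e0; exists 1; split=> // x _; rewrite subrr cabs0. Qed.

Lemma rccont_lin (s0 : R) : rccont (fun s => ((s - s0)%:C)%C).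
Proof.
move=> t e e0; exists e; split=> // s; rewrite -(rmorphB (real_complex R)) cabs_real.
by have -> : s - s0 - (t - s0) = s - t by ring.
Qed.

Definition cint (p : R -> C) (a b : R) : C :=
  Complex (rint (fun t => Re (p t)) a b) (rint (fun t => Im (p t)) a b).

Lemma cint_chasles p a b c : rccont p -> cint p a b + cint p b c = cint p a c.
Proof.
move=> cp; apply/eqP; rewrite eq_complex /=.
by rewrite !rint_chasles ?eqxx //; [exact: rccont_Im|exact: rccont_Re].
Qed.

Lemma cintD p q a b : rccont p -> rccont q ->
  cint (fun t => p t + q t) a b = cint p a b + cint q a b.
Proof.
move=> cp cq; apply/eqP; rewrite eq_complex /=; apply/andP; split; apply/eqP.
  rewrite -rintD; try exact: rccont_Re.
  by congr (rint _ a b); apply/funext => t; case: (p t) (q t) => ? ? [].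
rewrite -rintD; try exact: rccont_Im.
by congr (rint _ a b); apply/funext => t; case: (p t) (q t) => ? ? [].
Qed.

Lemma cintZ (k : C) p a b : rccont p -> cint (fun t => k * p t) a b = k * cint p a b.
Proof.
move=> cp; case: k => u v; apply/eqP; rewrite eq_complex /=.
have cR := rccont_Re cp; have cI := rccont_Im cp.
have cZ (k : R) (f : R -> R) : continuous f -> continuous (fun x => k * f x).
  by move=> cf x; apply: continuousM; [exact: cvg_cst|exact: cf].
apply/andP; split; apply/eqP.
  rewrite -mulNr -!rintZ //; rewrite -rintD; try exact: cZ.
  by congr (rint _ a b); apply/funext => t; case: (p t) => ? ? /=; ring.
rewrite -!rintZ // -rintD; try exact: cZ.
by congr (rint _ a b); apply/funext => t; case: (p t) => ? ? /=; ring.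
Qed.

Lemma cint_cst (k : C) a b : cint (fun=> k) a b = k * ((b - a)%:C)%C.
Proof.
case: k => u v; apply/eqP; rewrite /cint !rint_cst eq_complex /=.
by apply/andP; split; apply/eqP; ring.
Qed.

Lemma cint_lin (s0 : R) a b :
  cint (fun s => ((s - s0)%:C)%C) a b = ((((b - s0) ^+ 2 - (a - s0) ^+ 2) / 2)%:C)%C.
Proof. by rewrite /cint /= rint_lin rint_cst mul0r. Qed.

Lemma cint_bound p a b (M : R) : rccont p -> a <= b ->
  (forall t, a <= t <= b -> cabs (p t) <= M) -> cabs (cint p a b) <= 2 * M * (b - a).
Proof.
move=> cp ab H; apply: le_trans (cabs_ReIm _) _ => /=.
have h (f : R -> R) : continuous f -> (forall t, a <= t <= b -> `|f t| <= M) ->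
    `|rint f a b| <= M * (b - a).
  move=> cf Hf; rewrite ler_norml -mulNr; apply: rint_bounds => // x /Hf.
  by rewrite ler_norml.
have -> : 2 * M * (b - a) = M * (b - a) + M * (b - a) by ring.
apply: lerD; apply: h; try exact: rccont_Re; try exact: rccont_Im.
  by move=> t /H; apply: le_trans; exact: Re_le_cabs.
by move=> t /H; apply: le_trans; exact: Im_le_cabs.
Qed.

(** Separate continuity is enough, since integrals are only taken along horizontal and vertical
    segments. *)
Definition sepcont (H : R -> R -> C) :=
  (forall t, rccont (fun s => H s t)) /\ (forall s, rccont (fun t => H s t)).

(** The integral of [H s t] against [d(s + i t)], counterclockwise around the rectangle [[a, b] x
    [c, d]]. *)
Definition bdry (H : R -> R -> C) (a b c d : R) : C :=
  cint (fun s => H s c) a b - cint (fun s => H s d) a b +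
  ii * (cint (fun t => H b t) c d - cint (fun t => H a t) c d).

Lemma bdry_hsplit H a m b c d : sepcont H -> bdry H a b c d = bdry H a m c d + bdry H m b c d.
Proof.
move=> [H1 H2]; rewrite /bdry -(cint_chasles a m b (H1 c)) -(cint_chasles a m b (H1 d)).
by ring.
Qed.

Lemma bdry_vsplit H a b c m d : sepcont H -> bdry H a b c d = bdry H a b c m + bdry H a b m d.
Proof.
move=> [H1 H2]; rewrite /bdry -(cint_chasles c m d (H2 a)) -(cint_chasles c m d (H2 b)).
by ring.
Qed.

Definition caffine (al l : C) (s0 t0 s t : R) : C := al + l * Complex (s - s0) (t - t0).

Lemma caffine_s al l s0 t0 s t :
  caffine al l s0 t0 s t = (al + l * ii * ((t - t0)%:C)%C) + l * ((s - s0)%:C)%C.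
Proof.
rewrite /caffine; have -> : Complex (s - s0) (t - t0) = ((s - s0)%:C)%C + ii * ((t - t0)%:C)%C.
  by apply/eqP; rewrite eq_complex /=; apply/andP; split; apply/eqP; ring.
by ring.
Qed.

Lemma caffine_t al l s0 t0 s t :
  caffine al l s0 t0 s t = (al + l * ((s - s0)%:C)%C) + l * ii * ((t - t0)%:C)%C.
Proof. by rewrite caffine_s; ring. Qed.

Lemma sepcont_caffine al l s0 t0 : sepcont (caffine al l s0 t0).
Proof.
split=> x.
  under eq_fun do rewrite caffine_s.
  by apply: rccontD (rccont_cst _) _; apply: rccontZ; exact: rccont_lin.
under eq_fun do rewrite caffine_t.
by apply: rccontD (rccont_cst _) _; apply: rccontZ; exact: rccont_lin.
Qed.

Lemma bdry_caffine al l s0 t0 a b c d : bdry (caffine al l s0 t0) a b c d = 0.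
Proof.
have hs t : cint (fun s => caffine al l s0 t0 s t) a b =
    (al + l * ii * ((t - t0)%:C)%C) * ((b - a)%:C)%C +
    l * ((((b - s0) ^+ 2 - (a - s0) ^+ 2) / 2)%:C)%C.
  under eq_fun do rewrite caffine_s.
  rewrite cintD; [|exact: rccont_cst|by apply: rccontZ; exact: rccont_lin].
  by rewrite cint_cst cintZ ?cint_lin //; exact: rccont_lin.
have ht s : cint (fun t => caffine al l s0 t0 s t) c d =
    (al + l * ((s - s0)%:C)%C) * ((d - c)%:C)%C +
    l * ii * ((((d - t0) ^+ 2 - (c - t0) ^+ 2) / 2)%:C)%C.
  under eq_fun do rewrite caffine_t.
  rewrite cintD; [|exact: rccont_cst|by apply: rccontZ; exact: rccont_lin].
  by rewrite cint_cst cintZ ?cint_lin //; exact: rccont_lin.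
rewrite /bdry !hs !ht.
move: ((((b - s0) ^+ 2 - _) / 2)%:C)%C ((((d - t0) ^+ 2 - _) / 2)%:C)%C => P Q.
have rB (u v : R) : ((u - v)%:C)%C = (u%:C)%C - (v%:C)%C by rewrite (rmorphB (real_complex R)).
rewrite !rB; move: (a%:C)%C (b%:C)%C (c%:C)%C (d%:C)%C (s0%:C)%C (t0%:C)%C ii => a' b' c' d' s' t' i'.
by ring.
Qed.

Lemma sepcontB H K : sepcont H -> sepcont K -> sepcont (fun s t => H s t - K s t).
Proof.
have E (p q : R -> C) : rccont p -> rccont q -> rccont (fun t => p t - q t).
  move=> cp cq; apply: rccontD => //; under eq_fun do rewrite -mulN1r; exact: rccontZ.
by move=> [h1 h2] [k1 k2]; split=> x; exact: E.
Qed.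

Lemma bdryB H K a b c d : sepcont H -> sepcont K ->
  bdry (fun s t => H s t - K s t) a b c d = bdry H a b c d - bdry K a b c d.
Proof.
move=> [h1 h2] [k1 k2].
have E (p q : R -> C) u v : rccont p -> rccont q ->
    cint (fun t => p t - q t) u v = cint p u v - cint q u v.
  move=> cp cq; rewrite cintD //; last by under eq_fun do rewrite -mulN1r; exact: rccontZ.
  by under [in X in _ + X]eq_fun do rewrite -mulN1r; rewrite cintZ // mulN1r.
by rewrite /bdry !E //; ring.
Qed.

Lemma bdry_bound H a b c d (M : R) : sepcont H -> a <= b -> c <= d ->
  (forall s t, a <= s <= b -> c <= t <= d -> cabs (H s t) <= M) ->
  cabs (bdry H a b c d) <= 4 * M * ((b - a) + (d - c)).
Proof.
move=> [h1 h2] ab cd HM.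
have A1 := cint_bound (h1 c) ab (fun s sab => HM s c sab (introT andP (conj (lexx c) cd))).
have A2 := cint_bound (h1 d) ab (fun s sab => HM s d sab (introT andP (conj cd (lexx d)))).
have A3 := cint_bound (h2 a) cd (fun t tcd => HM a t (introT andP (conj (lexx a) ab)) tcd).
have A4 := cint_bound (h2 b) cd (fun t tcd => HM b t (introT andP (conj ab (lexx b))) tcd).
rewrite /bdry; apply: le_trans (cabsD _ _) _; rewrite cabsM cabs_i mul1r.
apply: le_trans (lerD (cabsB _ _) (cabsB _ _)) _; lra.
Qed.

(** Complex differentiability relative to the closed rectangle, so that increments staying inside
    suffice at its boundary. *)
Definition cdiff2 (H : R -> R -> C) (a b c d s0 t0 : R) := exists l : C, forall e : R, 0 < e ->
  exists dl : R, 0 < dl /\ forall s t, a <= s <= b -> c <= t <= d ->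
    `|s - s0| < dl -> `|t - t0| < dl ->
    cabs (H s t - H s0 t0 - l * Complex (s - s0) (t - t0)) <= e * (`|s - s0| + `|t - t0|).

Lemma half_seq_lt (B e : R) : 0 < e -> exists n, B * 2^-1 ^+ n < e.
Proof.
move=> e0; exists (Num.bound (B / e)); rewrite exprVn ltr_pdivrMr ?exprn_gt0 //.
by rewrite [ltRHS]mulrC -ltr_pdivrMr //; apply: upper_nthrootP.
Qed.

(** Bisection: some quarter of the rectangle keeps at least a quarter of the boundary integral,
    while near the limit point [H] is affine up to an error too small to sustain it. *)
Theorem goursat H a b c d : a <= b -> c <= d -> sepcont H ->
  (forall s0 t0, a <= s0 <= b -> c <= t0 <= d -> cdiff2 H a b c d s0 t0) ->
  bdry H a b c d = 0.
Proof.
move=> ab cd sH dH; apply/eqP/negPn/negP; rewrite -cabs_gt0 => B0.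
set B := cabs _ in B0.
pose w n := (b - a) * 2^-1 ^+ n; pose h n := (d - c) * 2^-1 ^+ n.
have hp n : 0 <= (2^-1 : R) ^+ n by rewrite exprn_ge0 // invr_ge0.
have w0 n : 0 <= w n by rewrite mulr_ge0 // subr_ge0.
have h0 n : 0 <= h n by rewrite mulr_ge0 // subr_ge0.
have wS n : w n = w n.+1 + w n.+1 by rewrite /w exprS; move: (_ ^+ n) => q; field.
have hS n : h n = h n.+1 + h n.+1 by rewrite /h exprS; move: (_ ^+ n) => q; field.
pose big n (p : R * R) := B * 4^-1 ^+ n <= cabs (bdry H p.1 (p.1 + w n) p.2 (p.2 + h n)).
(* The choice function must be total; for a rectangle that is not large the new corner is
   arbitrary. *)
have step : forall np : nat * (R * R), exists p' : R * R, big np.1 np.2 ->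
    [/\ big np.1.+1 p', np.2.1 <= p'.1, p'.1 <= np.2.1 + w np.1.+1, np.2.2 <= p'.2 &
        p'.2 <= np.2.2 + h np.1.+1].
  move=> [n [x y]] /=; have [bg|nb] := pselect (big n (x, y)); last by exists (x, y).
  move: bg; rewrite /big /= => bg.
  set w' := w n.+1; set h' := h n.+1.
  have e1 : bdry H x (x + w n) y (y + h n) =
     bdry H x (x + w') y (y + h') + bdry H (x + w') (x + w' + w') y (y + h') +
     (bdry H x (x + w') (y + h') (y + h' + h') +
      bdry H (x + w') (x + w' + w') (y + h') (y + h' + h')).
    rewrite wS hS -/w' -/h' (addrA x w' w') (addrA y h' h') (bdry_vsplit _ _ _ (y + h') _ sH).
    by rewrite (bdry_hsplit x (x + w') _ y _ sH) (bdry_hsplit x (x + w') _ (y + h') _ sH).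
  rewrite e1 in bg.
  have {}bg := le_trans bg (le_trans (cabsD _ _) (lerD (cabsD _ _) (cabsD _ _))).
  have : 4^-1 ^+ n = 4 * 4^-1 ^+ n.+1 :> R by rewrite exprS mulrA divff ?mul1r.
  move=> e4; rewrite e4 in bg.
  have [l1|l1] := leP (B * 4^-1 ^+ n.+1) (cabs (bdry H x (x + w') y (y + h'))).
    by exists (x, y) => _ /=; rewrite lexx lerDl w0 lexx lerDl h0.
  have [l2|l2] := leP (B * 4^-1 ^+ n.+1) (cabs (bdry H (x + w') (x + w' + w') y (y + h'))).
    by exists (x + w', y) => _ /=; rewrite !lexx !lerDl w0 h0.
  have [l3|l3] := leP (B * 4^-1 ^+ n.+1) (cabs (bdry H x (x + w') (y + h') (y + h' + h'))).
    by exists (x, y + h') => _ /=; rewrite !lexx !lerDl w0 h0.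
  have [l4|l4] := leP (B * 4^-1 ^+ n.+1)
     (cabs (bdry H (x + w') (x + w' + w') (y + h') (y + h' + h'))).
    by exists (x + w', y + h') => _ /=; rewrite !lexx !lerDl w0 h0.
  exfalso; move: bg l1 l2 l3 l4; move: (4^-1 ^+ n.+1) => q; lra.
have [st Hst] := choice step.
pose p := fix p n := if n is n'.+1 then st (n', p n') else (a, c).
have bigp n : big n (p n).
  elim: n => [|n IH].
    by rewrite /big /= expr0 mulr1 /w /h expr0 !mulr1 !(addrC _ (_ - _)) !subrK.
  by have [] := Hst (n, p n) IH.
have x1 n : (p n).1 <= (p n.+1).1 by have [] := Hst (n, p n) (bigp n).
have x2 n : (p n.+1).1 + w n.+1 <= (p n).1 + w n.
  by have [_ _ H2 _ _] := Hst (n, p n) (bigp n); rewrite [w n]wS addrA lerD2r.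
have y1 n : (p n).2 <= (p n.+1).2 by have [] := Hst (n, p n) (bigp n).
have y2 n : (p n.+1).2 + h n.+1 <= (p n).2 + h n.
  by have [_ _ _ _ H2] := Hst (n, p n) (bigp n); rewrite [h n]hS addrA lerD2r.
have limit (x : nat -> R) (v : nat -> R) : (forall n, 0 <= v n) -> (forall n, x n <= x n.+1) ->
    (forall n, x n.+1 + v n.+1 <= x n + v n) -> exists s, forall n, x n <= s <= x n + v n.
  move=> v0 xi xd.
  have mx n k : x n <= x (n + k)%N.
    by elim: k => [|k IH]; rewrite ?addn0 // addnS; apply: le_trans IH (xi _).
  have md n k : x (n + k)%N + v (n + k)%N <= x n + v n.
    by elim: k => [|k IH]; rewrite ?addn0 // addnS; apply: le_trans (xd _) IH.
  have ub n m : x m <= x n + v n.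
    apply: le_trans (_ : x (m + n)%N <= _); first exact: mx.
    by rewrite addnC; apply: le_trans (md n m); rewrite lerDl.
  have hs : has_sup (range x) by split; [exists (x 0%N), 0%N|exists (x 0%N + v 0%N) => _ [m _ <-]].
  exists (sup (range x)) => n; apply/andP; split.
    by apply: ub_le_sup; [case: hs|exists n].
  by apply: ge_sup; [case: hs|move=> _ [m _ <-]].
have [s0 Hs0] := limit _ _ w0 x1 x2; have [t0 Ht0] := limit _ _ h0 y1 y2.
have pin n : a <= (p n).1 /\ (p n).1 + w n <= b /\ c <= (p n).2 /\ (p n).2 + h n <= d.
  elim: n => [|n [i1 [i2 [i3 i4]]]].
    by rewrite /w /h /= expr0 !mulr1 !(addrC _ (_ - _)) !subrK !lexx.
  split; first exact: le_trans i1 (x1 n).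
  split; first exact: le_trans (x2 n) i2.
  split; first exact: le_trans i3 (y1 n).
  exact: le_trans (y2 n) i4.
have sab : a <= s0 <= b.
  by have := Hs0 0%N; rewrite /w /= expr0 mulr1 (addrC a) subrK.
have tcd : c <= t0 <= d.
  by have := Ht0 0%N; rewrite /h /= expr0 mulr1 (addrC c) subrK.
have [l Hl] := dH s0 t0 sab tcd.
pose S := (b - a) + (d - c).
have S0 : 0 <= S by rewrite addr_ge0 // subr_ge0.
(* The affine part has zero boundary integral and the rest is at most [e (w n + h n)] on a boundary
   of length [2 (w n + h n)]. Both factors shrink like [2^-n], which cancels the [4^-n] of [big]. *)
have key e : 0 < e -> B <= 4 * e * S ^+ 2.
  move=> e0; have [dl [dl0 Hdl]] := Hl e e0.
  have [n Hn] := half_seq_lt S dl0.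
  have wn : w n < dl.
    by apply: le_lt_trans Hn; rewrite /w ler_wpM2r // /S lerDl subr_ge0.
  have hn : h n < dl.
    by apply: le_lt_trans Hn; rewrite /h ler_wpM2r // /S lerDr subr_ge0.
  have [i1 [i2 [i3 i4]]] := pin n.
  have sA := sepcont_caffine (H s0 t0) l s0 t0.
  have HM s t : (p n).1 <= s <= (p n).1 + w n -> (p n).2 <= t <= (p n).2 + h n ->
      cabs (H s t - caffine (H s0 t0) l s0 t0 s t) <= e * (w n + h n).
    move=> /andP[s1 s2] /andP[t1 t2].
    have /andP[s3 s4] := Hs0 n; have /andP[t3 t4] := Ht0 n.
    have sw : `|s - s0| <= w n by rewrite ler_norml; apply/andP; split; lra.
    have th : `|t - t0| <= h n by rewrite ler_norml; apply/andP; split; lra.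
    apply: (@le_trans _ _ (e * (`|s - s0| + `|t - t0|))); last first.
      by rewrite ler_pM2l // lerD.
    rewrite /caffine opprD addrA; apply: Hdl.
    - by rewrite (le_trans i1 s1) (le_trans s2 i2).
    - by rewrite (le_trans i3 t1) (le_trans t2 i4).
    - exact: le_lt_trans sw wn.
    - exact: le_lt_trans th hn.
  have := bdry_bound (sepcontB sH sA) _ _ HM.
  rewrite !lerDl => /(_ (w0 n) (h0 n)).
  rewrite bdryB // bdry_caffine subr0 => /(le_trans (bigp n)).
  rewrite (addrC (p n).1) (addrC (p n).2) !addrK.
  have -> : w n + h n = S * 2^-1 ^+ n by rewrite /w /h -mulrDl.
  have e4 : 4^-1 ^+ n = 2^-1 ^+ n * 2^-1 ^+ n :> R.
    by rewrite -exprMn; congr (_ ^+ n); rewrite -invfM -natrM.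
  rewrite e4; have q0 : 0 < (2^-1 : R) ^+ n by rewrite exprn_gt0 // invr_gt0.
  move: (2^-1 ^+ n) q0 => q q0.
  have -> : 4 * (e * (S * q)) * (S * q) = 4 * e * S ^+ 2 * (q * q) by ring.
  by rewrite ler_pM2r // mulr_gt0.
have S20 : 0 <= S ^+ 2 by rewrite exprn_ge0.
have e0 : 0 < B / (8 * (S ^+ 2 + 1)) by rewrite divr_gt0 // mulr_gt0 // ltr_wpDl.
have := key _ e0; rewrite leNgt => /negP; apply.
have -> : 4 * (B / (8 * (S ^+ 2 + 1))) * S ^+ 2 = B * (S ^+ 2 / (S ^+ 2 + 1) / 2).
  by field; rewrite gt_eqF // ltr_wpDl.
rewrite gtr_pMr // ltr_pdivrMr // mul1r ltr_pdivrMr; last by rewrite ltr_wpDl.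
lra.
Qed.

End Goursat.

(** * The maximum principle *)

Section MaximumPrinciple.
Variable R : realType.
Local Notation C := R[i].

Lemma is_derive_eps (f : R -> R) (x l : R) : is_derive x 1 f l ->
  forall e : R, 0 < e -> exists d : R, 0 < d /\
    forall h, `|h| < d -> `|f (x + h) - f x - l * h| <= e * `|h|.
Proof.
move=> [df dl] e e0.
have /cvgrPdist_lt /(_ e e0) [d d0 Hd] : h^-1 *: (f (h *: (1 : R) + x) - f x) @[h --> 0^'] --> l.
  by rewrite -dl; exact: df.
exists d; split=> // h hd.
have [->|h0] := eqVneq h 0; first by rewrite addr0 subrr mulr0 subr0 normr0 mulr0.
have := Hd h; rewrite /ball_ /= sub0r normrN => /(_ hd h0).
rewrite /GRing.scale /= mulr1 => /ltW H.
have -> : f (x + h) - f x - l * h = - ((l - h^-1 * (f (h + x) - f x)) * h).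
  by rewrite (addrC x h); field.
by rewrite normrN normrM ler_wpM2r.
Qed.

Definition ce (z : C) : C := Complex (expR (Re z) * cos (Im z)) (expR (Re z) * sin (Im z)).

Lemma ceD z w : ce (z + w) = ce z * ce w.
Proof.
case: z w => a b [c d]; apply/eqP; rewrite eq_complex /ce /= expRD cosD sinD.
by apply/andP; split; apply/eqP; ring.
Qed.

Lemma cabs_ce z : cabs (ce z) = expR (Re z).
Proof.
rewrite /cabs /ce !exprMn -mulrDr cos2Dsin2 mulr1 sqrtr_sqr ger0_norm //; exact: expR_ge0.
Qed.

Lemma ce_small (e : R) : 0 < e -> exists d : R, 0 < d /\
  forall h : C, cabs h < d -> cabs (ce h - 1 - h) <= e * cabs h.
Proof.
move=> e0; have [e' [e'0 e'1 e'8]] : exists e' : R, [/\ 0 < e', e' <= 1 & e' <= e / 8].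
  by exists (Num.min 1 (e / 8)); rewrite lt_min ltr01 divr_gt0 // !ge_min !lexx orbT.
have [d1 [d10 H1]] := is_derive_eps (@is_derive_expR R 0) e'0.
have [d2 [d20 H2]] := is_derive_eps (@is_derive_cos R 0) e'0.
have [d3 [d30 H3]] := is_derive_eps (@is_derive_sin R 0) e'0.
exists (Num.min (Num.min d1 d2) (Num.min d3 e')); split; first by rewrite !lt_min d10 d20 d30 e'0.
move=> h; rewrite !lt_min => /andP[/andP[hd1 hd2] /andP[hd3 he]].
have u1 := Re_le_cabs h; have v1 := Im_le_cabs h.
case: h hd1 hd2 hd3 he u1 v1 => u v hd1 hd2 hd3 he /= u1 v1.
set c := cabs (Complex u v) in hd1 hd2 hd3 he u1 v1 *.
have c0 : 0 <= c by exact: cabs_ge0.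
have := H1 u (le_lt_trans u1 hd1); have := H2 v (le_lt_trans v1 hd2).
have := H3 v (le_lt_trans v1 hd3).
rewrite !add0r expR0 cos0 sin0 oppr0 mul0r mul1r !subr0 mul1r ?oppr0 ?addr0 => K3 K2 K1.
have K1' : `|expR u - 1 - u| <= e' * c by apply: le_trans K1 _; rewrite ler_pM2l.
have K2' : `|cos v - 1| <= e' * c by apply: le_trans K2 _; rewrite ler_pM2l.
have K3' : `|sin v - v| <= e' * c by apply: le_trans K3 _; rewrite ler_pM2l.
have ec : e' * c <= c by rewrite ler_piMl.
have c1 : c <= 1 by apply: le_trans (ltW he) e'1.
apply: le_trans (cabs_ReIm _) _ => /=.
have cv : `|cos v| <= 1 by exact: cos_max.
have -> : expR u * cos v - 1 - u = (expR u - 1 - u) * cos v + (1 + u) * (cos v - 1) by ring.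
have -> : expR u * sin v - 0 - v = expR u * (sin v - v) + (expR u - 1 - u) * v + u * v by ring.
have B1 : `|(expR u - 1 - u) * cos v + (1 + u) * (cos v - 1)| <= 3 * (e' * c).
  apply: le_trans (ler_normD _ _) _; rewrite !normrM.
  have a1 : `|expR u - 1 - u| * `|cos v| <= e' * c * 1 by apply: ler_pM.
  have a2 : `|1 + u| * `|cos v - 1| <= 2 * (e' * c).
    apply: ler_pM => //; apply: le_trans (ler_normD _ _) _; rewrite normr1.
    by apply: (@lerD _ 1 1 _ 1) => //; exact: le_trans u1 c1.
  lra.
have ue : `|expR u| <= 3.
  have -> : expR u = (expR u - 1 - u) + (1 + u) by ring.
  apply: le_trans (ler_normD _ _) _; have := ler_normD 1 u; rewrite normr1; lra.
have B2 : `|expR u * (sin v - v) + (expR u - 1 - u) * v + u * v| <= 5 * (e' * c).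
  apply: le_trans (ler_normD _ _) _; apply: le_trans (lerD (ler_normD _ _) (lexx _)) _.
  rewrite !normrM.
  have a1 : `|expR u| * `|sin v - v| <= 3 * (e' * c) by apply: ler_pM.
  have a2 : `|expR u - 1 - u| * `|v| <= e' * c * 1 by apply: ler_pM => //; exact: le_trans v1 c1.
  have a3 : `|u| * `|v| <= e' * c by apply: ler_pM => //; exact: le_trans u1 (ltW he).
  lra.
have : e' * c <= e / 8 * c by rewrite ler_wpM2r.
lra.
Qed.

Lemma cderiv_ce z : is_cderiv ce z (ce z).
Proof.
move=> e e0; have k0 : 0 < cabs (ce z) by rewrite cabs_ce expR_gt0.
have [d [d0 Hd]] := ce_small (divr_gt0 (divr_gt0 e0 (ltr0Sn _ 1)) k0).
exists d; split=> // h /andP[h0 /Hd H].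
have hn : h != 0 by rewrite -cabs_gt0.
have -> : (ce (z + h) - ce z) / h - ce z = ce z * (ce h - 1 - h) / h.
  by rewrite ceD; field.
rewrite cabs_div cabsM ltr_pdivrMr // mulrC -ltr_pdivlMr //.
apply: le_lt_trans H _; rewrite [ltRHS]mulrAC ltr_pM2r // ltr_pM2r ?invr_gt0 //; lra.
Qed.

Lemma rccont_comp (p : R -> C) (f : C -> C) :
  rccont p -> (forall t, ccont_at f (p t)) -> rccont (fun t => f (p t)).
Proof.
move=> cp cf t e e0; have [d [d0 Hd]] := cf t e e0; have [d' [d0' Hd']] := cp t d d0.
by exists d'; split=> // s /Hd'; exact: Hd.
Qed.

Lemma rccont_pair (a b : R -> R) : continuous a -> continuous b ->
  rccont (fun t => Complex (a t) (b t)).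
Proof.
move=> ca cb t e e0; have e2 : 0 < e / 2 by rewrite divr_gt0.
have /cvgrPdist_lt /(_ _ e2) [d1 /= d10 H1] := ca t.
have /cvgrPdist_lt /(_ _ e2) [d2 /= d20 H2] := cb t.
exists (Num.min d1 d2); split; first by rewrite lt_min d10.
move=> s; rewrite lt_min => /andP[s1 s2].
have := H1 s; rewrite /ball_ /= distrC => /(_ s1) A1.
have := H2 s; rewrite /ball_ /= distrC => /(_ s2) A2.
by apply: le_lt_trans (cabs_ReIm _) _ => /=; rewrite (splitr e) ltrD // distrC.
Qed.

(** Log-polar coordinates: the radius is [expR s]. The map is holomorphic in [s + i t] and turns an
    annulus into a rectangle, where Goursat applies. *)
Definition circle (z0 : C) (s t : R) : C := z0 + ce (Complex s t).

(** By periodicity the horizontal sides of the rectangle [[u, s] x [0, 2 pi]] cancel, so the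
    integral over a circle does not depend on its radius. Letting [u] tend to minus infinity uses
    only continuity at the centre. *)
Lemma mean_value (f : C -> C) (z0 : C) (r s : R) : expR s < r ->
  (forall x, 0 < cabs (x - z0) < r -> cdiff f x) -> ccont_at f z0 ->
  rccont (fun t => f (circle z0 s t)) /\
  cint (fun t => f (circle z0 s t)) 0 (pi *+ 2) = f z0 * ((pi *+ 2)%:C)%C.
Proof.
move=> sr df cf.
(* The cut-off at [s] makes [H] separately continuous for all real parameters, although [f] is
   controlled only inside the disc. *)
pose H u t := f (circle z0 (Num.min u s) t).
have inb u t : u <= s -> 0 < cabs (circle z0 u t - z0) < r.
  move=> us; rewrite /circle addrC addKr cabs_ce /= expR_gt0 /=.
  by apply: le_lt_trans sr; rewrite ler_expR.
have cmin u : Num.min u s <= s by rewrite ge_min lexx orbT.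
have sH : sepcont H.
  have cc u t : ccont_at f (circle z0 (Num.min u s) t).
    by apply: cdiff_cont; apply: df; exact: inb.
  split=> [t|u].
    apply: rccont_comp => [|u]; last exact: cc.
    have cm : continuous (fun u => Num.min u s).
      by move=> u; apply: continuous_min; [exact: cvg_id|exact: cvg_cst].
    apply: rccontD (rccont_cst _) _; apply: rccont_comp; last by move=> u; apply: cderiv_cont (cderiv_ce _).
    by apply: rccont_pair => //; exact: cst_continuous.
  apply: rccont_comp => [|t]; last exact: cc.
  apply: rccontD (rccont_cst _) _; apply: rccont_comp; last by move=> t; apply: cderiv_cont (cderiv_ce _).
  apply: rccont_pair; first exact: cst_continuous.
  by move=> t; exact: cvg_id.
have pi2 : 0 <= pi *+ 2 :> R by rewrite mulrn_wge0 // pi_ge0.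
have Hs t : H s t = f (circle z0 s t) by rewrite /H minxx.
have cs : rccont (fun t => f (circle z0 s t)) by under eq_fun do rewrite -Hs; exact: sH.2.
split=> //.
have same u : u <= s -> cint (fun t => H s t) 0 (pi *+ 2) = cint (fun t => H u t) 0 (pi *+ 2).
  move=> us; have := @goursat R H u s 0 (pi *+ 2) us pi2 sH.
  have per v : H v (pi *+ 2) = H v 0.
    by rewrite /H /circle /ce /= cos2pi sin2pi cos0 sin0.
  rewrite /bdry (_ : (fun s0 => H s0 (pi *+ 2)) = (fun s0 => H s0 0)); last exact/funext.
  rewrite subrr add0r => G.
  have /eqP : 'i%C * (cint [eta H s] 0 (pi *+ 2) - cint [eta H u] 0 (pi *+ 2)) = 0.
    apply: G => s0 t0 /andP[us0 s0s] t0r.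
    have [l Hl] : cdiff (fun w => f (z0 + ce w)) (Complex s0 t0).
      have [l Hl] := df _ (inb s0 t0 s0s).
      exists (l * ce (Complex s0 t0)); apply: (@cderiv_comp _ (fun w => z0 + ce w)) => //.
      by rewrite -[X in is_cderiv _ _ X]add0r; apply: cderivD (cderiv_cst _ _) (cderiv_ce _).
    exists l => e e0; have [d [d0 Hd]] := Hl e e0.
    exists (d / 2); split; first by rewrite divr_gt0.
    move=> s1 t1 /andP[us1 s1s] t1r ds dt.
    rewrite /H !min_l // /circle.
    set k := Complex (s1 - s0) (t1 - t0).
    have kl : cabs k <= `|s1 - s0| + `|t1 - t0| by exact: cabs_ReIm.
    have -> : Complex s1 t1 = Complex s0 t0 + k.
      by apply/eqP; rewrite eq_complex /=; apply/andP; split; apply/eqP; ring.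
    have [->|k0] := eqVneq k 0.
      by rewrite mulr0 subr0 addr0 subrr cabs0 mulr_ge0 ?addr_ge0 // ltW.
    have kd : cabs k < d by apply: le_lt_trans kl _; lra.
    have := Hd k; rewrite cabs_gt0 k0 kd /= => /(_ isT) /ltW Hk.
    set q := f _ - f _ in Hk *.
    have -> : q - l * k = (q / k - l) * k by rewrite mulrBl divfK.
    rewrite cabsM; apply: le_trans (_ : e * cabs k <= _); first by rewrite ler_wpM2r ?cabs_ge0.
    by rewrite ler_pM2l.
  rewrite mulf_eq0 subr_eq0 => /orP[|/eqP //].
  by rewrite eq_complex /= oner_eq0 andbF.
have -> : (fun t => f (circle z0 s t)) = (fun t => H s t) by apply/funext => t; rewrite Hs.
apply/eqP; rewrite -subr_eq0 -cabs_eq0 eq_le cabs_ge0 andbT.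
apply/ler_addgt0Pr => e e0; rewrite add0r.
have e'0 : 0 < e / (2 * (pi *+ 2)) by rewrite divr_gt0 // mulr_gt0 // mulrn_wgt0 // pi_gt0.
have [d [d0 Hd]] := cf _ e'0.
pose u := Num.min s (ln (d / 2)).
have us : u <= s by rewrite ge_min lexx.
have ud : expR u < d.
  apply: (@le_lt_trans _ _ (d / 2)); last lra.
  by rewrite -[leRHS]lnK ?posrE ?divr_gt0 // ler_expR ge_min lexx orbT.
rewrite (same u us) -[X in _ - _ * X]/(((pi *+ 2))%:C)%C.
have -> : f z0 * ((pi *+ 2)%:C)%C = cint (fun=> f z0) 0 (pi *+ 2) by rewrite cint_cst subr0.
have -> : cint [eta H u] 0 (pi *+ 2) - cint (fun=> f z0) 0 (pi *+ 2) =
    cint (fun t => H u t + (- 1) * f z0) 0 (pi *+ 2).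
  rewrite cintD; [|exact: sH.2|exact: rccont_cst].
  by rewrite (@cintZ _ (-1) (fun=> f z0)) ?mulN1r //; exact: rccont_cst.
have := @cint_bound R (fun t => H u t + (- 1) * f z0) 0 (pi *+ 2) (e / (2 * (pi *+ 2))).
move=> CB; apply: le_trans (CB _ pi2 _) _.
- by apply: rccontD; [exact: sH.2|exact: rccont_cst].
- move=> t _; rewrite mulN1r; apply: ltW; apply: Hd.
  by rewrite /circle addrC addKr cabs_ce /= min_l.
- have P0 : 0 < pi *+ 2 :> R by rewrite mulrn_wgt0 // pi_gt0.
  rewrite subr0; move: (pi *+ 2) P0 => P P0.
  by rewrite le_eqVlt; apply/orP; left; apply/eqP; field; rewrite gt_eqF.
Qed.

(** The average of [Re (f / f z0)] over the circle is one and the integrand never exceeds one, so it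
    cannot drop below one. Only the angle [1] is recorded: [cos 1 > 0] is all that the maximum
    principle asks for. *)
Lemma max_local (f : C -> C) (z0 : C) (r s : R) : expR s < r ->
  (forall x, 0 < cabs (x - z0) < r -> cdiff f x) -> ccont_at f z0 ->
  (forall x, cabs (x - z0) < r -> cabs (f x) <= cabs (f z0)) ->
  cabs (f (circle z0 s 1)) = cabs (f z0).
Proof.
move=> sr df cf fmax.
have inb t : cabs (circle z0 s t - z0) < r.
  by rewrite /circle addrC addKr cabs_ce.
apply/eqP; rewrite eq_le fmax //=.
have [f0|f0] := eqVneq (f z0) 0; first by rewrite f0 cabs0 cabs_ge0.
have [cs mv] := mean_value sr df cf.
pose g t := (f z0)^-1 * f (circle z0 s t).
have cg : rccont g by exact: rccontZ.
have pi2 : 2 < pi *+ 2 :> R by rewrite mulr2n; have := pi_ge2 R; lra.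
have mg : cint g 0 (pi *+ 2) = ((pi *+ 2)%:C)%C.
  by rewrite cintZ // mv mulrA mulVf // mul1r.
have gle t : cabs (g t) <= 1.
  by rewrite /g cabsM cabsV mulrC ler_pdivrMr ?cabs_gt0 // mul1r fmax.
have rg : rint (fun t => Re (g t)) 0 (pi *+ 2) = pi *+ 2.
  by have := congr1 (@complex.Re R) mg.
have cR := rccont_Re cg.
have Rle t : Re (g t) <= 1.
  by apply: le_trans (gle t); apply: le_trans (ler_norm _) (Re_le_cabs _).
suff : 1 <= Re (g 1).
  move=> h; have : 1 <= cabs (g 1).
    by apply: le_trans h _; apply: le_trans (ler_norm _) (Re_le_cabs _).
  by rewrite /g cabsM cabsV mulrC ler_pdivlMr ?cabs_gt0 // mul1r.
rewrite leNgt; apply/negP => lt1.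
pose e := (1 - Re (g 1)) / 2.
have e0 : 0 < e by rewrite divr_gt0 // subr_gt0.
have /cvgrPdist_lt /(_ _ e0) [d /= d0 Hd] := cR 1.
pose d' := Num.min (d / 2) 1.
have d'0 : 0 < d' by rewrite lt_min ltr01 divr_gt0.
have d'1 : d' <= 1 by rewrite ge_min lexx orbT.
have d'd : d' < d by apply: (@le_lt_trans _ _ (d / 2)); [rewrite ge_min lexx|lra].
have near1 t : 1 <= t <= 1 + d' -> -1 <= Re (g t) <= 1 - e.
  move=> /andP[t1 t2]; have := Hd t; rewrite /ball_ /= distrC.
  have -> : `|t - 1| < d by rewrite ger0_norm ?subr_ge0 //; lra.
  move=> /(_ isT); rewrite ltr_norml /e => /andP[A1 A2].
  have := le_trans (Re_le_cabs (g t)) (gle t); rewrite ler_norml => /andP[B1 B2].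
  by rewrite B1 /=; lra.
have gen t : -1 <= Re (g t) <= 1.
  by have := le_trans (Re_le_cabs (g t)) (gle t); rewrite ler_norml.
have := rg; rewrite -(@rint_chasles R _ 0 (1 + d')) // -(@rint_chasles R _ 0 1) //.
have /andP[_ a1] := @rint_bounds R _ 0 1 (-1) 1 cR ler01 (fun t _ => gen t).
have l2 : 1 <= 1 + d' by lra.
have /andP[_ a2] := rint_bounds cR l2 near1.
have l3 : 1 + d' <= pi *+ 2 by lra.
have /andP[_ a3] := @rint_bounds R _ _ _ (-1) 1 cR l3 (fun t _ => gen t).
have : 0 < e * d' by rewrite mulr_gt0.
move: a1 a2 a3; lra.
Qed.

(** Differentiability is asked in the punctured disc only, which admits difference quotients at
    their base point. *)
Definition interior_regular (A : set C) (h : C -> C) (x : C) := exists r : R,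
  [/\ 0 < r, (forall y, cabs (y - x) < r -> A y) & (forall y, 0 < cabs (y - x) < r -> cdiff h y)].

(* Among the maximum points take one with the largest real part: the mean value property
   would move it further to the right. *)
Lemma max_principle (A : set C) (h : C -> C) (B : R) x0 : A x0 ->
  (forall x, A x -> cabs x <= B) -> cclosed A -> ccont_on A h ->
  exists x, [/\ A x, (forall y, A y -> cabs (h y) <= cabs (h x)) & ~ interior_regular A h x].
Proof.
move=> Ax0 AB Acl ch.
have [x1 [Ax1 Hx1]] := cabs_max Ax0 AB Acl ch.
pose A' := [set x | A x /\ forall y, A y -> cabs (h y) <= cabs (h x)].
have A'cl : cclosed A'.
  move=> u l Hu ul; have Al : A l by apply: (Acl u l) => // n; exact: (Hu n).1.
  split=> // y Ay; apply/ler_addgt0Pr => e e0.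
  have [d [d0 Hd]] := ch l Al e e0; have [N HN] := ul d d0.
  have := Hd _ (Hu N).1 (HN N (leqnn N)); have := (Hu N).2 y Ay.
  have := cabs_le_sub (h (u N)) (h l); lra.
have [x [A'x Hx]] : exists x, A' x /\ forall y, A' y -> Re y <= Re x.
  apply: (@cclosed_EVT R A' (fun x => Re x) B x1) => //; first by move=> y [/AB].
  move=> y _ e e0; exists e; split=> // y' _ yy.
  have := Re_le_cabs (y' - y); rewrite Re_sub; have := ler_norm (Re y' - Re y); lra.
exists x; split; [exact: A'x.1|exact: A'x.2|move=> [r [r0 rA rd]]].
have cx : ccont_at h x.
  move=> e e0; have [d [d0 Hd]] := ch x A'x.1 e e0.
  exists (Num.min d r); split; first by rewrite lt_min d0.
  by move=> y; rewrite lt_min => /andP[yd yr]; apply: Hd => //; exact: rA.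
pose s := ln (r / 2).
have es : expR s = r / 2 by rewrite lnK // posrE divr_gt0.
have sr : expR s < r by rewrite es; lra.
have := max_local sr rd cx (fun y yr => A'x.2 y (rA y yr)) => E.
have A'c : A' (circle x s 1).
  split; first by apply: rA; rewrite /circle addrC addKr cabs_ce.
  by move=> y Ay; rewrite E; exact: A'x.2.
have := Hx _ A'c; rewrite /circle /ce es; case: (x) => a b /=.
have := mulr_gt0 (divr_gt0 r0 (ltr0Sn _ 1)) (@cos1_gt0 R); lra.
Qed.

End MaximumPrinciple.

(** * Local behaviour of holomorphic functions *)

Section HolomorphicLocal.
Variable R : realType.
Local Notation C := R[i].
Implicit Types (x y z v l : C) (f g h : C -> C) (r M : R).

Definition isolated_regular h y := exists r, 0 < r /\ forall x, 0 < cabs (x - y) < r -> cdiff h x.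

Lemma ccontX f z n : ccont_at f z -> ccont_at (fun x => f x ^+ n) z.
Proof.
move=> cf; elim: n => [|n IH]; first by under eq_fun do rewrite expr0; exact: ccont_cst.
by under eq_fun do rewrite exprS; exact: ccontM.
Qed.

Lemma ball_sub y z r : cabs (y - z) < r -> exists d : R, 0 < d /\
  forall x, cabs (x - y) < d -> cabs (x - z) < r.
Proof.
move=> yr; exists (r - cabs (y - z)); split; first by rewrite subr_gt0.
by move=> x xy; have := cabs_triangle y x z; lra.
Qed.

Lemma punctured_ball_sub y z r : 0 < cabs (y - z) < r -> exists d : R, 0 < d /\
  forall x, cabs (x - y) < d -> 0 < cabs (x - z) < r.
Proof.
move=> /andP[y0 yr]; have [d [d0 Hd]] := ball_sub yr.
exists (Num.min d (cabs (y - z))); split; first by rewrite lt_min d0.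
move=> x; rewrite lt_min => /andP[/Hd -> xy]; rewrite andbT.
by have := cabs_triangle x y z; rewrite (cabs_distC y x); lra.
Qed.

Lemma isolated_regular_ball h z r y : (forall x, cabs (x - z) < r -> cdiff h x) ->
  cabs (y - z) < r -> isolated_regular h y.
Proof.
move=> hd /ball_sub[d [d0 Hd]]; exists d; split=> // x /andP[_ /Hd]; exact: hd.
Qed.

Lemma ball_max h z r M : 0 < r -> (forall x, cabs (x - z) <= r -> ccont_at h x) ->
  (forall y, cabs (y - z) < r -> isolated_regular h y) ->
  (forall x, cabs (x - z) = r -> cabs (h x) <= M) ->
  forall x, cabs (x - z) <= r -> cabs (h x) <= M.
Proof.
move=> r0 ch ir hM x xr.
have [y [yr ymax yni]] := @max_principle R [set x | cabs (x - z) <= r] h (cabs z + r) x xr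
  (fun x => @cball_bound R z r x) (@cclosed_cball R z r) (ccont_at_on ch).
apply: le_trans (ymax x xr) _; apply: hM; apply/eqP; rewrite eq_le [_ <= r]yr /= leNgt.
apply/negP => ylt; apply: yni.
have [d [d0 Hd]] := ball_sub ylt; have [d' [d0' Hd']] := ir y ylt.
exists (Num.min d d'); split; first by rewrite lt_min d0.
  by move=> w; rewrite lt_min => /andP[/Hd/ltW].
by move=> w /andP[w0]; rewrite lt_min => /andP[_ wd]; apply: Hd'; rewrite w0.
Qed.

(** If [f] missed [v], the reciprocal of [f - v] would be larger at the centre than anywhere on the
    circle. *)
Lemma surjective_ball f z r v (m : R) : 0 < r ->
  (forall x, cabs (x - z) <= r -> ccont_at f x) ->
  (forall y, cabs (y - z) < r -> isolated_regular f y) ->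
  cabs (f z - v) < m -> (forall x, cabs (x - z) = r -> m <= cabs (f x - v)) ->
  exists x, cabs (x - z) < r /\ f x = v.
Proof.
move=> r0 cf ir fzv fm; apply: contrapT => H.
have m0 : 0 < m by apply: le_lt_trans fzv; exact: cabs_ge0.
have fv x : cabs (x - z) <= r -> f x - v != 0.
  rewrite le_eqVlt => /orP[/eqP/fm mx|xr].
    by rewrite -cabs_gt0; exact: lt_le_trans mx.
  by apply/negP; rewrite subr_eq0 => /eqP fx; apply: H; exists x.
have B : forall x, cabs (x - z) <= r -> cabs (f x - v)^-1 <= m^-1.
  apply: ball_max => //.
  - by move=> x xr; apply: (@ccontV _ (fun x => f x - v)) (fv x xr) _; apply: ccontB (cf x xr) (ccont_cst _ _).
  - move=> y yr; have [d [d0 Hd]] := ir y yr; have [d' [d0' Hd']] := ball_sub yr.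
    exists (Num.min d d'); split; first by rewrite lt_min d0.
    move=> x /andP[x0]; rewrite lt_min => /andP[xd /Hd'/ltW/fv fx]; apply: cdiffV => //.
    by apply: cdiffB (cdiff_cst _ _); apply: Hd; rewrite x0.
  - by move=> x /fm mx; rewrite cabsV lef_pV2 ?posrE //; exact: lt_le_trans mx.
have := B z; rewrite subrr cabs0 => /(_ (ltW r0)).
rewrite cabsV lef_pV2 ?posrE //; first by rewrite leNgt fzv.
by rewrite cabs_gt0 fv // subrr cabs0 ltW.
Qed.

(** A class that is stable under difference quotients before removable singularities are available;
    it is what [ball_max] accepts. *)
Definition hol f z r := forall y, cabs (y - z) < r -> ccont_at f y /\ isolated_regular f y.

Lemma cdiff_hol f z r : (forall x, cabs (x - z) < r -> cdiff f x) -> hol f z r.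
Proof.
by move=> df y yr; split; [exact/cdiff_cont/df|exact: isolated_regular_ball yr].
Qed.

Lemma hol_sub f z r y r' : hol f z r -> cabs (y - z) + r' <= r -> hol f y r'.
Proof. by move=> hf le x xr; apply: hf; have := cabs_triangle y x z; lra. Qed.

(** The difference quotient of [f] at [z], completed at [z] by the derivative, which continuity
    forces there. *)
Definition cquot f z (p : C -> C) := ccont_at p z /\ forall x, f x = f z + p x * (x - z).

Lemma cquotE f z p x : cquot f z p -> x != z -> p x = (f x - f z) / (x - z).
Proof.
by move=> [_ fp] xz; rewrite (fp x) (addrC (f z)) addrK mulfK // subr_eq0.
Qed.

Lemma cquot_near f z p y : cquot f z p -> y != z ->
  exists d : R, 0 < d /\ forall x, cabs (x - y) < d -> (f x - f z) / (x - z) = p x.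
Proof.
move=> qp yz; exists (cabs (y - z)); split; first by rewrite cabs_gt0 subr_eq0.
move=> x xy; rewrite (cquotE qp) //; apply: contraTneq xy => ->.
by rewrite cabs_distC ltxx.
Qed.

Lemma cquot_cdiff f z p y : cquot f z p -> y != z -> cdiff f y -> cdiff p y.
Proof.
move=> qp yz fy; have [d [d0 Hd]] := cquot_near qp yz.
apply: cdiff_near d0 Hd _; apply: cdiffM.
  by apply: cdiffB fy (cdiff_cst _ _).
by apply: cdiffV; [rewrite subr_eq0|apply: cdiffB (cdiff_id _) (cdiff_cst _ _)].
Qed.

Lemma cquot_ccont f z p y : cquot f z p -> ccont_at f y -> ccont_at p y.
Proof.
move=> qp fy; have [->|yz] := eqVneq y z; first exact: qp.1.
have [d [d0 Hd]] := cquot_near qp yz.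
apply: ccont_near d0 Hd _; apply: ccontM.
  by apply: ccontB fy (ccont_cst _ _).
by apply: ccontV; [rewrite subr_eq0|apply: ccontB (ccont_id _) (ccont_cst _ _)].
Qed.

Lemma cquot_isolated f z p y : cquot f z p -> isolated_regular f y -> isolated_regular p y.
Proof.
move=> qp [d [d0 Hd]]; have [yz|yz] := eqVneq y z.
  rewrite yz in Hd *.
  exists d; split=> // x; have [->|xz] := eqVneq x z; first by rewrite subrr cabs0 ltxx.
  by move=> /Hd; exact: cquot_cdiff qp xz.
exists (Num.min d (cabs (y - z))); split; first by rewrite lt_min d0 cabs_gt0 subr_eq0.
move=> x /andP[x0]; rewrite lt_min => /andP[xd xy].
apply: (cquot_cdiff qp); last by apply: Hd; rewrite x0.
by apply: contraTneq xy => ->; rewrite cabs_distC ltxx.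
Qed.

Lemma cquot_hol f z p y r : cquot f z p -> hol f y r -> hol p y r.
Proof.
by move=> qp hf x /hf[cx ix]; split; [exact: cquot_ccont qp cx|exact: cquot_isolated qp ix].
Qed.

Lemma cquot_exists f z l : is_cderiv f z l -> exists p, cquot f z p /\ p z = l.
Proof. by move=> /cderivP[p [cp pl fp]]; exists p. Qed.

(** On a circle of radius [s < r] the quotient is at most [2 M / s]; the maximum principle carries
    this inside, and [s] tends to [r]. *)
Lemma schwarz f z r M l : 0 < r -> hol f z r -> is_cderiv f z l ->
  (forall x, cabs (x - z) < r -> cabs (f x) <= M) ->
  forall p, cquot f z p -> forall x, cabs (x - z) < r -> cabs (p x) <= 2 * M / r.
Proof.
move=> r0 hf fl fM p qp x xr; have hp := cquot_hol qp hf.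
have M0 : 0 <= M by apply: le_trans (fM z _); rewrite ?cabs_ge0 // subrr cabs0.
have key s : cabs (x - z) <= s -> 0 < s < r -> s * cabs (p x) <= 2 * M.
  move=> xs /andP[s0 sr]; rewrite mulrC -ler_pdivlMr //.
  apply: (@ball_max p z s) => //.
  - by move=> y ys; exact: (hp y (le_lt_trans ys sr)).1.
  - by move=> y ys; exact: (hp y (lt_trans ys sr)).2.
  - move=> y ys; have yz : y != z by rewrite -subr_eq0 -cabs_gt0 ys.
    rewrite (cquotE qp yz) cabs_div ys ler_pM2r ?invr_gt0 //.
    apply: le_trans (cabsB _ _) _; have := fM y; have := fM z.
    rewrite subrr cabs0 ys => /(_ r0) A /(_ sr) B; lra.
rewrite ler_pdivlMr //; apply/ler_addgt0Pr => e e0.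
pose k := cabs (p x) + 1.
have k0 : 0 < k by rewrite /k ltr_wpDl ?cabs_ge0.
(* The three terms keep [x] inside the circle, keep [s] positive, and make the loss from replacing
   [r] by [s] at most [e]. *)
pose s := Num.max (cabs (x - z)) (Num.max (r / 2) (r - e / k)).
have sr : s < r.
  have := divr_gt0 e0 k0; rewrite /s !gt_max xr /= => ?; apply/andP; split; lra.
have s0 : 0 < s by rewrite /s !lt_max divr_gt0 ?orbT.
have K := key s; rewrite s0 sr /s le_max lexx in K; have {}K := K isT isT.
have h1 : r - e / k <= s by rewrite /s !le_max lexx !orbT.
have h2 : r * cabs (p x) <= s * cabs (p x) + e / k * cabs (p x).
  by rewrite -mulrDl ler_wpM2r ?cabs_ge0 //; lra.
have h3 : e / k * cabs (p x) <= e.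
  by rewrite mulrAC ler_pdivrMr // ler_pM2l // /k lerDl.
rewrite mulrC; apply: le_trans h2 _; apply: lerD h3.
exact: K.
Qed.

Lemma schwarz_lip f z r M l : 0 < r -> hol f z r -> is_cderiv f z l ->
  (forall x, cabs (x - z) < r -> cabs (f x) <= M) ->
  forall x, cabs (x - z) < r -> cabs (f x - f z) <= 2 * M / r * cabs (x - z).
Proof.
move=> r0 hf fl fM x xr; have [p [qp _]] := cquot_exists fl.
have [_ ->] := qp; rewrite (addrC (f z)) addrK cabsM ler_wpM2r ?cabs_ge0 //.
exact: (schwarz r0 hf fl fM qp).
Qed.

Lemma cauchy_lip f z r M : 0 < r -> (forall x, cabs (x - z) < r -> cdiff f x) ->
  (forall x, cabs (x - z) < r -> cabs (f x) <= M) ->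
  forall x y, cabs (x - z) < r / 4 -> cabs (y - z) < r / 4 ->
  cabs (f x - f y) <= 4 * M / r * cabs (x - y).
Proof.
move=> r0 fd fM x y xr yr.
have sub w : cabs (w - y) < r / 2 -> cabs (w - z) < r by have := cabs_triangle y w z; lra.
have [|l fl] := fd y; first lra.
have hy : hol f y (r / 2) by apply: cdiff_hol => w /sub; exact: fd.
have := schwarz_lip (divr_gt0 r0 (ltr0Sn _ 1)) hy fl (fun w wy => fM w (sub w wy)) (x := x).
have -> : 2 * M / (r / 2) = 4 * M / r by field; rewrite gt_eqF.
by apply; have := cabs_triangle z x y; rewrite (cabs_distC z y); lra.
Qed.

(** This is the Schwarz bound for the quotient [p] itself. As [p] is not yet known to be
    differentiable at [z], the estimate is based at points [y] near [z] and passes to the limit by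
    continuity. *)
Lemma taylor2 f z r M l : 0 < r -> (forall x, cabs (x - z) < r -> cdiff f x) ->
  (forall x, cabs (x - z) < r -> cabs (f x) <= M) -> is_cderiv f z l ->
  forall p, cquot f z p -> forall x, cabs (x - z) < r / 4 ->
  cabs (p x - p z) <= 8 * M / r ^+ 2 * cabs (x - z).
Proof.
move=> r0 fd fM fl p qp x xr.
have hf := cdiff_hol fd; have hp := cquot_hol qp hf.
have pM := schwarz r0 hf fl fM qp.
have [->|xz] := eqVneq x z; first by rewrite !subrr cabs0 mulr0.
have M0 : 0 <= M by apply: le_trans (fM z _); rewrite ?cabs_ge0 // subrr cabs0.
pose K := 8 * M / r ^+ 2.
have K0 : 0 <= K by rewrite /K divr_ge0 ?mulr_ge0 ?exprn_ge0 ?(ltW r0).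
have key y : y != z -> cabs (y - z) < r / 4 -> cabs (p x - p y) <= K * cabs (x - y).
  move=> yz yr; have [|m pm] := cquot_cdiff qp yz (fd y _); first lra.
  have sub w : cabs (w - y) < r / 2 -> cabs (w - z) < r by have := cabs_triangle y w z; lra.
  have hy : hol p y (r / 2) by apply: hol_sub hp _; lra.
  have := schwarz_lip (divr_gt0 r0 (ltr0Sn _ 1)) hy pm (fun w wy => pM w (sub w wy)) (x := x).
  have -> : 2 * (2 * M / r) / (r / 2) = K by rewrite /K; field; rewrite gt_eqF.
  by apply; have := cabs_triangle z x y; rewrite (cabs_distC z y); lra.
apply/ler_addgt0Pr => e e0.
have K1 : 0 < K + 1 by rewrite ltr_wpDl.
have [d [d0 Hd]] := qp.1 _ (divr_gt0 e0 (ltr0Sn _ 1)).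
pose t := Num.min (d / 2) (Num.min (r / 8) (e / 2 / (K + 1))).
have t0 : 0 < t by rewrite !lt_min !divr_gt0.
have td : t < d by apply: (@le_lt_trans _ _ (d / 2)); [rewrite ge_min lexx|lra].
have tr : t < r / 4 by apply: (@le_lt_trans _ _ (r / 8)); [rewrite !ge_min lexx orbT|lra].
have te : (K + 1) * t <= e / 2.
  by rewrite mulrC -ler_pdivlMr // !ge_min lexx !orbT.
pose y := z + (t%:C)%C.
have yz : y - z = (t%:C)%C by rewrite /y addrC addKr.
have cyz : cabs (y - z) = t by rewrite yz cabs_real gtr0_norm.
have ynz : y != z by rewrite -subr_eq0 -cabs_gt0 cyz.
have k1 := key y ynz; rewrite cyz in k1; have {}k1 := k1 tr.
have k2 := Hd y; rewrite cyz in k2; have {}k2 := k2 td.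
have h1 := cabs_triangle (p y) (p x) (p z).
have h2 := cabs_triangle z x y; rewrite (cabs_distC z y) cyz in h2.
have h3 : K * cabs (x - y) <= K * cabs (x - z) + K * t by rewrite -mulrDr ler_wpM2l.
rewrite -/K; lra.
Qed.

(** The nonlinear part [g] is of second order on the disc of radius [4 s]; by [cauchy_lip] it is
    Lipschitz on the disc of radius [s], with a constant proportional to [s]. *)
Lemma bilipschitz f z r M l (s : R) : 0 < r -> 0 < s -> (forall x, cabs (x - z) < r -> cdiff f x) ->
  (forall x, cabs (x - z) < r -> cabs (f x) <= M) -> is_cderiv f z l ->
  s <= r / 16 -> 256 * M * s <= cabs l * r ^+ 2 ->
  forall x y, cabs (x - z) < s -> cabs (y - z) < s ->
  cabs (f x - f y - l * (x - y)) <= cabs l / 2 * cabs (x - y).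
Proof.
move=> r0 s0 fd fM fl sr sl x y xs ys.
have M0 : 0 <= M by apply: le_trans (fM z _); rewrite ?cabs_ge0 // subrr cabs0.
have [p [qp pl]] := cquot_exists fl.
have T := taylor2 r0 fd fM fl qp.
pose g w := f w - f z - l * (w - z).
have s4 : 0 < 4 * s by rewrite mulr_gt0.
have sub w : cabs (w - z) < 4 * s -> cabs (w - z) < r by lra.
have gd w : cabs (w - z) < 4 * s -> cdiff g w.
  move=> /sub/fd fw; apply: cdiffB; first by apply: cdiffB fw (cdiff_cst _ _).
  by apply: cdiffM (cdiff_cst _ _) _; apply: cdiffB (cdiff_id _) (cdiff_cst _ _).
have gM w : cabs (w - z) < 4 * s -> cabs (g w) <= 8 * M / r ^+ 2 * (4 * s) ^+ 2.
  move=> ws; have := T w; rewrite pl => /(_ _) Tw.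
  have -> : g w = (p w - l) * (w - z) by rewrite /g (qp.2 w); ring.
  rewrite cabsM (expr2 (4 * s)) mulrA; apply: ler_pM; rewrite ?cabs_ge0 //; last exact: ltW.
  apply: le_trans (Tw _) _; first lra.
  by apply: ler_wpM2l (ltW ws); rewrite divr_ge0 ?mulr_ge0 ?exprn_ge0 ?(ltW r0).
have -> : f x - f y - l * (x - y) = g x - g y by rewrite /g; ring.
have s44 : 4 * s / 4 = s by field.
have := cauchy_lip s4 gd gM (x := x) (y := y); rewrite s44 => /(_ xs ys)/le_trans; apply.
rewrite ler_wpM2r ?cabs_ge0 //.
(* The Lipschitz constant is [128 M s / r^2]; the factor 256 in the hypothesis makes it at most half
   of [cabs l]. *)
have -> : 4 * (8 * M / r ^+ 2 * (4 * s) ^+ 2) / (4 * s) = (256 * M * s) / r ^+ 2 / 2.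
  by field; rewrite !gt_eqF.
by rewrite ler_pM2r ?invr_gt0 // ler_pdivrMr // exprn_gt0.
Qed.

Lemma bilipschitz_bounds f l x y : cabs (f x - f y - l * (x - y)) <= cabs l / 2 * cabs (x - y) ->
  cabs l / 2 * cabs (x - y) <= cabs (f x - f y) <= 2 * cabs l * cabs (x - y).
Proof.
move=> H; have h1 := cabs_le_sub (l * (x - y)) (f x - f y); rewrite (cabs_distC _ (f x - f y)) cabsM in h1.
have h2 := cabs_le_sub (f x - f y) (l * (x - y)); rewrite cabsM in h2.
have := mulr_ge0 (cabs_ge0 l) (cabs_ge0 (x - y)) => h3.
by apply/andP; split; lra.
Qed.

(** Bernoulli's inequality. It discards a fixed factor from a maximum principle estimate: the
    estimate is made for [n]-th powers, and [n] grows. *)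
Lemma power_bound (a b K : R) : 0 <= a -> 0 <= b -> (forall n, a ^+ n <= K * b ^+ n) -> a <= b.
Proof.
move=> a0 b0 H; rewrite leNgt; apply/negP => ba.
have [b_eq0|bn0] := eqVneq b 0.
  by have := H 1%N; rewrite !expr1 b_eq0 mulr0 => /(lt_le_trans ba); rewrite b_eq0 ltxx.
have bp : 0 < b by rewrite lt_neqAle eq_sym bn0.
have q1 : 0 < a / b - 1 by rewrite subr_gt0 ltr_pdivlMr // mul1r.
have bern n : 1 + n%:R * (a / b - 1) <= (a / b) ^+ n.
  elim: n => [|n IH]; first by rewrite mul0r addr0 expr0.
  rewrite exprS -[in leRHS](subrK 1 (a / b)) mulrDl mul1r.
  have : (a / b - 1) * 1 <= (a / b - 1) * (a / b - 1 + 1) ^+ n.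
    by rewrite ler_pM2l // exprn_ege1 // lerDr ltW.
  rewrite subrK -nat1r; lra.
have Kn n : n%:R * (a / b - 1) <= K.
  have := H n; rewrite -ler_pdivrMr ?exprn_gt0 // -expr_div_n; have := bern n; lra.
have K0 : 0 <= K by have := Kn 0%N; rewrite mul0r.
have := archi_boundP (divr_ge0 K0 (ltW q1)); rewrite ltr_pdivrMr // ltNge.
by rewrite Kn.
Qed.

(** As [k] is only bounded near [z], its difference quotient [q] at [y] need not be continuous
    there. Multiplying [q^n] by [w - z] repairs this, the maximum principle on the disc of radius
    [r / 2] applies, and [n]-th roots remove the extra factor. *)
Lemma removable_lip k z r M : 0 < r -> (forall x, 0 < cabs (x - z) < r -> cdiff k x) ->
  (forall x, 0 < cabs (x - z) < r -> cabs (k x) <= M) ->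
  forall x y, 0 < cabs (x - z) < r / 4 -> 0 < cabs (y - z) < r / 4 ->
  cabs (k x - k y) <= 8 * M / r * cabs (x - y).
Proof.
move=> r0 kd kM x y /andP[x0 xr] /andP[y0 yr].
have M0 : 0 <= M by apply: le_trans (kM x _); rewrite ?cabs_ge0 // x0; lra.
have yb : 0 < cabs (y - z) < r by rewrite y0; lra.
have [l kl] := kd y yb; have [q [qq ql]] := cquot_exists kl.
have xz : x != z by rewrite -subr_eq0 -cabs_gt0.
have yz : y != z by rewrite -subr_eq0 -cabs_gt0.
suff qx : cabs (q x) <= 8 * M / r.
  by rewrite (qq.2 x) (addrC (k y)) addrK cabsM ler_wpM2r ?cabs_ge0.
have A0 : 0 <= 8 * M / r by rewrite divr_ge0 ?mulr_ge0 // ltW.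
apply: (@power_bound _ _ (r / 2 / cabs (x - z))) => // [|n]; first exact: cabs_ge0.
rewrite mulrAC ler_pdivlMr //.
have r2 : 0 < r / 2 by rewrite divr_gt0.
have in2 w : w != z -> cabs (w - z) <= r / 2 -> 0 < cabs (w - z) < r.
  by move=> wz wr; rewrite cabs_gt0 subr_eq0 wz /=; lra.
(* The value [0] at [z] is the limit, because [q] is bounded near [z]. *)
pose h w := if w == z then 0 else q w ^+ n * (w - z).
have hnear w : w != z -> exists d : R, 0 < d /\
    forall u, cabs (u - w) < d -> q u ^+ n * (u - z) = h u.
  move=> wz; exists (cabs (w - z)); split; first by rewrite cabs_gt0 subr_eq0.
  move=> u uw; rewrite /h ifN //; apply: contraTneq uw => ->.
  by rewrite cabs_distC ltxx.
have qcont w : w != z -> cabs (w - z) <= r / 2 -> ccont_at q w.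
  by move=> wz wr; apply: cquot_ccont qq _; apply: cdiff_cont; apply: kd; exact: in2.
have := @ball_max h z (r / 2) ((8 * M / r) ^+ n * (r / 2)) r2.
have qbd : exists B : R, 0 <= B /\ forall w, w != z -> cabs (w - z) < cabs (y - z) / 2 ->
    cabs (q w) <= B.
  exists (2 * M / (cabs (y - z) / 2)); split.
    by rewrite !(divr_ge0, mulr_ge0) // ltW.
  move=> w wz wy; have wyn : w != y.
    by apply: contraTneq wy => ->; rewrite -leNgt; lra.
  have wyd : cabs (y - z) / 2 <= cabs (w - y).
    by have := cabs_triangle w y z; rewrite (cabs_distC y w); lra.
  rewrite (cquotE qq wyn) cabs_div ler_pM ?cabs_ge0 ?invr_ge0 ?cabs_ge0 //.
    have := cabsB (k w) (k y); have := kM y yb.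
    have := kM w; rewrite cabs_gt0 subr_eq0 wz /= => /(_ _) K1 K2 K3.
    have {}K1 := K1 _; apply: le_trans K3 _.
    have : cabs (k w) <= M by apply: K1; lra.
    lra.
  by rewrite lef_pV2 ?posrE //; [apply: lt_le_trans wyd|]; rewrite divr_gt0.
case: qbd => B [B0 qB] BM.
have hx : h x = q x ^+ n * (x - z) by rewrite /h (negbTE xz).
have -> : cabs (q x) ^+ n * cabs (x - z) = cabs (h x) by rewrite hx cabsM cabsX.
rewrite mulrC; apply: BM; last lra.
- move=> w wr; have [->|wz] := eqVneq w z.
    move=> e e0; have B1 : 0 < B ^+ n + 1 by rewrite ltr_wpDl ?exprn_ge0.
    exists (Num.min (cabs (y - z) / 2) (e / (B ^+ n + 1))); split.
      by rewrite lt_min !divr_gt0.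
    move=> u; rewrite lt_min => /andP[uy ue]; rewrite /h eqxx subr0.
    have [_|uz] := eqVneq u z; first by rewrite cabs0.
    rewrite cabsM cabsX; apply: le_lt_trans (_ : (B ^+ n + 1) * cabs (u - z) < e).
      rewrite ler_wpM2r ?cabs_ge0 //; apply: le_trans (_ : B ^+ n <= _); last by rewrite lerDl.
      by rewrite lerXn2r ?nnegrE ?cabs_ge0 // qB.
    by rewrite mulrC -ltr_pdivlMr.
  have [d [d0 Hd]] := hnear w wz; apply: ccont_near d0 Hd _.
  apply: ccontM; last by apply: ccontB (ccont_id _) (ccont_cst _ _).
  by apply: ccontX; exact: qcont.
- move=> w wr.
  have hcd u : u != z -> u != y -> cabs (u - z) < r / 2 -> cdiff h u.
    move=> uz uy ur; have [d [d0 Hd]] := hnear u uz; apply: cdiff_near d0 Hd _.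
    apply: cdiffM; last by apply: cdiffB (cdiff_id _) (cdiff_cst _ _).
    apply: cdiffX; apply: cquot_cdiff qq uy _; apply: kd; apply: in2 => //; exact: ltW.
  have [d [d0 Hd]] := ball_sub wr.
  have [d1 [d10 Hd1]] : exists d1 : R, 0 < d1 /\ forall u, 0 < cabs (u - w) < d1 -> u != z.
    have [->|wz] := eqVneq w z.
      by exists 1; split=> // u /andP[+ _]; rewrite cabs_gt0 subr_eq0.
    exists (cabs (w - z)); split; first by rewrite cabs_gt0 subr_eq0.
    by move=> u /andP[_]; apply: contraTneq => ->; rewrite cabs_distC ltxx.
  have [d2 [d20 Hd2]] : exists d1 : R, 0 < d1 /\ forall u, 0 < cabs (u - w) < d1 -> u != y.
    have [->|wz] := eqVneq w y.
      by exists 1; split=> // u /andP[+ _]; rewrite cabs_gt0 subr_eq0.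
    exists (cabs (w - y)); split; first by rewrite cabs_gt0 subr_eq0.
    by move=> u /andP[_]; apply: contraTneq => ->; rewrite cabs_distC ltxx.
  exists (Num.min d (Num.min d1 d2)); split; first by rewrite !lt_min d0 d10.
  move=> u /andP[u0]; rewrite !lt_min => /and3P[ud ud1 ud2].
  by apply: hcd; [apply: Hd1|apply: Hd2|apply: Hd]; rewrite ?u0.
- move=> w wr; have wz : w != z by rewrite -subr_eq0 -cabs_gt0 wr.
  have wyn : w != y.
    by apply/eqP => wy; move: yr; rewrite -wy wr; lra.
  rewrite /h (negbTE wz) cabsM wr ler_pM2r // cabsX lerXn2r ?nnegrE ?cabs_ge0 //.
  have wyd : r / 4 <= cabs (w - y) by have := cabs_triangle y w z; lra.
  rewrite (cquotE qq wyn) cabs_div.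
  have -> : 8 * M / r = 2 * M / (r / 4) by field; rewrite gt_eqF.
  rewrite ler_pM ?cabs_ge0 ?invr_ge0 ?cabs_ge0 //.
    have := cabsB (k w) (k y); have := kM y yb; have : cabs (k w) <= M.
      by apply: kM; rewrite wr r2 /=; lra.
    lra.
  by rewrite lef_pV2 ?posrE //; [apply: lt_le_trans wyd|]; rewrite divr_gt0.
Qed.

(** By the Lipschitz bound the values along a geometric sequence tending to [z] converge, and the
    same bound compares every other value with the limit. *)
Lemma removable k z r M : 0 < r -> (forall x, 0 < cabs (x - z) < r -> cdiff k x) ->
  (forall x, 0 < cabs (x - z) < r -> cabs (k x) <= M) ->
  exists v, forall x, 0 < cabs (x - z) < r / 4 -> cabs (k x - v) <= 8 * M / r * cabs (x - z).
Proof.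
move=> r0 kd kM; have L := removable_lip r0 kd kM.
pose u n : C := z + ((r / 8 * 2^-1 ^+ n)%:C)%C.
have hp n : 0 < (2^-1 : R) ^+ n by rewrite exprn_gt0 // invr_gt0.
have h1 n : (2^-1 : R) ^+ n <= 1 by rewrite exprn_ile1 ?invr_ge0 // invf_le1 // ler1n.
have uz n : u n - z = ((r / 8 * 2^-1 ^+ n)%:C)%C by rewrite /u addrC addKr.
have cu n : cabs (u n - z) = r / 8 * 2^-1 ^+ n.
  by rewrite uz cabs_real gtr0_norm // mulr_gt0 // divr_gt0.
have r8 : 0 < r / 8 by rewrite divr_gt0.
have ub n : 0 < cabs (u n - z) < r / 4.
  rewrite cu mulr_gt0 //=; apply: (@le_lt_trans _ _ (r / 8)); first by rewrite ler_piMr // ltW.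
  lra.
have M0 : 0 <= M.
  apply: le_trans (kM (u 0%N) _); rewrite ?cabs_ge0 //.
  by have /andP[-> ?] := ub 0%N; lra.
have K0 : 0 <= 8 * M / r by rewrite !(divr_ge0, mulr_ge0) // ltW.
have [v kv] : exists v, ccvg (fun n => k (u n)) v.
  apply: (@geom_cauchy R _ (8 * M / r * (r / 8))) => n.
  apply: le_trans (L _ _ (ub n.+1) (ub n)) _; rewrite -(mulrA (8 * M / r)).
  apply: ler_wpM2l K0 _ _ _.
  have -> : u n.+1 - u n = - (((r / 8 * 2^-1 ^+ n / 2)%:C)%C).
    have -> : u n.+1 - u n = (u n.+1 - z) - (u n - z) by ring.
    rewrite !uz -(rmorphB (real_complex R)) -(rmorphN (real_complex R)); congr (_%:C)%C.
    by rewrite exprS; move: (_ ^+ n) => q; field.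
  rewrite cabsN cabs_real gtr0_norm; last by rewrite divr_gt0 // mulr_gt0.
  by have := mulr_gt0 r8 (hp n); lra.
exists v => x xr; rewrite cabs_distC.
apply/ler_addgt0Pr => e e0.
have [N HN] := half_seq_lt (8 * M / r * (r / 8)) (divr_gt0 e0 (ltr0Sn _ 1)).
have [N' HN'] := kv _ (divr_gt0 e0 (ltr0Sn _ 1)).
pose n := maxn N N'.
have A1 := HN' n (leq_maxr _ _); have A2 := L _ _ (ub n) xr.
have A3 : 8 * M / r * cabs (u n - z) <= e / 2.
  apply: le_trans (ltW HN); rewrite cu mulrA; apply: ler_wpM2l; first by rewrite mulr_ge0 // ltW.
  by apply: ler_wiXn2l; rewrite ?invr_ge0 ?leq_maxl // invf_le1 // ler1n.
have A4 : 8 * M / r * cabs (u n - x) <= 8 * M / r * cabs (u n - z) + 8 * M / r * cabs (x - z).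
  by rewrite -mulrDr; apply: ler_wpM2l K0 _ _ _; rewrite (cabs_distC x z); exact: cabs_triangle.
have := cabs_triangle (k (u n)) v (k x); rewrite (cabs_distC v (k (u n))); lra.
Qed.

Lemma half_ball_bounded f z r : 0 < r -> (forall x, cabs (x - z) < r -> cdiff f x) ->
  exists M : R, 0 < M /\ forall x, cabs (x - z) <= r / 2 -> cabs (f x) <= M.
Proof.
move=> r0 fd; apply: (@cabs_bounded R [set x | cabs (x - z) <= r / 2] f (cabs z + r / 2)).
- by move=> x; exact: cball_bound.
- exact: cclosed_cball.
- by apply: ccont_at_on => x /= xr; apply: cdiff_cont; apply: fd; lra.
Qed.

(** At [z] itself, [taylor2] bounds the quotient of [p - p z] by [x - z]; its singularity is
    removable, and the value there is the derivative of [p]. *)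
Lemma cquot_differentiable f z r : 0 < r -> (forall x, cabs (x - z) < r -> cdiff f x) ->
  forall p, cquot f z p -> forall x, cabs (x - z) < r -> cdiff p x.
Proof.
move=> r0 fd p qp x xr; have [xz|xz] := eqVneq x z; last first.
  by apply: cquot_cdiff qp xz _; exact: fd.
rewrite xz => {x xr xz}; have [l fl] : cdiff f z by apply: fd; rewrite subrr cabs0.
have [M [M0 fM]] : exists M : R, 0 < M /\ forall x, cabs (x - z) < r / 2 -> cabs (f x) <= M.
  by have [M [M0 HM]] := half_ball_bounded r0 fd; exists M; split=> // x /ltW; exact: HM.
have r2 : 0 < r / 2 by rewrite divr_gt0.
have fd2 x : cabs (x - z) < r / 2 -> cdiff f x by move=> ?; apply: fd; lra.
have T := taylor2 r2 fd2 fM fl qp.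
pose k x := (p x - p z) / (x - z).
have r8 : 0 < r / 2 / 4 by rewrite !divr_gt0.
have kd x : 0 < cabs (x - z) < r / 2 / 4 -> cdiff k x.
  move=> /andP[x0 xr]; have xz : x != z by rewrite -subr_eq0 -cabs_gt0.
  apply: cdiffM; first by apply: cdiffB (cdiff_cst _ _); apply: cquot_cdiff qp xz _; apply: fd; lra.
  by apply: cdiffV; [rewrite subr_eq0|apply: cdiffB (cdiff_id _) (cdiff_cst _ _)].
have kM x : 0 < cabs (x - z) < r / 2 / 4 -> cabs (k x) <= 8 * M / (r / 2) ^+ 2.
  by move=> /andP[x0 xr]; rewrite /k cabs_div ler_pdivrMr //; exact: T.
have [v Hv] := removable r8 kd kM.
set K := 8 * _ / _ in Hv.
have K0 : 0 < K + 1.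
  by rewrite ltr_wpDl // /K !(divr_ge0, mulr_ge0, exprn_ge0) // ltW.
clearbody K; exists v => e e0.
exists (Num.min (r / 2 / 4 / 4) (e / (K + 1))); split.
  by rewrite lt_min !divr_gt0.
move=> w /andP[w0]; rewrite lt_min => /andP[w1 w2].
have := Hv (z + w); rewrite /k (addrC z w) addrK w0 w1 => /(_ isT).
move/le_lt_trans; apply.
apply: (@le_lt_trans _ _ ((K + 1) * cabs w)); first by rewrite ler_wpM2r ?cabs_ge0 // lerDl.
by rewrite mulrC -ltr_pdivlMr.
Qed.

(** If every power of [x - z] could be split off, the maximum principle would bound the cofactors by
    [2 M / (r / 2)^(n+1)], and [f] would be constant near [z]. *)
Lemma vanishing_order f z r : 0 < r -> (forall x, cabs (x - z) < r -> cdiff f x) ->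
  (forall s : R, 0 < s -> exists x, cabs (x - z) < s /\ f x <> f z) ->
  exists n g, [/\ (forall x, cabs (x - z) < r -> cdiff g x), g z != 0 &
     forall x, f x = f z + (x - z) ^+ n.+1 * g x].
Proof.
move=> r0 fd nc; apply: contrapT => H.
have all_div n : exists g, (forall x, cabs (x - z) < r -> cdiff g x) /\
    forall x, f x = f z + (x - z) ^+ n.+1 * g x.
  elim: n => [|n [g [gd fg]]].
    have [l fl] : cdiff f z by apply: fd; rewrite subrr cabs0.
    have [p [qp _]] := cquot_exists fl; exists p; split.
      exact: cquot_differentiable qp.
    by move=> x; rewrite {1}(qp.2 x) expr1 mulrC.
  have gz : g z = 0.
    by apply/eqP/negPn/negP => gz; apply: H; exists n, g.
  have [l gl] : cdiff g z by apply: gd; rewrite subrr cabs0.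
  have [p [qp _]] := cquot_exists gl; exists p; split.
    exact: cquot_differentiable qp.
  by move=> x; rewrite fg (qp.2 x) gz add0r [in RHS]exprSr -!mulrA [p x * _]mulrC.
have [M [M0 fM]] : exists M : R, 0 < M /\ forall x, cabs (x - z) <= r / 2 -> cabs (f x) <= M.
  exact: half_ball_bounded.
have r2 : 0 < r / 2 by rewrite divr_gt0.
have [x [xr fx]] := nc _ (divr_gt0 r2 (ltr0Sn _ 1)).
have bnd n : cabs (f x - f z) <= 2 * M * 2^-1 ^+ n.+1.
  have [g [gd fg]] := all_div n.
  have gM y : cabs (y - z) <= r / 2 -> cabs (g y) <= 2 * M / (r / 2) ^+ n.+1.
    apply: ball_max => //.
    - by move=> w wr; apply: cdiff_cont; apply: gd; lra.
    - by move=> w wr; apply: isolated_regular_ball gd _; lra.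
    - move=> w wr; rewrite ler_pdivlMr ?exprn_gt0 // -wr -cabsX -cabsM mulrC.
      have -> : (w - z) ^+ n.+1 * g w = f w - f z by rewrite (fg w) (addrC (f z)) addrK.
      apply: le_trans (cabsB _ _) _; have := fM w; have := fM z.
      by rewrite subrr cabs0 wr lexx => /(_ (ltW r2)) A /(_ isT) B; lra.
  rewrite (fg x) (addrC (f z)) addrK cabsM cabsX.
  apply: (@le_trans _ _ ((r / 2 / 2) ^+ n.+1 * (2 * M / (r / 2) ^+ n.+1))).
    apply: ler_pM; rewrite ?exprn_ge0 ?cabs_ge0 //.
      by rewrite lerXn2r ?nnegrE ?cabs_ge0 ?(ltW xr) // divr_ge0 // ltW.
    by apply: gM; apply: le_trans (ltW xr) _; lra.
  rewrite [(r / 2 / 2) ^+ _]exprMn; have := exprn_gt0 n.+1 r2.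
  move: ((r / 2) ^+ n.+1) (2^-1 ^+ n.+1) => P Q P0.
  by rewrite le_eqVlt; apply/orP; left; apply/eqP; field; rewrite gt_eqF.
apply: fx; apply/eqP; rewrite -subr_eq0 -cabs_eq0 eq_le cabs_ge0 andbT.
apply/ler_addgt0Pr => e e0; rewrite add0r.
have [n Hn] := half_seq_lt (2 * M) e0; apply: le_trans (bnd n) _; apply: le_trans (ltW Hn).
rewrite ler_pM2l ?mulr_gt0 // exprS ler_piMl ?exprn_ge0 ?invr_ge0 //.
by rewrite invf_le1 // ler1n.
Qed.

(** The derivative is [(x - z)^n ((n+1) g + (x - z) g')]. Near [z] the second factor is nonzero,
    since [g z] is nonzero and the Lipschitz constant of [g] bounds [g']. *)
Lemma isolated_critical f z r : 0 < r -> (forall x, cabs (x - z) < r -> cdiff f x) ->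
  (forall s : R, 0 < s -> exists x, cabs (x - z) < s /\ f x <> f z) ->
  exists s : R, 0 < s /\ forall x, 0 < cabs (x - z) < s -> ~ is_cderiv f x 0.
Proof.
move=> r0 fd nc; have [n [g [gd gz fg]]] := vanishing_order r0 fd nc.
have [M [M0 gM]] : exists M : R, 0 < M /\ forall x, cabs (x - z) < r / 2 -> cabs (g x) <= M.
  by have [M [M0 HM]] := half_ball_bounded r0 gd; exists M; split=> // x /ltW; exact: HM.
have r2 : 0 < r / 2 by rewrite divr_gt0.
have gd2 x : cabs (x - z) < r / 2 -> cdiff g x by move=> ?; apply: gd; lra.
have L := cauchy_lip r2 gd2 gM.
set K := 4 * M / _ in L.
have K0 : 0 < K by rewrite /K divr_gt0 // mulr_gt0.
clearbody K.
have a0 : 0 < cabs (g z) by rewrite cabs_gt0.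
exists (Num.min (r / 2 / 4) (cabs (g z) / 2 / K)); split; first by rewrite lt_min !divr_gt0.
move=> x /andP[x0]; rewrite lt_min => /andP[xr xK] fx.
have xz : x - z != 0 by rewrite -cabs_gt0.
have r8 : 0 < r / 2 / 4 by rewrite !divr_gt0.
have [m gm] : cdiff g x by apply: gd; lra.
have mK : cabs m <= K.
  have [d [d0 Hd]] := ball_sub xr.
  by apply: cderiv_le gm d0 _ => y yd; apply: L => //; exact: Hd.
have dl : is_cderiv (fun y => (y - z) ^+ n.+1) x (n.+1%:R * (x - z) ^+ n).
  elim: n {fg} => [|n IH].
    rewrite expr0 mulr1 -[1%:R]subr0; under eq_fun do rewrite expr1.
    by apply: cderivB (cderiv_id _) (cderiv_cst _ _).
  under eq_fun do rewrite exprS.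
  have -> : n.+2%:R * (x - z) ^+ n.+1 = (1 - 0) * (x - z) ^+ n.+1 + (x - z) * (n.+1%:R * (x - z) ^+ n).
    by rewrite -[n.+2%:R]nat1r exprS; ring.
  exact: (cderivM (cderivB (cderiv_id _) (cderiv_cst _ _)) IH).
have := cderivD (cderiv_cst (f z) x) (cderivM dl gm).
have -> : (fun y => f z + (y - z) ^+ n.+1 * g y) = f by apply/funext => y; rewrite -fg.
move=> /(cderiv_unique fx)/esym/eqP; rewrite add0r exprSr.
have -> : n.+1%:R * (x - z) ^+ n * g x + (x - z) ^+ n * (x - z) * m =
  (x - z) ^+ n * (n.+1%:R * g x + (x - z) * m) by ring.
rewrite mulf_eq0 expf_eq0 (negbTE xz) andbF /= addr_eq0 => /eqP E.
have E1 : n.+1%:R * cabs (g x) = cabs (x - z) * cabs m.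
  by rewrite -(cabs_natmul R n.+1) -cabsM E cabsN cabsM.
have h1 : cabs (g z) <= cabs (g x) + cabs (g z - g x) by exact: cabs_le_sub.
have h2 : cabs (g z - g x) < cabs (g z) / 2.
  rewrite cabs_distC; apply: le_lt_trans (L x z xr _) _; first by rewrite subrr cabs0.
  by rewrite mulrC -ltr_pdivlMr.
have h3 : cabs (x - z) * cabs m < cabs (g z) / 2.
  apply: (@le_lt_trans _ _ (cabs (x - z) * K)); first by rewrite ler_pM2l.
  by rewrite -ltr_pdivlMr.
have h4 : cabs (g x) <= n.+1%:R * cabs (g x) by rewrite ler_peMl ?cabs_ge0 // ler1n.
lra.
Qed.

End HolomorphicLocal.

(** * Hausdorff content and dimension *)

Section HausdorffContent.
Variable R : realType.
Local Notation C := R[i].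
Implicit Types (A B : set C) (s x y : R) (U : nat -> set C) (d : nat -> R).

(** Bounding all partial sums keeps nonnegative series inside the reals; [sumleP] translates to the
    extended series. *)
Definition sumle (a : nat -> R) (x : R) := forall n, \sum_(j < n) a j <= x.

Lemma sumleP (a : nat -> R) x : (forall n, 0 <= a n) ->
  sumle a x <-> (\sum_(j <oo) (a j)%:E <= x%:E)%E.
Proof.
move=> a0; split=> [H|H n].
  apply: lime_le; first by apply: is_cvg_nneseries => n _ _; rewrite lee_fin.
  by apply: nearW => n /=; rewrite big_mkord sumEFin lee_fin.
rewrite -lee_fin -sumEFin; apply: le_trans H.
rewrite -(big_mkord xpredT (fun j => (a j)%:E)).
by apply: nneseries_lim_ge => k _ _; rewrite lee_fin.
Qed.

Lemma sumle_ge0 (a : nat -> R) x : sumle a x -> 0 <= x.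
Proof. by move=> /(_ 0%N); rewrite big_ord0. Qed.

Lemma sumle_term (a : nat -> R) x : (forall n, 0 <= a n) -> sumle a x -> forall n, a n <= x.
Proof.
move=> a0 H n; apply: le_trans (H n.+1); rewrite big_ord_recr /= lerDr.
by apply: sumr_ge0.
Qed.

Lemma sumle_double (F : nat -> nat -> R) (y : nat -> R) x : (forall j i, 0 <= F j i) ->
  (forall j, sumle (F j) (y j)) -> sumle y x ->
  exists f : nat -> nat * nat, (forall p, exists n, f n = p) /\
    sumle (fun n => F (f n).1 (f n).2) x.
Proof.
move=> F0 Fy yx.
have y0 j : 0 <= y j := sumle_ge0 (Fy j).
have /ppcard_eqP[f] : ([set: nat] #= [set: nat * nat])%card.
  by rewrite card_eq_sym; exact: card_nat2.
exists f; split.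
  move=> p; exists (f^-1%FUN p); by rewrite invK ?inE.
apply/sumleP => //.
apply: (@le_trans _ _ (\sum_(j <oo) \sum_(i <oo) (F j i)%:E)%E); last first.
  apply: (@le_trans _ _ (\sum_(j <oo) (y j)%:E)%E); last exact/sumleP.
  apply: lee_nneseries => [j _ _|j _]; first by apply: nneseries_ge0 => i _ _; rewrite lee_fin.
  exact/sumleP.
have FE j i : (0 <= (F j i)%:E)%E by rewrite lee_fin.
rewrite le_eqVlt; apply/orP; left; apply/eqP; apply/esym.
transitivity (\esum_(l in [set: nat] `*` [set: nat]) (F l.1 l.2)%:E)%E.
  rewrite (_ : _ `*` _ = setT `*`` (fun=> setT)); last by apply/seteqP; split.
  rewrite -(@esum_esum _ _ _ _ _ (fun i j => (F i j)%:E))//.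
  rewrite nneseries_esumT; last by move=> n; apply: nneseries_ge0.
  by apply: eq_esum => i _; rewrite nneseries_esumT.
rewrite (reindex_esum [set: nat] _ f)//; last first.
  have := @bijTT _ _ f.
  by rewrite -setTT_bijective/= -[in X in set_bij _ X _ -> _](@setXTT nat nat).
by rewrite nneseries_esumT.
Qed.

Definition covers A U d := (A `<=` \bigcup_i U i) /\
  forall i, 0 <= d i /\ forall a b, U i a -> U i b -> cabs (a - b) <= d i.

(** An upper bound for the Hausdorff content of dimension [s]: covers by sets of any size are
    allowed, unlike in the Hausdorff measure. *)
Definition hle s A x := forall e : R, 0 < e ->
  exists U d, covers A U d /\ sumle (fun i => d i `^ s) (x + e).

Lemma hle_ge0 s A x : hle s A x -> 0 <= x.
Proof.
by move=> H; apply/ler_addgt0Pr => e /H[U [d [_ /sumle_ge0]]].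
Qed.

Lemma hle_sub s A B x y : A `<=` B -> x <= y -> hle s B x -> hle s A y.
Proof.
move=> AB xy H e /H[U [d [[BU dU] du]]]; exists U, d; split.
  by split=> // z /AB; exact: BU.
by move=> n; apply: le_trans (du n) _; rewrite lerD2r.
Qed.

Lemma sum_half_le n : \sum_(j < n) (2^-1 : R) ^+ j.+1 <= 1.
Proof.
suff -> : \sum_(j < n) (2^-1 : R) ^+ j.+1 = 1 - 2^-1 ^+ n.
  by rewrite gerBl exprn_ge0 // invr_ge0.
elim: n => [|n IH]; first by rewrite big_ord0 expr0 subrr.
by rewrite big_ord_recr /= IH exprS; field.
Qed.

Lemma hle_bigcup s A (A_ : nat -> set C) (x_ : nat -> R) x : A `<=` \bigcup_j A_ j ->
  (forall j, hle s (A_ j) (x_ j)) -> sumle x_ x -> hle s A x.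
Proof.
move=> AA H sx e e0.
have hp n : 0 < (2^-1 : R) ^+ n by rewrite exprn_gt0 // invr_gt0.
have /choice[Ud HUd] : forall j, exists Ud : (nat -> set C) * (nat -> R),
    covers (A_ j) Ud.1 Ud.2 /\ sumle (fun i => Ud.2 i `^ s) (x_ j + e * 2^-1 ^+ j.+1).
  by move=> j; have [U [d H']] := H j _ (mulr_gt0 e0 (hp j.+1)); exists (U, d).
have sy : sumle (fun j => x_ j + e * 2^-1 ^+ j.+1) (x + e).
  move=> n; rewrite big_split /=; apply: lerD; first exact: sx.
  rewrite -mulr_sumr ler_piMr ?(ltW e0) //; exact: sum_half_le.
have [f [fs fle]] := sumle_double (F := fun j i => (Ud j).2 i `^ s)
  (fun j i => powR_ge0 _ _) (fun j => (HUd j).2) sy.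
exists (fun n => (Ud (f n).1).1 (f n).2), (fun n => (Ud (f n).1).2 (f n).2); split=> //.
split; last by move=> i; exact: (HUd (f i).1).1.2.
move=> z /AA[j _ /((HUd j).1.1)[i _ Uz]].
by have [n fn] := fs (j, i); exists n => //; rewrite fn.
Qed.

Definition null s A := hle s A 0.

Lemma null_bigcup s A (A_ : nat -> set C) : A `<=` \bigcup_j A_ j ->
  (forall j, null s (A_ j)) -> null s A.
Proof.
move=> AA H; apply: hle_bigcup AA H _ => n.
by rewrite big1.
Qed.

Lemma null_sub s A B : A `<=` B -> null s B -> null s A.
Proof. by move=> AB; exact: hle_sub. Qed.

Lemma null_subsingleton s A : 0 < s -> (forall a b, A a -> A b -> a = b) -> null s A.
Proof.
move=> s0 A1 e e0; exists (fun=> A), (fun=> 0); split; last first.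
  by move=> n; rewrite add0r big1 ?ltW // => i _; rewrite powR0 // gt_eqF.
split=> [z Az|_]; first by exists 0%N.
by split=> // a b Aa Ab; rewrite (A1 a b) // subrr cabs0.
Qed.

Lemma null_set0 s : 0 < s -> null s set0.
Proof. by move=> s0; apply: null_subsingleton. Qed.

Lemma hleU s A B x y : 0 < s -> hle s A x -> hle s B y -> hle s (A `|` B) (x + y).
Proof.
move=> s0 hA hB.
have x0 := hle_ge0 hA; have y0 := hle_ge0 hB.
apply: (@hle_bigcup s _ (fun j => match j with 0%N => A | 1%N => B | _ => set0 end)
  (fun j => match j with 0%N => x | 1%N => y | _ => 0 end)).
- by move=> z [Az|Bz]; [exists 0%N|exists 1%N].
- by move=> [|[|j]] //; exact: null_set0.
- move=> [|[|n]]; rewrite ?big_ord0 ?addr_ge0 //.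
    by rewrite big_ord_recl big_ord0 addr0 lerDl.
  by rewrite !big_ord_recl /= big1 ?addr0.
Qed.

Lemma hle_seq s (T : eqType) (l : seq T) (A_ : T -> set C) (x_ : T -> R) : 0 < s ->
  (forall b, b \in l -> hle s (A_ b) (x_ b)) ->
  hle s [set z | exists b, b \in l /\ A_ b z] (\sum_(b <- l) x_ b).
Proof.
move=> s0; elim: l => [|b l IH] H.
  by rewrite big_nil; apply: null_sub (null_set0 s0) => z [b []].
rewrite big_cons; apply: (hle_sub _ (lexx _) (hleU s0 (H b (mem_head _ _)) (IH _))).
  by move=> z [b' []]; rewrite inE => /orP[/eqP ->|b'l] Az; [left|right; exists b'].
by move=> b' b'l; apply: H; rewrite inE b'l orbT.
Qed.

(** Here [B] is a pullback of [A] under a map [phi] that expands distances by at least [1 / K], so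
    no inverse branch has to be constructed to transport a cover. *)
Lemma hle_lip s A B x (K : R) (phi : C -> C) : 0 < s -> 0 <= K -> hle s A x ->
  (forall b, B b -> A (phi b)) ->
  (forall b b', B b -> B b' -> cabs (b - b') <= K * cabs (phi b - phi b')) ->
  hle s B (K `^ s * x).
Proof.
move=> s0 K0 hA BA BK e e0.
have k0 := powR_ge0 K s.
have k1 : 0 < K `^ s + 1 by rewrite ltr_wpDl.
have [U [d [[AU Ud] sU]]] := hA _ (divr_gt0 e0 k1).
exists (fun i => [set b | B b /\ U i (phi b)]), (fun i => K * d i); split.
  split=> [b Bb|i]; first by have [i _ Ui] := AU _ (BA b Bb); exists i.
  have [d0 Hd] := Ud i; split=> [|b b' [Bb Ub] [Bb' Ub']]; first exact: mulr_ge0.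
  by apply: le_trans (BK b b' Bb Bb') _; apply: ler_wpM2l => //; exact: Hd.
move=> n; under eq_bigr do rewrite powRM ?(Ud _).1 //.
rewrite -mulr_sumr; apply: le_trans (ler_wpM2l k0 (sU n)) _.
rewrite mulrDr lerD2l mulrA ler_pdivrMr // mulrC ler_pM2l // lerDl //.
Qed.

Lemma null_lip s A B (K : R) (phi : C -> C) : 0 < s -> 0 <= K -> null s A ->
  (forall b, B b -> A (phi b)) ->
  (forall b b', B b -> B b' -> cabs (b - b') <= K * cabs (phi b - phi b')) ->
  null s B.
Proof. by move=> s0 K0 nA BA BK; rewrite /null -(mulr0 (K `^ s)); exact: hle_lip nA BA BK. Qed.

Lemma cdiam_le (V : set C) (D : R) : 0 <= D -> (forall a b, V a -> V b -> cabs (a - b) <= D) ->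
  (cdiam V <= D%:E)%E.
Proof.
move=> D0 H; apply: ge_ereal_sup => _ [->|[a [b [Va [Vb ->]]]]]; rewrite lee_fin //.
exact: H.
Qed.

Lemma cdiam_ge0 (V : set C) : (0 <= cdiam V)%E.
Proof. by apply: ereal_sup_ubound; left. Qed.

Lemma cdiam_ge (V : set C) a b : V a -> V b -> ((cabs (a - b))%:E <= cdiam V)%E.
Proof. by move=> Va Vb; apply: ereal_sup_ubound; right; exists a, b. Qed.

(** Content and measure have the same null sets: a small sum forces every term, hence every
    diameter, to be small. *)
Lemma Hmeas_null s A : 0 < s -> Hmeas s A = 0%E <-> null s A.
Proof.
move=> s0; split=> [H|H].
  move=> e e0; have : (Hdelta s 1 A < e%:E)%E.
    apply: (@le_lt_trans _ _ 0%E); last by rewrite lte_fin.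
    by rewrite -H; apply: ereal_sup_ubound; exists 1 => //=.
  move=> /ereal_inf_lt[_ [U [AU Ud] <-] Ue].
  have fin i : cdiam (U i) \is a fin_num.
    rewrite ge0_fin_numE ?cdiam_ge0 //; apply: le_lt_trans (Ud i) _; exact: ltry.
  exists U, (fun i => fine (cdiam (U i))); split.
    split=> // i; split; first by rewrite fine_ge0 // cdiam_ge0.
    by move=> a b Ua Ub; rewrite -lee_fin fineK //; exact: cdiam_ge.
  by apply/sumleP => [n|]; [exact: powR_ge0|rewrite add0r; exact: ltW].
have nn dl : (0 <= Hdelta s dl A)%E.
  apply: le_ereal_inf_tmp => _ [U _ <-]; apply: nneseries_ge0 => i _ _.
  by rewrite lee_fin powR_ge0.
have z dl : 0 < dl -> Hdelta s dl A = 0%E.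
  move=> dl0; apply/eqP; rewrite eq_le nn andbT; apply/lee_addgt0Pr => e e0; rewrite add0e.
  pose e' := Num.min e (dl `^ s).
  have e'0 : 0 < e' by rewrite lt_min e0 powR_gt0.
  have [U [d [[AU Ud] sU]]] := H _ e'0; rewrite add0r in sU.
  have dd i : d i <= dl.
    have := sumle_term (fun i => powR_ge0 (d i) s) sU i; rewrite leNgt => h; rewrite leNgt.
    apply/negP => dld; move/negP: h; apply; apply: (@le_lt_trans _ _ (dl `^ s)).
      by rewrite ge_min lexx orbT.
    by apply: gt0_ltr_powR => //; rewrite nnegrE ?(Ud i).1 // ltW.
  have cd i : (cdiam (U i) <= (d i)%:E)%E by apply: cdiam_le; [exact: (Ud i).1|exact: (Ud i).2].
  apply: (@le_trans _ _ (\sum_(i <oo) ((fine (cdiam (U i))) `^ s)%:E)%E).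
    apply: ereal_inf_lbound; exists U => //; split=> // i.
    by apply: le_trans (cd i) _; rewrite lee_fin.
  apply: (@le_trans _ _ e'%:E); last by rewrite lee_fin ge_min lexx.
  apply/sumleP => [n|n]; first exact: powR_ge0.
  apply: le_trans (sU n); apply: ler_sum => i _; apply: ge0_ler_powR; first exact: ltW.
  - by rewrite nnegrE fine_ge0 // cdiam_ge0.
  - by rewrite nnegrE (Ud i).1.
  - rewrite -lee_fin fineK ?cd // ge0_fin_numE ?cdiam_ge0 //.
    by apply: le_lt_trans (cd i) _; exact: ltry.
apply/eqP; rewrite eq_le; apply/andP; split.
  by apply: ge_ereal_sup => _ [dl /= dl0 <-]; rewrite z.
by rewrite -(z 1 ltr01); apply: ereal_sup_ubound; exists 1 => //=.
Qed.

(** Since [x^0 = 1] also for [x = 0], every cover costs at least one, even for the empty set. Hence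
    only positive exponents compete in [HD]. *)
Lemma Hmeas0 A : Hmeas 0 A <> 0%E.
Proof.
move=> H; have : (Hdelta 0 1 A <= 0)%E.
  by rewrite -H; apply: ereal_sup_ubound; exists 1 => //=.
have : (1 <= Hdelta 0 1 A)%E.
  apply: le_ereal_inf_tmp => _ [U _ <-].
  apply: le_trans (@nneseries_lim_ge R _ xpredT 0%N 1%N _) => [|n _ _]; last first.
    by rewrite lee_fin powR_ge0.
  by rewrite big_nat1 powRr0.
by move=> h1 /(le_trans h1); rewrite lee_fin ler10.
Qed.

Lemma HD_le_null A (s : R) : 0 < s -> null s A -> (HD A <= s%:E)%E.
Proof.
move=> s0 nA; apply: ereal_inf_lbound; exists s => //; split; first exact: ltW.
exact/Hmeas_null.
Qed.

Lemma HD_mono A B : (forall s, 0 < s -> null s B -> null s A) -> (HD A <= HD B)%E.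
Proof.
move=> H; apply: le_ereal_inf_tmp => _ [s [s0 sB] <-]; apply: ereal_inf_lbound.
have sp : 0 < s.
  by rewrite lt_neqAle s0 andbT; apply/eqP => s00; move: sB; rewrite -s00; exact: Hmeas0.
by exists s => //; split=> //; apply/Hmeas_null => //; apply: H => //; apply/Hmeas_null.
Qed.

Lemma HD_ge A (t : R) : (forall s, 0 < s -> s < t -> ~ null s A) -> (t%:E <= HD A)%E.
Proof.
move=> H; apply: le_ereal_inf_tmp => _ [s [s0 sB] <-]; rewrite lee_fin leNgt.
have sp : 0 < s.
  by rewrite lt_neqAle s0 andbT; apply/eqP => s00; move: sB; rewrite -s00; exact: Hmeas0.
by apply/negP => st; apply: (H s sp st); apply/Hmeas_null.
Qed.

End HausdorffContent.

(** * Cantor sets and the mass distribution principle *)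

Section CantorSets.
Variable R : realType.
Local Notation C := R[i].
Variable N : nat -> nat.
Hypothesis N2 : forall n, (2 <= N n)%N.

(** The mass of a cylinder of depth [m] under the uniform product measure on digit sequences. *)
Definition cylmass (m : nat) : R := (\prod_(k < m) (N k)%:R)^-1.

Let N_gt0 k : 0 < (N k)%:R :> R.
Proof. by rewrite ltr0n (leq_trans _ (N2 k)). Qed.

Lemma prodN_gt0 m : 0 < \prod_(k < m) (N k)%:R :> R.
Proof. by apply: prodr_gt0. Qed.

Lemma cylmass_gt0 m : 0 < cylmass m.
Proof. by rewrite invr_gt0 prodN_gt0. Qed.

Lemma cylmassS m : (N m)%:R * cylmass m.+1 = cylmass m.
Proof. by rewrite /cylmass big_ord_recr /= invfM mulrCA mulfV ?mulr1 // gt_eqF. Qed.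

Lemma cylmass_half m : cylmass m <= 2^-1 ^+ m.
Proof.
elim: m => [|m IH]; first by rewrite /cylmass big_ord0 invr1 expr0.
have : 2 * cylmass m.+1 <= cylmass m.
  by rewrite -(cylmassS m) ler_pM2r ?cylmass_gt0 // ler_nat.
rewrite exprS; move: IH; move: (2^-1 ^+ m) => q; lra.
Qed.

Definition valid (x : nat -> nat) := forall k, (x k < N k)%N.

Definition agree (x y : nat -> nat) m := all (fun k => x k == y k) (iota 0 m).

Lemma agreeP x y m : reflect (forall k, (k < m)%N -> x k = y k) (agree x y m).
Proof.
apply: (iffP allP) => [H k km|H k]; first by apply/eqP/H; rewrite mem_iota.
by rewrite mem_iota => /H /eqP.
Qed.

Section Avoid.
Variables (x : nat -> nat -> nat) (n : nat -> nat) (q : R).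
Hypotheses (xv : forall i, valid (x i)) (q1 : q < 1).
Hypothesis mass : sumle (fun i => cylmass (n i)) q.

(** The mass that the [i]-th cylinder has inside the cylinder given by the first [m] digits of [y]:
    the two are nested or disjoint, and the deeper one counts. *)
Let part m y i : R := if agree (x i) y (minn (n i) m) then cylmass (maxn (n i) m) else 0.

Let upd (y : nat -> nat) (m j k : nat) : nat := if k == m then j else y k.

Let agree_upd i y m j k : (k <= m)%N -> agree (x i) (upd y m j) k = agree (x i) y k.
Proof.
move=> km; apply: eq_in_all => l; rewrite mem_iota add0n /= => lk.
by rewrite /upd (ltn_eqF (leq_trans lk km)).
Qed.

Let part_sum y m i : \sum_(j < N m) part m.+1 (upd y m j) i = part m y i.
Proof.
rewrite /part; have [nm|nm] := leqP (n i) m.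
  rewrite (minn_idPl (leqW nm)) (maxn_idPr (leqW nm)).
  under eq_bigr do rewrite agree_upd //.
  case: ifP => _; last by rewrite big1.
  by rewrite sumr_const card_ord -(cylmassS m) mulr_natl.
rewrite (minn_idPr nm) (maxn_idPl nm).
rewrite (bigD1 (Ordinal (xv i m))) //= big1 ?addr0.
  congr (if _ then _ else _); rewrite /agree -addn1 iotaD all_cat add0n /= {2}/upd eqxx eqxx !andbT.
  exact: agree_upd.
move=> j jn; rewrite ifF //; apply/negP => /agreeP /(_ m (ltnSn m)).
rewrite /upd eqxx => e; move/negP: jn; apply; apply/eqP/val_inj => /=.
by rewrite e.
Qed.

Let inv m y := sumle (part m y) (q * cylmass m).

Let part_ge0 m y i : 0 <= part m y i.
Proof. by rewrite /part; case: ifP => // _; rewrite ltW // cylmass_gt0. Qed.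

(** The parts in the children add up to the part in the parent, so not all children can exceed the
    share [q]. *)
Let step m y : inv m y -> exists j, (j < N m)%N /\ inv m.+1 (upd y m j).
Proof.
move=> Hi; apply: contrapT => H.
have /choice[t Ht] : forall j, exists t, (j < N m)%N ->
    q * cylmass m.+1 < \sum_(i < t) part m.+1 (upd y m j) i.
  move=> j; apply: contrapT => Hj; apply: H; exists j; split.
    by rewrite ltnNge; apply/negP => h; apply: Hj; exists 0%N; rewrite ltnNge h.
  move=> t; rewrite leNgt; apply/negP => lt; apply: Hj; by exists t.
(* There are finitely many children, so one truncation witnesses all their excesses and the finite
   sums can be exchanged. *)
pose T := (\max_(j < N m) t j)%N.
have HT j : (j < N m)%N -> q * cylmass m.+1 < \sum_(i < T) part m.+1 (upd y m j) i.
  move=> jm; apply: lt_le_trans (Ht j jm) _.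
  have tT : (t j <= T)%N by exact: (leq_bigmax (Ordinal jm)).
  rewrite -(big_mkord xpredT (part m.+1 (upd y m j))) -(big_mkord xpredT (part m.+1 (upd y m j))).
  by rewrite (big_cat_nat _ tT) //= lerDl sumr_ge0.
have : \sum_(j < N m) (q * cylmass m.+1) < \sum_(j < N m) \sum_(i < T) part m.+1 (upd y m j) i.
  apply: ltr_sum => [|j _]; last exact: HT.
  by apply/hasP; exists (Ordinal (leq_trans (ltn0Sn _) (N2 m))) => //; rewrite mem_index_enum.
rewrite exchange_big /= (eq_bigr (fun i : 'I_T => part m y i)) => [|i _]; last exact: part_sum.
rewrite sumr_const card_ord -mulr_natl mulrCA cylmassS => /lt_le_trans/(_ (Hi T)).
by rewrite ltxx.
Qed.

(** Countably many cylinders of total mass at most [q < 1] miss a point: each digit is chosen so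
    that their share of the current cylinder stays at most [q]. If [y] lay in the [i]-th one, that
    share would be everything at depth [n i]. *)
Lemma avoid_cylinders : exists y, valid y /\ forall i, ~~ agree (x i) y (n i).
Proof.
have /choice[nx Hnx] : forall my : nat * (nat -> nat), exists j, inv my.1 my.2 ->
    (j < N my.1)%N /\ inv my.1.+1 (upd my.2 my.1 j).
  move=> [m y]; have [/step[j Hj]|nI] := pselect (inv m y); first by exists j.
  by exists 0%N.
pose st := fix st m := if m is m'.+1 then upd (st m') m' (nx (m', st m')) else fun=> 0%N.
have inv_st m : inv m (st m).
  elim: m => [|m IH]; last exact: (Hnx (m, st m) IH).2.
  move=> T; rewrite /cylmass big_ord0 invr1 mulr1; apply: le_trans (mass T).
  by apply: ler_sum => i _; rewrite /part minn0 maxn0.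
have st_stab k m : (k < m)%N -> st m k = st k.+1 k.
  elim: m => // m IH; rewrite ltnS leq_eqVlt => /orP[/eqP <- //|km].
  by rewrite /= {1}/upd ltn_eqF // IH.
pose y k := st k.+1 k.
exists y; split.
  move=> k; rewrite /y /= /upd eqxx; exact: (Hnx (k, st k) (inv_st k)).1.
move=> i; apply/negP => /agreeP Ha.
have := sumle_term (part_ge0 (n i) (st (n i))) (inv_st (n i)) i.
rewrite /part minnn maxnn ifT; last first.
  by apply/agreeP => k kn; rewrite Ha // (st_stab k (n i)).
rewrite leNgt => /negP; apply; rewrite gtr_pMl //; exact: cylmass_gt0.
Qed.

End Avoid.

(** A set of diameter [d] meets the Cantor set inside one cylinder, whose depth is the first [n]
    with [g n <= d]; by the balance of [N] and [g] its mass is at most [d^s / c]. A cover of small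
    content would thus give cylinders of total mass below one. *)
Theorem cantor_not_null (s : R) (A : set C) (g : nat -> R) (p : (nat -> nat) -> C) (c : R) :
  0 < s -> 0 < c ->
  (forall x, valid x -> A (p x)) ->
  (forall x y n, valid x -> valid y -> (forall k, (k < n)%N -> x k = y k) -> x n <> y n ->
     g n <= cabs (p x - p y)) ->
  (forall n, 0 < g n) ->
  (forall n, c <= (\prod_(k < n) (N k)%:R) * g n `^ s) ->
  ~ null s A.
Proof.
move=> s0 c0 pA sep g0 gc nA.
(* Content [c / 4] accounts for mass [1 / 4] and the correction terms for [1 / 2]; the sum [3 / 4]
   is still below one. *)
have [U [d [[AU Ud] sU]]] := nA _ (divr_gt0 c0 (ltr0Sn _ 3)); rewrite add0r in sU.
pose v0 : nat -> nat := fun=> 0%N.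
have v0v : valid v0 by move=> k; exact: leq_trans (N2 k).
have hp k : 0 < (2^-1 : R) ^+ k by rewrite exprn_gt0 // invr_gt0.
have loc i : exists xn : (nat -> nat) * nat, [/\ valid xn.1,
    (forall y, valid y -> U i (p y) -> agree xn.1 y xn.2) &
    cylmass xn.2 <= d i `^ s / c + 2^-1 ^+ i.+1 / 2].
  have [n [dg mn]] : exists n, (forall k, (k < n)%N -> d i < g k) /\
      cylmass n <= d i `^ s / c + 2^-1 ^+ i.+1 / 2.
    have dc : 0 <= d i `^ s / c by rewrite divr_ge0 ?powR_ge0 // ltW.
    have [H|H] := pselect (exists n, g n <= d i).
      have ex : exists n, g n <= d i by [].
      exists (ex_minn ex); case: ex_minnP => n gn mn; split.
        by move=> k kn; rewrite ltNge; apply/negP => /mn; rewrite leqNgt kn.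
      apply: (@le_trans _ _ (d i `^ s / c)); last by rewrite lerDl divr_ge0 // ltW.
      rewrite ler_pdivlMr // /cylmass mulrC ler_pdivrMr ?prodN_gt0 //.
      apply: le_trans (gc n) _; rewrite mulrC ler_pM2r ?prodN_gt0 //.
      by apply: ge0_ler_powR => //; rewrite ?nnegrE ltW // (lt_le_trans (g0 n)).
    (* Every gap exceeds [d i], so any depth is allowed; this one makes the masses summable. *)
    exists i.+2; split; first by move=> k _; rewrite ltNge; apply/negP => h; apply: H; exists k.
    apply: le_trans (cylmass_half _) _; rewrite [leLHS]exprSr lerDr //.
  have [[x [xv Ux]]|H] := pselect (exists x, valid x /\ U i (p x)).
    exists (x, n); split=> //= y yv Uy; apply/agreeP => k.
    elim/ltn_ind: k => k IH kn; apply/eqP/negPn/negP => /eqP xy.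
    have := sep x y k xv yv (fun l lk => IH l lk (ltn_trans lk kn)) xy; rewrite leNgt => /negP.
    by apply; apply: le_lt_trans (dg k kn); exact: (Ud i).2.
  by exists (v0, n); split=> //= y yv Uy; exfalso; apply: H; exists y.
have [xn Hxn] := choice loc.
have [y [yv Hy]] : exists y, valid y /\ forall i, ~~ agree (xn i).1 y (xn i).2.
  apply: (@avoid_cylinders (fun i => (xn i).1) (fun i => (xn i).2) (3 / 4)).
  - by move=> i; have [] := Hxn i.
  - lra.
  - move=> n; apply: (@le_trans _ _ (\sum_(i < n) (d i `^ s / c + 2^-1 ^+ i.+1 / 2))).
      by apply: ler_sum => i _; have [] := Hxn i.
    rewrite big_split /= -!mulr_suml.
    have h1 : (\sum_(i < n) d i `^ s) / c <= 1 / 4.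
      by rewrite ler_pdivrMr // mulrAC mul1r; exact: sU.
    have := sum_half_le R n; lra.
have [i _ Ui] := AU _ (pA y yv).
by have [_ /(_ y yv Ui) ag _] := Hxn i; move: (Hy i); rewrite ag.
Qed.

End CantorSets.

(** * Null sets under meromorphic maps *)

Section NullTransport.
Variable R : realType.
Local Notation C := R[i].
Implicit Types (A B : set C) (s : R) (x y z a : C).

(** A countable base of discs with rational centres and radii, used to pass from local to global
    nullity. *)
Lemma rational_balls : exists (bc : nat -> C) (br : nat -> R), forall z (r : R), 0 < r ->
  exists n, cabs (z - bc n) < br n /\ forall x, cabs (x - bc n) < br n -> cabs (x - z) < r.
Proof.
pose dec n : rat * rat * rat := odflt (0, 0, 0) (unpickle n).
exists (fun n => Complex (ratr (dec n).1.1) (ratr (dec n).1.2)), (fun n => ratr (dec n).2).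
move=> z r r0.
have r42 : r / 4 < r / 2 by lra.
have [q] := rat_in_itvoo r42.
rewrite in_itv /= => /andP[q1 q2].
have q0 : 0 < ratr q :> R by apply: lt_trans q1; rewrite divr_gt0.
have app (t : R) : exists u : rat, `|t - ratr u| < ratr q / 2.
  have tq : t - ratr q / 2 < t + ratr q / 2 by lra.
  have [u] := rat_in_itvoo tq.
  rewrite in_itv /= => /andP[u1 u2]; exists u; rewrite ltr_norml; apply/andP; split; lra.
have [u Hu] := app (Re z); have [v Hv] := app (Im z).
exists (pickle ((u, v), q)); rewrite /dec pickleK /=.
have zc : cabs (z - Complex (ratr u) (ratr v)) < ratr q.
  apply: le_lt_trans (cabs_ReIm _) _; rewrite Re_sub Im_sub /=; lra.
split=> // x xc; have := cabs_triangle (Complex (ratr u) (ratr v)) x z.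
rewrite (cabs_distC (Complex _ _) z); lra.
Qed.

Lemma null_local s A : 0 < s -> (forall z, A z -> exists r : R, 0 < r /\
  null s (A `&` [set x | cabs (x - z) < r])) -> null s A.
Proof.
move=> s0 H; have [bc [br Hb]] := rational_balls.
pose A_ n := [set x | [/\ A x, cabs (x - bc n) < br n &
  null s (A `&` [set x | cabs (x - bc n) < br n])]].
apply: (@null_bigcup R s A A_) => [z Az|n].
  have [r [r0 nr]] := H z Az; have [n [zn nz]] := Hb z r r0.
  exists n => //; split=> //; apply: null_sub nr => x [Ax xn]; split=> //; exact: nz.
have [nn|nn] := pselect (null s (A `&` [set x | cabs (x - bc n) < br n])).
  by apply: null_sub nn => x [].
by apply: null_sub (null_set0 s0) => x [].
Qed.

Variable f : C -> option C.
Hypothesis mero : meromorphic f.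
Local Notation F := (fun x => fin (f x)).

Lemma mero_regular z w : f z = Some w -> regular_at f z.
Proof. by move=> fz; case: (mero z) => // -[m [_ [fN _]]]; rewrite fN in fz. Qed.

Lemma mero_poles z : f z = None -> poles f z.
Proof.
move=> fz; case: (mero z) => // -[r [r0 /(_ z)]]; rewrite subrr cabs0 => /(_ r0)[].
by rewrite fz.
Qed.

Lemma poles_None a : poles f a -> f a = None.
Proof. by case=> m [_ []]. Qed.

Lemma Some_fin z : f z <> None -> f z = Some (F z).
Proof. by move=> /=; case: (f z) => // h; case: (h). Qed.

Lemma regular_ball z w : f z = Some w -> exists r : R, 0 < r /\
  forall x, cabs (x - z) < r -> f x <> None /\ cdiff F x.
Proof. exact: mero_regular. Qed.

Lemma pole_large a (K : R) : poles f a -> exists r : R, 0 < r /\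
  forall x, 0 < cabs (x - a) < r -> K < cabs (F x).
Proof.
move=> [[|m] [m1 [_ [r [r0 [g [ga [gd H]]]]]]]] //.
have a0 : 0 < cabs (g a) by rewrite cabs_gt0.
have [|d [d0 Hd]] := cdiff_cont (gd a _) (divr_gt0 a0 (ltr0Sn _ 1)).
  by rewrite subrr cabs0.
pose K' := Num.max K 1; have K'0 : 0 < K' by rewrite lt_max ltr01 orbT.
exists (Num.min (Num.min r 1) (Num.min d (cabs (g a) / 2 / K'))); split.
  by rewrite !lt_min r0 d0 ltr01 !divr_gt0.
move=> x /andP[x0]; rewrite !lt_min => /andP[/andP[xr x1] /andP[xd xK]].
rewrite H ?x0 //=; apply: (@le_lt_trans _ _ K'); first by rewrite le_max lexx.
rewrite cabs_div cabsX ltr_pdivlMr ?exprn_gt0 //.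
apply: (@le_lt_trans _ _ (K' * cabs (x - a))).
  rewrite ler_pM2l // exprS ler_piMr ?cabs_ge0 // exprn_ile1 ?cabs_ge0 // ltW //.
apply: (@lt_trans _ _ (cabs (g a) / 2)); first by rewrite mulrC -ltr_pdivlMr.
have := Hd x xd; have := cabs_le_sub (g a) (g x); rewrite (cabs_distC (g a)); lra.
Qed.

Lemma pole_order_unique a m m' : pole_of_order f a m -> pole_of_order f a m' -> m = m'.
Proof.
wlog mm : m m' / (m < m')%N.
  move=> W h h'; have [/W W'|/W W'|//] := ltngtP m m'; [exact: W'|exact/esym/W'].
move=> [_ [_ [r [r0 [g [ga [gd H]]]]]]] [_ [_ [r' [r0' [g' [ga' [gd' H']]]]]]]; exfalso.
have a0 : 0 < cabs (g' a) by rewrite cabs_gt0.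
(* Two orders would make [k] vanish off [a], although it is continuous with the nonzero value [g' a]
   at [a]. *)
pose k x := g' x - g x * (x - a) ^+ (m' - m).
have ck : ccont_at k a.
  apply: ccontB; first by apply/cdiff_cont/gd'; rewrite subrr cabs0.
  apply: ccontM; first by apply/cdiff_cont/gd; rewrite subrr cabs0.
  by apply: ccontX; apply: ccontB (ccont_id _) (ccont_cst _ _).
have ka : k a = g' a.
  by rewrite /k subrr expr0n subn_eq0 leqNgt mm /= mulr0 subr0.
have [d [d0 Hd]] := ck _ a0.
pose t := Num.min d (Num.min r r') / 2.
have m0 : 0 < Num.min d (Num.min r r') by rewrite !lt_min d0 r0.
have t0 : 0 < t by rewrite divr_gt0.
have tm : t < Num.min d (Num.min r r') by rewrite /t; lra.
move: (tm); rewrite !lt_min => /and3P[td tr tr'].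
have xa : (a + (t%:C)%C) - a = (t%:C)%C by rewrite addrC addKr.
have cx : cabs ((a + (t%:C)%C) - a) = t by rewrite xa cabs_real gtr0_norm.
set x := a + _ in xa cx.
have xn : x - a != 0 by rewrite -cabs_gt0 cx.
have := H x; have := H' x; rewrite cx t0 tr tr' => /(_ isT) -> /(_ isT)[E].
have kx : k x = 0.
  rewrite /k; apply/eqP; rewrite subr_eq0; apply/eqP.
  have -> : g' x = g' x / (x - a) ^+ m' * (x - a) ^+ m' by rewrite divfK // expf_neq0.
  rewrite E -{1}(subnKC (ltnW mm)) exprD mulrA divfK ?expf_neq0 //.
have := Hd x; rewrite cx => /(_ td); rewrite kx ka sub0r cabsN ltxx //.
Qed.

(** As [f] is only locally Lipschitz, the image is cut into countably many pieces coming from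
    rational discs; on each piece a choice of preimages is the map required by [null_lip]. *)
Lemma null_image s A (c : C) : 0 < s -> null s A ->
  null s [set w | exists z v, [/\ A z, f z = Some v & w = v + c]].
Proof.
move=> s0 nA; have [bc [br Hb]] := rational_balls.
pose good n (K : R) := 0 <= K /\ forall x y, cabs (x - bc n) < br n -> cabs (y - bc n) < br n ->
  cabs (F x - F y) <= K * cabs (x - y).
pose B_ n := [set w | exists z v, [/\ A z, f z = Some v, w = v + c, cabs (z - bc n) < br n &
  exists K, good n K]].
apply: (@null_bigcup R s _ B_) => [w [z [v [Az fz ->]]]|n].
  have [r [r0 Hr]] := regular_ball fz.
  have rd x : cabs (x - z) < r -> cdiff F x by move=> /Hr[].
  have [M [M0 fM]] := half_ball_bounded r0 rd.
  have r2 : 0 < r / 2 by rewrite divr_gt0.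
  have L := @cauchy_lip R F z (r / 2) M r2 (fun x xr => rd x (lt_trans xr _)) (fun x xr => fM x (ltW xr)).
  have r8 : 0 < r / 2 / 4 by rewrite !divr_gt0.
  have [n [zn nz]] := Hb z _ r8; exists n => //; exists z, v; split=> //.
  exists (4 * M / (r / 2)); split; first by rewrite divr_ge0 ?mulr_ge0 // ltW.
  by move=> x y xn yn; apply: L; [lra|exact: nz|exact: nz].
have [[K [K0 HK]]|nK] := pselect (exists K, good n K); last first.
  by apply: null_sub (null_set0 s0) => w [z [v []]].
have /choice[phi Hphi] : forall w, exists z, B_ n w ->
    exists v, [/\ A z, f z = Some v, w = v + c & cabs (z - bc n) < br n].
  move=> w; have [[z [v [? ? ? ? _]]]|nB] := pselect (B_ n w); first by exists z => _; exists v.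
  by exists 0.
apply: (@null_lip R s A _ K phi) => // [w /Hphi[v []] //|w w' /Hphi[v [_ fz e zn]] /Hphi[v' [_ fz' e' zn']]].
have := HK _ _ zn zn'; rewrite fz fz' /=.
by have -> : v - v' = w - w' by rewrite e e'; ring.
Qed.

Lemma null_preimage_noncritical s B (c : C) : 0 < s -> null s B ->
  null s [set z | (exists v, f z = Some v /\ B (v + c)) /\ ~ is_cderiv F z 0].
Proof.
move=> s0 nB; apply: null_local => // z [[v [fz Bz]] nc].
have [r [r0 Hr]] := regular_ball fz.
have rd x : cabs (x - z) < r -> cdiff F x by move=> /Hr[].
have [M [M0 fM]] := half_ball_bounded r0 rd.
have [l Fl] : cdiff F z by apply: rd; rewrite subrr cabs0.
have l0 : 0 < cabs l.
  by rewrite cabs_gt0; apply/eqP => l0; apply: nc; rewrite -l0.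
have r2 : 0 < r / 2 by rewrite divr_gt0.
pose t := Num.min (r / 2 / 16) (cabs l * (r / 2) ^+ 2 / (256 * M)).
have M256 : 0 < 256 * M by apply: mulr_gt0 M0; rewrite ltr0n.
have t0 : 0 < t by rewrite lt_min !divr_gt0 // mulr_gt0 // exprn_gt0.
exists t; split=> //.
have BL := @bilipschitz R F z (r / 2) M l t r2 t0 (fun x xr => rd x (lt_trans xr _))
  (fun x xr => fM x (ltW xr)) Fl.
apply: (@null_lip R s B _ (2 / cabs l) (fun x => F x + c)) => //.
- by rewrite divr_ge0 // ltW.
- by move=> x [[[v' [-> Bv']] _] _].
- move=> x y [_ /= xt] [_ /= yt].
  have -> : F x + c - (F y + c) = F x - F y by ring.
  have /(@bilipschitz_bounds R F)/andP[H1 _] : cabs (F x - F y - l * (x - y)) <= cabs l / 2 * cabs (x - y).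
    apply: BL => //; first lra.
    - by rewrite /t ge_min lexx.
    - by rewrite mulrC -ler_pdivlMr // /t ge_min lexx orbT.
  by rewrite mulrAC ler_pdivlMr // mulrC -ler_pdivrMl // mulrA (mulrC 2^-1).
Qed.

Lemma null_preimage s B (c : C) : 0 < s -> null s B ->
  (forall z v, f z = Some v -> forall e : R, 0 < e -> exists x, cabs (x - z) < e /\ F x <> F z) ->
  null s [set z | exists v, f z = Some v /\ B (v + c)].
Proof.
move=> s0 nB nc; apply: null_local => // z [v [fz Bz]].
have [r [r0 Hr]] := regular_ball fz.
have rd x : cabs (x - z) < r -> cdiff F x by move=> /Hr[].
have [t [t0 Ht]] := isolated_critical r0 rd (nc z v fz).
exists t; split=> //.
have n1 : null s [set z] by apply: null_subsingleton => // a b -> ->.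
have := hleU s0 n1 (null_preimage_noncritical c s0 nB); rewrite addr0.
apply: null_sub => x [Bx /= xt]; have [->|xz] := eqVneq x z; first by left.
by right; split=> //; apply: Ht; rewrite xt cabs_gt0 subr_eq0 xz.
Qed.

(** Local constancy would propagate along the segment to the pole [a0]. At the last point reached
    [f] is finite with value [v], because such points accumulate there, and [vanishing_order]
    forbids accumulation unless [f] is constant nearby. *)
Lemma mero_nonconstant a0 : poles f a0 -> forall z v, f z = Some v -> forall e : R, 0 < e ->
  exists x, cabs (x - z) < e /\ F x <> F z.
Proof.
move=> pa z v fz e e0; apply: contrapT => H.
have [r [r0 Hr]] := regular_ball fz.
pose gam (t : R) : C := z + (t%:C)%C * (a0 - z).
pose P x := exists d : R, 0 < d /\ forall y, cabs (y - x) < d -> f y = Some v.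
have P0 : P z.
  exists (Num.min e r); split; first by rewrite lt_min e0.
  move=> y; rewrite lt_min => /andP[ye yr]; rewrite (Some_fin (Hr y yr).1).
  congr Some; apply: contrapT => fy; apply: H; exists y; split=> //.
  by rewrite fz.
pose S := [set t : R | 0 <= t <= 1 /\ forall t' : R, 0 <= t' <= t -> P (gam t')].
have S0 : S 0.
  split; first by rewrite lexx ler01.
  move=> t'; rewrite -eq_le => /eqP <-; by rewrite /gam mul0r addr0.
have hs : has_sup S by split; [exists 0|exists 1 => t [/andP[]]].
pose T := sup S.
have T0 : 0 <= T by apply: ub_le_sup => //; case: hs.
have T1 : T <= 1 by apply: ge_sup; [case: hs|move=> t [/andP[]]].
have PT t : 0 <= t < T -> P (gam t).
  move=> /andP[t0 tT]; have [u [u1 Hu] tu] := sup_gt (ex_intro _ 0 S0) tT.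
  by apply: Hu; rewrite t0 ltW.
have gd t t' : cabs (gam t - gam t') = `|t - t'| * cabs (a0 - z).
  rewrite /gam (_ : z + _ - (z + _) = ((t - t')%:C)%C * (a0 - z)); first by rewrite cabsM cabs_real.
  by rewrite (rmorphB (real_complex R)); ring.
have az : 0 < cabs (a0 - z).
  by rewrite cabs_gt0 subr_eq0; apply/eqP => az; move: fz; rewrite -az (poles_None pa).
have Popen t : P (gam t) -> exists d : R, 0 < d /\ forall t', `|t' - t| < d -> P (gam t').
  move=> [d [d0 Hd]]; exists (d / cabs (a0 - z)); split; first by rewrite divr_gt0.
  move=> t'; rewrite ltr_pdivlMr // -gd => /ball_sub[d' [d0' Hd']].
  by exists d'; split=> // y /Hd' /Hd.
have Tpos : 0 < T.
  have [|d [d0 Hd]] := Popen 0; first by rewrite /gam mul0r addr0.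
  apply: (@lt_le_trans _ _ (Num.min (d / 2) 1)); first by rewrite lt_min divr_gt0 // ltr01.
  apply: ub_le_sup; first by case: hs.
  split; first by rewrite le_min ler01 (divr_ge0 (ltW d0)) //= ge_min lexx orbT.
  move=> t' /andP[t'0 t'1]; apply: Hd; rewrite subr0 ger0_norm //.
  by apply: le_lt_trans t'1 _; apply: (@le_lt_trans _ _ (d / 2)); [rewrite ge_min lexx|lra].
have close d : 0 < d -> exists y, 0 < cabs (y - gam T) < d /\ f y = Some v.
  move=> d0; pose t := Num.max 0 (T - d / 2 / cabs (a0 - z)).
  have dd : 0 < d / 2 / cabs (a0 - z) by rewrite !divr_gt0.
  have tT : t < T by rewrite /t gt_max Tpos gtrBl.
  have t0 : 0 <= t by rewrite le_max lexx.
  have [d' [d0' Hd']] := PT t (introT andP (conj t0 tT)).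
  exists (gam t); split; last by apply: Hd'; rewrite subrr cabs0.
  rewrite gd mulr_gt0 ?normr_gt0 ?subr_eq0 ?lt_eqF //=.
  rewrite -ltr_pdivlMr // ler0_norm ?subr_le0 ?ltW // opprB.
  apply: (@le_lt_trans _ _ (d / 2 / cabs (a0 - z))).
    by rewrite lerBlDl -lerBlDr /t le_max lexx orbT.
  by rewrite ltr_pM2r ?invr_gt0 //; lra.
have PgT : P (gam T).
  case fT: (f (gam T)) => [u|]; last first.
    have [d [d0 Hd]] := pole_large (cabs v) (mero_poles fT).
    have [y [yd fy]] := close d d0; have := Hd y yd; rewrite fy ltxx //.
  have [r' [r0' Hr']] := regular_ball fT.
  have rd x : cabs (x - gam T) < r' -> cdiff F x by move=> /Hr'[].
  have uv : u = v.
    apply/eqP/negPn/negP; rewrite -subr_eq0 -cabs_gt0 => uv.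
    have [|d [d0 Hd]] := cdiff_cont (rd (gam T) _) uv; first by rewrite subrr cabs0.
    have [y [/andP[_ yd] fy]] := close d d0; have := Hd y yd.
    by rewrite fy fT /= cabs_distC ltxx.
  have [H'|H'] := pselect (forall d : R, 0 < d -> exists x, cabs (x - gam T) < d /\ F x <> F (gam T)).
    have [n [g [gdf gz fg]]] := vanishing_order r0' rd H'.
    have a1 : 0 < cabs (g (gam T)) by rewrite cabs_gt0.
    have [|d [d0 Hd]] := cdiff_cont (gdf (gam T) _) a1; first by rewrite subrr cabs0.
    have [y [/andP[y0 yd] fy]] := close d d0.
    have := fg y; rewrite fy fT /= uv => /eqP; rewrite eq_sym addrC -subr_eq0 addrK mulf_eq0.
    rewrite expf_eq0 /= -cabs_eq0 gt_eqF //= => /eqP gy.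
    by have := Hd y yd; rewrite gy sub0r cabsN ltxx.
  have [d [d0 Hd]] : exists d : R, 0 < d /\ forall x, cabs (x - gam T) < d -> F x = F (gam T).
    apply: contrapT => h; apply: H' => d d0; apply: contrapT => h'; apply: h.
    by exists d; split=> // x xd; apply: contrapT => fx; apply: h'; exists x.
  exists (Num.min d r'); split; first by rewrite lt_min d0.
  move=> y; rewrite lt_min => /andP[yd yr]; rewrite (Some_fin (Hr' y yr).1).
  by rewrite (Hd y yd) fT /= uv.
have T_eq1 : T = 1.
  apply/eqP; rewrite eq_le T1 /= leNgt; apply/negP => Tlt.
  have [d [d0 Hd]] := Popen T PgT.
  pose u := Num.min 1 (T + d / 2).
  have Tu : T < u by rewrite lt_min Tlt ltrDl divr_gt0.
  have : u <= T.
    apply: ub_le_sup; first by case: hs.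
    split; first by rewrite (le_trans T0 (ltW Tu)) ge_min lexx.
    move=> t' /andP[t'0 t'u]; have [t'T|Tt'] := ltP t' T; first by apply: PT; rewrite t'0.
    apply: Hd; rewrite ger0_norm ?subr_ge0 //.
    have : u <= T + d / 2 by rewrite ge_min lexx orbT.
    lra.
  by rewrite leNgt Tu.
have [d [d0 Hd]] := PgT.
have ga : gam T = a0 by rewrite T_eq1 /gam mul1r addrC subrK.
have := Hd a0; rewrite ga subrr cabs0 (poles_None pa) => /(_ d0) //.
Qed.

End NullTransport.

(** * Geometry near the poles *)

Record pole_data (R : realType) (f : R[i] -> option R[i]) (P : set R[i]) (Rdag : R) (M : nat)
  (beta K : R) : Prop := PoleData {
  pd_mero : meromorphic f;
  pd_poles : P `<=` poles f;
  pd_Rdag : 0 < Rdag;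
  pd_sep : forall a1 a2, poles f a1 -> poles f a2 -> a1 <> a2 ->
     cball a1 Rdag `&` cball a2 Rdag = set0;
  pd_beta : 0 <= beta;
  pd_order : forall a, P a -> exists m, pole_of_order f a m /\ (1 <= m <= M)%N;
  pd_K : 1 <= K;
  pd_est : forall a m, P a -> pole_of_order f a m ->
     forall z, cball a Rdag z -> z != a ->
       (exists w, f z = Some w /\
          K^-1 * ((cabs a) `^ (- beta) / cabs (z - a) ^+ m) <= cabs w /\
          cabs w <= K * ((cabs a) `^ (- beta) / cabs (z - a) ^+ m)) /\
       (forall l, is_cderiv (fun x => fin (f x)) z l ->
          K^-1 * (m%:R * (cabs a) `^ (- beta) / cabs (z - a) ^+ m.+1) <= cabs l /\
          cabs l <= K * (m%:R * (cabs a) `^ (- beta) / cabs (z - a) ^+ m.+1)) }.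

Section PoleGeometry.
Variables (R : realType) (f : R[i] -> option R[i]) (P : set R[i]) (Rdag : R) (M : nat).
Variables (beta K : R).
Local Notation C := R[i].
Local Notation F := (fun x => fin (f x)).
Hypothesis pd : pole_data f P Rdag M beta K.

(** The condition [1 <= cabs a] makes [|a|^(-beta)] positive and at most one, so that thresholds can
    be chosen independently of the pole. *)
Definition good_pole (a : C) (m : nat) := [/\ P a, pole_of_order f a m & 1 <= cabs a].

Local Notation bet a := (cabs a `^ (- beta)).

Let K1 := pd_K pd.
Let K0 : 0 < K. Proof. exact: lt_le_trans ltr01 K1. Qed.

Lemma good_pole_order a m : good_pole a m -> (1 <= m <= M)%N.
Proof. by move=> [Pa om _]; have [m' [/(pole_order_unique om) <-]] := pd_order pd Pa. Qed.

Lemma bet_gt0 a m : good_pole a m -> 0 < bet a.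
Proof. by move=> [_ _ a1]; apply: powR_gt0; exact: lt_le_trans ltr01 a1. Qed.

Lemma bet_le1 a m : good_pole a m -> bet a <= 1.
Proof.
move=> [_ _ a1]; rewrite -(powRr0 (cabs a)); apply: ler_powR => //.
by rewrite oppr_le0 (pd_beta pd).
Qed.

Lemma near_pole_value a m z : good_pole a m -> 0 < cabs (z - a) < Rdag ->
  f z <> None /\ K^-1 * (bet a / cabs (z - a) ^+ m) <= cabs (F z) <= K * (bet a / cabs (z - a) ^+ m).
Proof.
move=> [Pa om _] /andP[z0 zR]; have za : z != a by rewrite -subr_eq0 -cabs_gt0.
by have [[w [-> [h1 h2]]] _] := pd_est pd Pa om zR za; split=> //=; rewrite h1 h2.
Qed.

Lemma near_pole_cdiff a m z : good_pole a m -> 0 < cabs (z - a) < Rdag -> cdiff F z.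
Proof.
move=> ga zR; have [/(Some_fin (f := f)) fz _] := near_pole_value ga zR.
have [r [r0 Hr]] := regular_ball (pd_mero pd) fz.
by apply: (Hr z _).2; rewrite subrr cabs0.
Qed.

(** Comparing the estimates for [f'] and [f] eliminates [|a|^(-beta)] and the power of
    [cabs (z - a)]: the constants depend neither on the pole nor on its order. *)
Lemma near_pole_deriv a m z l : good_pole a m -> 0 < cabs (z - a) < Rdag -> is_cderiv F z l ->
  (K ^+ 2)^-1 * cabs (F z) <= cabs l * cabs (z - a) <= M%:R * K ^+ 2 * cabs (F z).
Proof.
move=> ga zR fl; have [_ /andP[v1 v2]] := near_pole_value ga zR.
have /andP[m1 mM] := good_pole_order ga; have b0 := bet_gt0 ga.
move: ga zR => [Pa om _] /andP[z0 zR]; have za : z != a by rewrite -subr_eq0 -cabs_gt0.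
have [_ /(_ l fl)[l1 l2]] := pd_est pd Pa om zR za.
have t0 : 0 < cabs (z - a) ^+ m by rewrite exprn_gt0.
have e1 : m%:R * bet a / cabs (z - a) ^+ m.+1 * cabs (z - a) = m%:R * (bet a / cabs (z - a) ^+ m).
  by rewrite exprS; field; rewrite !gt_eqF.
set q := bet a / cabs (z - a) ^+ m in v1 v2 e1.
have q0 : 0 < q by rewrite divr_gt0.
have mr : 1 <= m%:R :> R by rewrite ler1n.
have mMr : m%:R <= M%:R :> R by rewrite ler_nat.
have m0 : 0 <= m%:R :> R by [].
apply/andP; split.
  apply: (@le_trans _ _ (K^-1 * (m%:R * q))); last first.
    by rewrite -e1 mulrA ler_pM2r.
  rewrite expr2 invfM -mulrA ler_pM2l ?invr_gt0 //.
  rewrite mulrC ler_pdivrMr //; apply: le_trans v2 _; rewrite mulrC ler_pM2r //.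
  by rewrite ler_peMl // ltW.
apply: (@le_trans _ _ (K * (m%:R * q))); first by rewrite -e1 mulrA ler_pM2r.
rewrite (_ : M%:R * K ^+ 2 * cabs (F z) = K * (M%:R * (K * cabs (F z)))); last by ring.
rewrite ler_pM2l //; apply: ler_pM => //; first exact: ltW.
by move: v1; rewrite mulrC ler_pdivrMr // mulrC.
Qed.

Lemma near_pole_bilip : exists kap : R, 0 < kap <= 1 / 32 /\
  forall a m z l, good_pole a m -> 0 < cabs (z - a) <= Rdag / 2 -> is_cderiv F z l ->
  forall x y, cabs (x - z) < kap * cabs (z - a) -> cabs (y - z) < kap * cabs (z - a) ->
  cabs (F x - F y - l * (x - y)) <= cabs l / 2 * cabs (x - y).
Proof.
(* This bounds the ratio between the maximum of [f] on the disc of half the distance to the pole,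
   where [2^M] enters, and the lower bound for [f']. Both scale alike, so [kap] serves all poles and
   distances. *)
pose Q : R := 256 * 4 * K ^+ 4 * 2 ^+ M.
have c256 : 0 < 256 :> R by rewrite ltr0n.
have Q0 : 0 < Q by rewrite /Q !mulr_gt0 // exprn_gt0.
exists (Num.min (1 / 32) Q^-1); split.
  by rewrite lt_min invr_gt0 Q0 divr_gt0 //= ge_min lexx.
move=> a m z l ga /andP[z0 zR] fl x y.
set kap := Num.min _ _; set t := cabs (z - a) in z0 zR *.
have kap0 : 0 < kap by rewrite lt_min invr_gt0 Q0 divr_gt0.
have kapQ : kap * Q <= 1 by rewrite -ler_pdivlMr // mul1r ge_min lexx orbT.
have kap32 : kap <= 1 / 32 by rewrite ge_min lexx.
have Rd := pd_Rdag pd.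
have zb : 0 < cabs (z - a) < Rdag by rewrite z0 /=; move: zR; rewrite /t; lra.
have t2 : 0 < t / 2 by rewrite divr_gt0.
have sub w : cabs (w - z) < t / 2 -> t / 2 < cabs (w - a) < Rdag.
  move=> wz; have := cabs_triangle w z a; have := cabs_triangle z w a.
  rewrite (cabs_distC z w) -/t => h1 h2; apply/andP; split; lra.
have sub' w : cabs (w - z) < t / 2 -> 0 < cabs (w - a) < Rdag.
  by move=> /sub/andP[h1 h2]; rewrite h2 andbT; apply: lt_trans h1.
have b0 := bet_gt0 ga; have /andP[m1 mM] := good_pole_order ga.
pose Mx := K * (bet a / (t / 2) ^+ m).
have fM w : cabs (w - z) < t / 2 -> cabs (F w) <= Mx.
  move=> wz; have [_ /andP[_ h]] := near_pole_value ga (sub' w wz); apply: le_trans h _.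
  rewrite ler_pM2l // ler_pM2l // lef_pV2 ?posrE ?exprn_gt0 //; last by case/andP: (sub' w wz).
  by rewrite lerXn2r ?nnegrE ?cabs_ge0 ?ltW //; case/andP: (sub w wz).
apply: (@bilipschitz R F z (t / 2) Mx l (kap * t)) => //.
- exact: mulr_gt0.
- by move=> w wz; exact: near_pole_cdiff ga (sub' w wz).
- have := ler_wpM2r (ltW z0) kap32; lra.
have /andP[dl _] := near_pole_deriv ga zb fl; rewrite -/t in dl.
have [_ /andP[vl _]] := near_pole_value ga zb; rewrite -/t in vl.
have lt0 : (K ^+ 2)^-1 * (K^-1 * (bet a / t ^+ m)) <= cabs l * t.
  apply: le_trans dl; by rewrite ler_pM2l ?invr_gt0 ?exprn_gt0.
have tm : 0 < t ^+ m by rewrite exprn_gt0.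
have q0 : 0 < bet a / t ^+ m by rewrite divr_gt0.
have -> : Mx = K * (bet a / t ^+ m * 2 ^+ m).
  by rewrite /Mx expr_div_n; field; rewrite !gt_eqF // exprn_gt0.
have p2 : (2 : R) ^+ m <= 2 ^+ M by apply: ler_weXn2l => //; rewrite ler1n.
have -> : cabs l * (t / 2) ^+ 2 = cabs l * t * (t / 4) by field.
apply: le_trans (ler_wpM2r _ lt0); last by rewrite divr_ge0 // ltW.
move: (bet a / t ^+ m) q0 => q q0.
have -> : 256 * (K * (q * 2 ^+ m)) * (kap * t) = (256 * 4 * K ^+ 4 * 2 ^+ m * kap) *
   ((K ^+ 2)^-1 * (K^-1 * q) * (t / 4)).
  by move: (2 ^+ m) (256 : R) => u v; field; rewrite gt_eqF.
apply: ler_piMl; first by rewrite !mulr_ge0 ?invr_ge0 ?exprn_ge0 // ltW.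
apply: le_trans kapQ; rewrite mulrC; apply: ler_wpM2l; first exact: ltW.
apply: ler_wpM2l p2; apply: ltW; apply: mulr_gt0; last by rewrite exprn_gt0.
by apply: mulr_gt0 c256 _.
Qed.

Lemma large_value_near (r : R) a m z : 0 < r <= 1 -> good_pole a m -> 0 < cabs (z - a) < Rdag ->
  K / r ^+ M < cabs (F z) -> cabs (z - a) < r.
Proof.
move=> /andP[r0 r1] ga zR; have /andP[m1 mM] := good_pole_order ga.
apply: contraTT; rewrite -!leNgt => rz.
have [_ /andP[_ h]] := near_pole_value ga zR; apply: le_trans h _.
rewrite ler_pM2l // -[leRHS]mul1r; apply: ler_pM.
- exact: ltW (bet_gt0 ga).
- by rewrite invr_ge0 exprn_ge0 // cabs_ge0.
- exact: bet_le1 ga.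
- rewrite lef_pV2 ?posrE ?exprn_gt0 //; last by case/andP: zR.
  apply: (@le_trans _ _ (r ^+ m)); first by apply: ler_wiXn2l => //; exact: ltW.
  by rewrite lerXn2r ?nnegrE ?cabs_ge0 // ltW.
Qed.

(** The reciprocal of [f], set to [0] at the pole, is continuous there and has modulus at least
    [r^M / K] on the circle, so it takes every small value. *)
Lemma pole_surjective (r : R) a m v : 0 < r <= 1 -> r < Rdag -> good_pole a m ->
  4 * K / r ^+ M <= cabs v -> exists x, 0 < cabs (x - a) < r /\ f x = Some v.
Proof.
move=> /andP[r0 r1] rR ga vl.
have /andP[m1 mM] := good_pole_order ga.
have rM : 0 < r ^+ M by rewrite exprn_gt0.
have v0 : 0 < cabs v by apply: lt_le_trans vl; rewrite divr_gt0 // mulr_gt0.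
have vn : v != 0 by rewrite -cabs_gt0.
pose q x : C := if x == a then 0 else (F x)^-1.
have inR x : cabs (x - a) <= r -> x != a -> 0 < cabs (x - a) < Rdag.
  by move=> xr xa; rewrite cabs_gt0 subr_eq0 xa (le_lt_trans xr rR).
have Fn x : 0 < cabs (x - a) < Rdag -> F x != 0.
  move=> xR; have [_ /andP[h _]] := near_pole_value ga xR; rewrite -cabs_gt0.
  apply: lt_le_trans h; rewrite mulr_gt0 ?invr_gt0 // divr_gt0 ?(bet_gt0 ga) //.
  by rewrite exprn_gt0; case/andP: xR.
have qnear x : x != a -> exists d : R, 0 < d /\ forall y, cabs (y - x) < d -> (F y)^-1 = q y.
  move=> xa; exists (cabs (x - a)); split; first by rewrite cabs_gt0 subr_eq0.
  move=> y yx; rewrite /q ifN //; apply: contraTneq yx => ->; by rewrite cabs_distC ltxx.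
have qd x : 0 < cabs (x - a) < Rdag -> cdiff q x.
  move=> xR; have xa : x != a by rewrite -subr_eq0 -cabs_gt0; case/andP: xR.
  have [d [d0 Hd]] := qnear x xa; apply: cdiff_near d0 Hd _.
  by apply: (@cdiffV _ F) (Fn x xR) _; exact: near_pole_cdiff ga xR.
have qa : ccont_at q a.
  move=> e e0; have [Pa om _] := ga.
  have [d [d0 Hd]] := pole_large e^-1 (pd_poles pd Pa).
  exists d; split=> // x xd; rewrite {2}/q eqxx subr0 /q.
  case: eqVneq => [_|xa]; first by rewrite cabs0.
  have := Hd x; rewrite cabs_gt0 subr_eq0 xa xd => /(_ isT) h.
  have F0 : 0 < cabs (F x) by apply: lt_trans h; rewrite invr_gt0.
  by rewrite cabsV invf_plt ?posrE.
have mid : r ^+ M / K / 4 * 4 = r ^+ M / K by field; rewrite gt_eqF.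
have vV : cabs v^-1 <= r ^+ M / K / 4.
  rewrite cabsV -[leRHS]invrK lef_pV2 ?posrE // ?invr_gt0 ?divr_gt0 //.
  by apply: le_trans vl; rewrite le_eqVlt; apply/orP; left; apply/eqP; field; rewrite !gt_eqF.
have B0 : 0 < r ^+ M / K by rewrite divr_gt0.
have [x [xr qx]] : exists x, cabs (x - a) < r /\ q x = v^-1.
  apply: (@surjective_ball R q a r v^-1 (r ^+ M / K / 2)) => //.
  - move=> x xr; have [->//|xa] := eqVneq x a.
    by apply: cdiff_cont; apply: qd; exact: inR.
  - move=> x xr; have [->|xa] := eqVneq x a.
      exists Rdag; split; first exact: (pd_Rdag pd).
      exact: qd.
    have xb : 0 < cabs (x - a) < Rdag by apply: inR => //; exact: ltW.
    have [d [d0 Hd]] := punctured_ball_sub xb.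
    by exists d; split=> // y /andP[_ /Hd/qd].
  - rewrite /q eqxx sub0r cabsN; lra.
  - move=> x xr; have xa : x != a by rewrite -subr_eq0 -cabs_gt0 xr.
    have xb : 0 < cabs (x - a) < Rdag by apply: inR => //; rewrite xr.
    have [_ /andP[_ h]] := near_pole_value ga xb.
    have F0 : 0 < cabs (F x) by rewrite cabs_gt0 Fn.
    have qx : r ^+ M / K <= cabs (q x).
      rewrite /q (negbTE xa) cabsV -[leLHS]invrK lef_pV2 ?posrE ?invr_gt0 //.
      apply: le_trans h _; rewrite invfM invrK mulrC ler_pM2r //.
      rewrite xr -[leRHS]mul1r; apply: ler_pM.
      + exact: ltW (bet_gt0 ga).
      + by rewrite invr_ge0 exprn_ge0 // ltW.
      + exact: bet_le1 ga.
      + by rewrite lef_pV2 ?posrE ?exprn_gt0 //; apply: ler_wiXn2l => //; exact: ltW.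
    have := cabs_le_sub (q x) v^-1; lra.
have xa : x != a.
  by apply: contra_eq_neq qx => ->; rewrite /q eqxx eq_sym invr_eq0.
have xb : 0 < cabs (x - a) < Rdag by apply: inR => //; exact: ltW.
exists x; split; first by rewrite xr andbT; case/andP: xb.
have [/(Some_fin (f := f)) -> _] := near_pole_value ga xb.
congr Some; apply: invr_inj; by move: qx; rewrite /q (negbTE xa).
Qed.

(** Restricting both the source and the image distance gives a set that [f] maps injectively onto a
    full disc, without speaking of connected components. *)
Definition branch_domain (z : C) (s d : R) : set C :=
  [set x | cabs (x - z) < s /\ cabs (F x - F z) < d].

Lemma expanding_branch (r d : R) : 0 < r -> r <= Rdag / 2 -> 0 < d -> exists R1 : R, 0 < R1 /\
  forall a m z, good_pole a m -> 0 < cabs (z - a) < r -> R1 <= cabs (F z) ->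
  exists s : R, 0 < s /\ let W := branch_domain z s d in
  [/\ (forall x, W x -> 0 < cabs (x - a) < Rdag),
      (forall x y, W x -> W y -> cabs (x - y) <= 2^-1 * cabs (F x - F y)) &
      (forall v, cabs (v - F z) < d -> exists x, W x /\ F x = v)].
Proof.
move=> r0 rR d0; have [kap [/andP[kap0 kap32] BL]] := near_pole_bilip.
have K20 : 0 < K ^+ 2 by rewrite exprn_gt0.
(* The first bound makes the derivative at least [4], hence inverse contraction by one half; the
   second makes the image of the disc of radius [kap * t / 2] cover the disc of radius [d]. *)
exists (Num.max (4 * r * K ^+ 2) (8 * K ^+ 2 * d / kap)); split.
  by rewrite lt_max mulr_gt0 // mulr_gt0.
move=> a m z ga /andP[z0 zr]; rewrite ge_max => /andP[h1 h2].
set t := cabs (z - a) in z0 zr *.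
have Rd := pd_Rdag pd.
have zb : 0 < cabs (z - a) < Rdag by rewrite z0 /=; move: zr; rewrite /t; lra.
have [l fl] := near_pole_cdiff ga zb.
have zb2 : 0 < cabs (z - a) <= Rdag / 2 by rewrite z0 /=; move: zr; rewrite /t; lra.
have {}BL := BL a m z l ga zb2 fl; rewrite -/t in BL.
have /andP[dl _] := near_pole_deriv ga zb fl; rewrite -/t in dl.
have L4 : 4 <= cabs l.
  rewrite -(ler_pM2r z0); apply: le_trans dl; rewrite [leRHS]mulrC ler_pdivlMr //.
  apply: le_trans h1; rewrite ler_pM2r // ler_pM2l //; exact: ltW.
have Lt : 8 * d <= cabs l * (kap * t).
  rewrite mulrCA -ler_pdivrMl //; apply: le_trans dl.
  rewrite [leRHS]mulrC ler_pdivlMr //; apply: le_trans h2.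
  by rewrite le_eqVlt; apply/orP; left; apply/eqP; field; rewrite gt_eqF.
have kt0 : 0 < kap * t by rewrite mulr_gt0.
have kt2 : 0 < kap * t / 2 by rewrite divr_gt0.
have ktt : kap * t <= t / 32 by have := ler_wpM2r (ltW z0) kap32; lra.
have sub x : cabs (x - z) < kap * t -> 0 < cabs (x - a) < Rdag.
  move=> xz; have := cabs_triangle x z a; have := cabs_triangle z x a.
  rewrite (cabs_distC z x) -/t => g1 g2; apply/andP; split; lra.
have lower x y : cabs (x - z) < kap * t -> cabs (y - z) < kap * t ->
    cabs l / 2 * cabs (x - y) <= cabs (F x - F y).
  by move=> xz yz; have /(@bilipschitz_bounds R F)/andP[] := BL x y xz yz.
exists (kap * t); split=> //; split.
- by move=> x [xz _]; exact: sub.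
- move=> x y [xz _] [yz _]; have := lower x y xz yz.
  have := ler_wpM2r (cabs_ge0 (x - y)) L4; lra.
- move=> v vz.
  have [x [xz Fx]] : exists x, cabs (x - z) < kap * t / 2 /\ F x = v.
    apply: (@surjective_ball R F z (kap * t / 2) v d) => //.
    + move=> x xz; apply: cdiff_cont; apply: near_pole_cdiff ga (sub x _); lra.
    + move=> x xz; have xb : cabs (x - z) < kap * t by lra.
      have [e [e0 He]] := ball_sub xb.
      by exists e; split=> // y /andP[_ /He/sub]; exact: near_pole_cdiff ga.
    + by rewrite cabs_distC.
    + move=> x xz; have xb : cabs (x - z) < kap * t by lra.
      have := lower x z xb; rewrite subrr cabs0 => /(_ kt0); rewrite xz.
      have := cabs_triangle v (F x) (F z); move: Lt; lra.
  exists x; split=> //; split; first by lra.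
  by rewrite Fx.
Qed.

Definition pscale (a : C) (m : nat) (X : R) : R := (bet a / X) `^ (m%:R^-1).

Lemma pscaleX a m X : (0 < m)%N -> 0 < X -> pscale a m X ^+ m = bet a / X.
Proof.
move=> m0 X0; rewrite -powR_mulrn ?powR_ge0 // -powRrM mulVf ?pnatr_eq0 -?lt0n //.
by rewrite powRr1 // divr_ge0 ?powR_ge0 // ltW.
Qed.

Lemma pscale_gt0 a m X : good_pole a m -> 0 < X -> 0 < pscale a m X.
Proof. by move=> ga X0; apply: powR_gt0; rewrite divr_gt0 // (bet_gt0 ga). Qed.

Lemma scale_bounds a m X z : good_pole a m -> 0 < cabs (z - a) < Rdag -> 0 < X ->
  X / 4 <= cabs (F z) <= 4 * X ->
  pscale a m X <= 4 * K * cabs (z - a) /\ cabs (z - a) <= 4 * K * pscale a m X.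
Proof.
move=> ga zR X0 /andP[X1 X2].
have /andP[m1 mM] := good_pole_order ga; have s0 := pscale_gt0 ga X0.
have [_ /andP[v1 v2]] := near_pole_value ga zR; have b0 := bet_gt0 ga.
have /andP[z0 _] := zR; have t0 : 0 < cabs (z - a) ^+ m by rewrite exprn_gt0.
have F0 : 0 < cabs (F z) by apply: lt_le_trans X1; rewrite divr_gt0.
have K4 : 1 <= 4 * K by move: K1; lra.
have K4m : 4 * K <= (4 * K) ^+ m by rewrite -{1}[4 * K]expr1; apply: ler_weXn2l.
have sX := pscaleX a m1 X0; move: (pscale a m X) s0 sX => s s0 sX.
have root (u v : R) : 0 < u -> 0 < v -> u ^+ m <= v ^+ m -> u <= v.
  by move=> u0 v0; rewrite ler_pXn2r ?nnegrE ?(ltW u0) ?(ltW v0).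
split; apply: root; rewrite ?mulr_gt0 // exprMn.
  apply: (@le_trans _ _ (4 * K * cabs (z - a) ^+ m)); last by rewrite ler_pM2r.
  rewrite sX ler_pdivrMr //.
  have h : bet a <= K * cabs (F z) * cabs (z - a) ^+ m.
    by move: v1; rewrite mulrA ler_pdivrMr // mulrC ler_pdivrMr // => /le_trans; apply; rewrite mulrC mulrA.
  apply: le_trans h _; rewrite (_ : 4 * K * _ * X = K * (4 * X) * cabs (z - a) ^+ m); last by ring.
  by rewrite ler_pM2r // ler_pM2l.
apply: (@le_trans _ _ (4 * K * s ^+ m)); last by rewrite ler_pM2r ?exprn_gt0.
rewrite sX; move: v2; rewrite mulrA ler_pdivlMr // => v2.
rewrite mulrA ler_pdivlMr //.
have : cabs (z - a) ^+ m * (X / 4) <= K * bet a.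
  by apply: le_trans v2; rewrite mulrC ler_pM2r.
lra.
Qed.

(** The bound on [cabs (z - z')] needs close points, as values repeat around a multiple pole. The
    converse bound holds for all pairs: points that are not close are at distance at least [kp]
    times the scale, and their values differ by at most [8 X]. *)
Lemma scale_lipschitz : exists kp K6 : R, 0 < kp /\ 0 < K6 /\
  forall a m X z z', good_pole a m -> 0 < X ->
  0 < cabs (z - a) <= Rdag / 2 -> 0 < cabs (z' - a) <= Rdag / 2 ->
  X / 4 <= cabs (F z) <= 4 * X -> X / 4 <= cabs (F z') <= 4 * X ->
  (cabs (z - z') < kp * pscale a m X ->
    cabs (z - z') <= K6 * (pscale a m X / X) * cabs (F z - F z')) /\
  cabs (F z - F z') <= K6 * (X / pscale a m X) * cabs (z - z').
Proof.
have [kap [/andP[kap0 kap32] BL]] := near_pole_bilip.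
have K20 : 0 < K ^+ 2 by rewrite exprn_gt0.
pose kp := kap / (4 * K).
have kp0 : 0 < kp by rewrite divr_gt0 // mulr_gt0.
pose Ka := 2 * 4 * K ^+ 2 * (4 * K).
pose Kb := 2 * (M%:R * K ^+ 2) * 4 * (4 * K) + 8 / kp.
have Ka0 : 0 < Ka by rewrite !mulr_gt0.
have Kb0 : 0 < Kb.
  apply: ltr_wpDl; last by rewrite divr_gt0.
  by rewrite !mulr_ge0 ?ler0n ?(ltW K0) ?(ltW K20).
exists kp, (Ka + Kb); split=> //; split; first exact: addr_gt0.
move=> a m X z z' ga X0 zR zR' zX zX'.
have Rd := pd_Rdag pd.
have zb : 0 < cabs (z - a) < Rdag by move: zR => /andP[-> ?] /=; lra.
have [s1 s2] := scale_bounds ga zb X0 zX.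
have s0 := pscale_gt0 ga X0; move: (pscale a m X) s0 s1 s2 => s s0 s1 s2.
have [l fl] := near_pole_cdiff ga zb.
have /andP[d1 d2] := near_pole_deriv ga zb fl.
have /andP[z0 _] := zb.
have near : cabs (z - z') < kp * s -> cabs l / 2 * cabs (z - z') <= cabs (F z - F z') <=
     2 * cabs l * cabs (z - z').
  move=> zz; apply: (@bilipschitz_bounds R F); apply: BL ga zR fl _ _ _ _.
    by rewrite subrr cabs0 mulr_gt0.
  rewrite cabs_distC; apply: lt_le_trans zz _; rewrite /kp mulrAC -mulrA ler_pM2l //.
  by rewrite ler_pdivrMr ?mulr_gt0 // mulrC.
have /andP[X1 X2] := zX; have /andP[X1' X2'] := zX'.
split.
  move=> zz; have /andP[n1 _] := near zz.
  have lb : X / (Ka / 2 * s) <= cabs l.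
    rewrite ler_pdivrMr; last by rewrite mulr_gt0 // divr_gt0.
    have h1 : (K ^+ 2)^-1 * (X / 4) <= cabs l * cabs (z - a).
      by apply: le_trans d1; rewrite ler_pM2l // invr_gt0.
    have h2 : cabs l * cabs (z - a) <= cabs l * (4 * K * s) by rewrite ler_wpM2l ?cabs_ge0.
    have := le_trans h1 h2; rewrite mulrC ler_pdivrMr // /Ka; lra.
  have l0 : 0 < cabs l.
    by apply: lt_le_trans lb; rewrite divr_gt0 // mulr_gt0 // divr_gt0.
  apply: (@le_trans _ _ (Ka * (s / X) * cabs (F z - F z'))); last first.
    by rewrite ler_wpM2r ?cabs_ge0 // ler_pM2r ?divr_gt0 // lerDl ltW.
  apply: le_trans (_ : 2 / cabs l * cabs (F z - F z') <= _).
    by rewrite mulrAC ler_pdivlMr // mulrC -ler_pdivrMl // mulrA (mulrC 2^-1).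
  rewrite ler_wpM2r ?cabs_ge0 // ler_pdivrMr //.
  move: lb; rewrite ler_pdivrMr; last by rewrite mulr_gt0 // divr_gt0.
  move=> lb; rewrite mulrA mulrAC ler_pdivlMr //; lra.
apply: (@le_trans _ _ (Kb * (X / s) * cabs (z - z'))); last first.
  by rewrite ler_wpM2r ?cabs_ge0 // ler_pM2r ?divr_gt0 // lerDr ltW.
have [zz|zz] := ltP (cabs (z - z')) (kp * s).
  have /andP[_ n2] := near zz; apply: le_trans n2 _; rewrite ler_wpM2r ?cabs_ge0 //.
  apply: (@le_trans _ _ (2 * (M%:R * K ^+ 2) * 4 * (4 * K) * (X / s))); last first.
    by rewrite ler_pM2r ?divr_gt0 // lerDl divr_ge0 // ltW.
  rewrite [leRHS]mulrA ler_pdivlMr //.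
  have h1 : cabs l * s <= cabs l * (4 * K * cabs (z - a)) by rewrite ler_wpM2l ?cabs_ge0.
  have h2 : M%:R * K ^+ 2 * cabs (F z) <= M%:R * K ^+ 2 * (4 * X).
    by rewrite ler_wpM2l // mulr_ge0 // ltW.
  have h3 : 4 * K * (cabs l * cabs (z - a)) <= 4 * K * (M%:R * K ^+ 2 * (4 * X)).
    by rewrite ler_pM2l ?mulr_gt0 //; exact: le_trans d2 h2.
  rewrite -mulrA; lra.
apply: (@le_trans _ _ (8 * X)).
  by apply: le_trans (cabsB _ _) _; lra.
apply: (@le_trans _ _ (8 / kp * (X / s) * cabs (z - z'))); last first.
  rewrite ler_wpM2r ?cabs_ge0 // ler_pM2r ?divr_gt0 // lerDr !mulr_ge0 // ltW //.
have -> : 8 / kp * (X / s) * cabs (z - z') = 8 * X * (cabs (z - z') / (kp * s)).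
  by field; rewrite !gt_eqF.
apply: ler_peMr; first by rewrite mulr_ge0 // ltW.
by rewrite (ler_pdivlMr _ _ (mulr_gt0 kp0 s0)) mul1r.
Qed.

End PoleGeometry.

(** * Orbits that follow poles are Julia and radial *)

Section TrackedOrbits.
Variables (R : realType) (f : R[i] -> option R[i]) (P : set R[i]) (Rdag : R) (M : nat).
Variables (beta K : R).
Local Notation C := R[i].
Local Notation F := (fun x => fin (f x)).
Hypothesis pd : pole_data f P Rdag M beta K.

Lemma FseqS (c : nat -> C) n z y : Fseq f c n z = Some y -> f y <> None ->
  Fseq f c n.+1 z = Some (F y + c n.+1).
Proof. by move=> /= -> /(Some_fin (f := f)) ->. Qed.

Lemma FseqS_inv (c : nat -> C) n z w : Fseq f c n.+1 z = Some w ->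
  exists y, [/\ Fseq f c n z = Some y, f y <> None & w = F y + c n.+1].
Proof.
move=> /=; case: (Fseq f c n z) => [y|//]; case fy : (f y) => [v|//] /= [<-].
by exists y; rewrite fy.
Qed.

Definition tracked (c : nat -> C) (r R1 : R) (z : C) := forall n, exists y a m,
  [/\ Fseq f c n z = Some y, good_pole f P a m, 0 < cabs (y - a) < r & R1 <= cabs (F y)].

Lemma tracked_defined c r R1 z : tracked c r R1 z -> defined_all (Fseq f c) z.
Proof. by move=> tr n; have [y [a [m [-> _ _ _]]]] := tr n. Qed.

(** The induction hypothesis for pulling back discs. Continuity of the iterate is carried along only
    to keep the next pullback open. *)
Let pull (c : nat -> C) (d : R) n z (U : set C) :=
  [/\ copen U, U z, (forall x, U x -> Fseq f c n x <> None /\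
        ccont_at (fun u => fin (Fseq f c n u)) x /\
        cabs (fin (Fseq f c n x) - fin (Fseq f c n z)) < d),
     (forall x x', U x -> U x' ->
        cabs (x - x') <= 2^-1 ^+ n * cabs (fin (Fseq f c n x) - fin (Fseq f c n x'))) &
     (forall w, cabs (w - fin (Fseq f c n z)) < d -> exists x, U x /\ Fseq f c n x = Some w)].

(** Discs of radius [2 r] about the orbit contain poles and pull back univalently with contraction
    [2^-n]. Hence preimages of poles accumulate at [z], and there later iterates are undefined. *)
Lemma tracked_radial (r : R) : 0 < r -> r <= Rdag / 2 -> exists R1 : R, 0 < R1 /\
  forall c z, tracked c r R1 z -> Julia (Fseq f c) z /\ radialJ (Fseq f c) z.
Proof.
move=> r0 rR; have d0 : 0 < 2 * r by rewrite mulr_gt0.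
have [R1 [R10 HB]] := expanding_branch pd r0 rR d0.
exists R1; split=> // c z tr; set d := 2 * r in d0 HB.
have pullP n : exists U, pull c d n z U.
  elim: n => [|n [U [oU Uz defU conU surU]]].
    exists (cball z d); split=> /=.
    - by move=> x xz; have [e [e0 He]] := ball_sub xz; exists e; split=> // y /He.
    - by rewrite /cball /= subrr cabs0.
    - by move=> x xz; split=> //; split=> //; exact: ccont_id.
    - by move=> x x' _ _; rewrite expr0 mul1r.
    - by move=> w wz; exists w.
  have [y [a [m [Fy ga ya R1y]]]] := tr n.
  have [s [s0 [Wnear Wcon Wsur]]] := HB a m y ga ya R1y.
  set W := branch_domain f y s d in Wnear Wcon Wsur.
  have Wy : W y by rewrite /W /branch_domain /= !subrr cabs0.
  have Wdef x : W x -> f x <> None by move=> /Wnear/(near_pole_value pd ga)[].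
  have Wcont x : W x -> ccont_at F x.
    by move=> /Wnear/(near_pole_cdiff pd ga); exact: cdiff_cont.
  (* Expansion places [W] inside the disc of radius [d] about [y], which the previous pullback
     covers. *)
  have Wball x : W x -> cabs (x - y) < d.
    move=> Wx; apply: le_lt_trans (Wcon x y Wx Wy) _; have := Wx.2; move: d0; lra.
  have Wopen x : W x -> exists e : R, 0 < e /\ forall u, cabs (u - x) < e -> W u.
    move=> Wx; have [e1 [e10 He1]] := ball_sub Wx.1.
    have [e2 [e20 He2]] := ball_sub Wx.2.
    have [e3 [e30 He3]] := Wcont x Wx e2 e20.
    exists (Num.min e1 e3); split; first by rewrite lt_min e10.
    by move=> u; rewrite lt_min => /andP[/He1 h1 /He3 /He2 h2].
  have fz : fin (Fseq f c n z) = y by rewrite Fy.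
  pose V := [set x | U x /\ W (fin (Fseq f c n x))].
  have Vn x : V x -> Fseq f c n.+1 x = Some (F (fin (Fseq f c n x)) + c n.+1).
    move=> [Ux Wx]; have [dx _] := defU x Ux.
    by apply: FseqS (Wdef _ Wx); move: dx; case: (Fseq f c n x) => // h; case: (h).
  have Vz : V z by split=> //; rewrite fz.
  have fz1 : fin (Fseq f c n.+1 z) = F y + c n.+1 by rewrite (Vn z Vz) fz.
  have Vopen x : V x -> exists e : R, 0 < e /\ forall u, cabs (u - x) < e -> V u.
    move=> [Ux Wx]; have [e1 [e10 He1]] := oU x Ux.
    have [e2 [e20 He2]] := Wopen _ Wx.
    have [_ [cx _]] := defU x Ux; have [e3 [e30 He3]] := cx e2 e20.
    exists (Num.min e1 e3); split; first by rewrite lt_min e10.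
    by move=> u; rewrite lt_min => /andP[h1 /He3/He2 h2]; split=> //; exact: He1.
  exists V; split=> //.
  - move=> x Vx; split; first by rewrite (Vn x Vx).
    split; last first.
      rewrite fz1 (Vn x Vx) [fin (Some _)]/=.
      have -> : F (fin (Fseq f c n x)) + c n.+1 - (F y + c n.+1) = F (fin (Fseq f c n x)) - F y by ring.
      exact: Vx.2.2.
    have [e [e0 He]] := Vopen x Vx.
    apply: (@ccont_near _ (fun u => F (fin (Fseq f c n u)) + c n.+1) _ _ e e0).
      by move=> u /He/Vn ->.
    apply: ccontD (ccont_cst _ _); apply: (@ccont_comp _ (fun u => fin (Fseq f c n u)) F).
      by have [_ []] := defU x Vx.1.
    exact: Wcont Vx.2.
  - move=> x x' Vx Vx'; rewrite (Vn x Vx) (Vn x' Vx') [fin (Some _)]/= [fin (Some (_ + _))]/=.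
    have -> : F (fin (Fseq f c n x)) + c n.+1 - (F (fin (Fseq f c n x')) + c n.+1) =
      F (fin (Fseq f c n x)) - F (fin (Fseq f c n x')) by ring.
    apply: le_trans (conU x x' Vx.1 Vx'.1) _; rewrite exprSr -mulrA.
    apply: ler_wpM2l; first by rewrite exprn_ge0 // invr_ge0.
    exact: Wcon Vx.2 Vx'.2.
  - move=> w; rewrite fz1 => wd.
    have [u [Wu Fu]] : exists u, W u /\ F u = w - c n.+1.
      by apply: Wsur; rewrite (_ : w - c n.+1 - F y = w - (F y + c n.+1)) //; ring.
    have [|x [Ux Fx]] := surU u; first by rewrite fz; exact: Wball.
    have Vx : V x by split=> //; rewrite Fx.
    by exists x; split=> //; rewrite Vn // Fx /= Fu subrK.
have pole_close n : exists a x, [/\ f a = None, Fseq f c n x = Some a &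
    cabs (x - z) <= 2^-1 ^+ n * r].
  have [U [oU Uz defU conU surU]] := pullP n.
  have [y [a [m [Fy ga /andP[_ ya] R1y]]]] := tr n.
  have fz : fin (Fseq f c n z) = y by rewrite Fy.
  have [x [Ux Fx]] : exists x, U x /\ Fseq f c n x = Some a.
    apply: surU; rewrite fz cabs_distC; apply: lt_trans ya _; rewrite /d; lra.
  exists a, x; split=> //; first by apply: poles_None; apply: (pd_poles pd); case: ga.
  apply: le_trans (conU x z Ux Uz) _; apply: ler_wpM2l.
    by rewrite exprn_ge0 // invr_ge0.
  by rewrite Fx fz /= cabs_distC ltW.
have J : Julia (Fseq f c) z.
  move=> [e [e0 [def _]]]; have [n Hn] := half_seq_lt r e0.
  have [a [x [fa Fx xz]]] := pole_close n.
  have /(def x)/(_ n.+1) : cball z e x by apply: le_lt_trans xz _; rewrite mulrC.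
  by rewrite /= Fx fa.
split=> //; split=> //; split; first exact: tracked_defined tr.
exists d; split=> // N; exists N; split=> //.
have [U [oU Uz defU conU surU]] := pullP N.
exists U; split=> //; split=> //; split; first by move=> x /defU[].
split.
  move=> x y Ux Uy E; have := conU x y Ux Uy; rewrite E subrr cabs0 mulr0 => h.
  by apply/eqP; rewrite -subr_eq0 -cabs_eq0 eq_le h cabs_ge0.
move=> w; split=> [|[x [Ux Fx]]]; first exact: surU.
by have [_ [_]] := defU x Ux; rewrite Fx.
Qed.

End TrackedOrbits.

(** * Large values occur only near poles *)

Section LargeValues.
Variables (R : realType) (f : R[i] -> option R[i]) (r R0 : R).
Local Notation C := R[i].
Local Notation F := (fun x => fin (f x)).
Hypotheses (mero : meromorphic f) (r0 : 0 < r) (R00 : 0 < R0).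
Hypothesis sep : forall a1 a2, poles f a1 -> poles f a2 -> a1 <> a2 -> 8 * r <= cabs (a1 - a2).
Hypothesis circ_bound : forall a z, poles f a -> cabs (z - a) = r -> cabs (F z) <= R0.

Let W (k : R) : set C := [set x | (forall a, poles f a -> r <= cabs (x - a)) /\ k < cabs (F x)].

Let off x := forall a, poles f a -> r <= cabs (x - a).

Let off_def x : off x -> f x <> None.
Proof.
by move=> ox /(mero_poles mero)/ox; rewrite subrr cabs0 leNgt r0.
Qed.

Let off_cdiff x : off x -> cdiff F x.
Proof.
move=> /off_def/(Some_fin (f := f))/(regular_ball mero)[e [e0 He]].
by apply: (He x _).2; rewrite subrr cabs0.
Qed.

Let off_closed : cclosed off.
Proof. by move=> u l Hu ul a pa; apply: (cclosed_cobball (z := a) _ ul) => n; exact: Hu. Qed.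

(** The circles around the poles carry only values of modulus at most [R0 <= k], so a point of [W k]
    has positive distance from the single pole disc that can be near it. *)
Let W_open k x : R0 <= k -> W k x -> exists d : R, 0 < d /\ forall y, cabs (y - x) < d -> W k y.
Proof.
move=> Rk [ox kx].
have [d1 [d10 Hd1]] : exists d : R, 0 < d /\ forall y, cabs (y - x) < d -> k < cabs (F y).
  have kx0 : 0 < cabs (F x) - k by rewrite subr_gt0.
  have [d [d0 Hd]] := cdiff_cont (off_cdiff ox) kx0.
  exists d; split=> // y /Hd; have := cabs_le_sub (F x) (F y); rewrite (cabs_distC (F x) (F y)); lra.
have [[a [pa xa]]|na] := pselect (exists a, poles f a /\ cabs (x - a) < 2 * r).
  have ra : r < cabs (x - a).
    rewrite lt_neqAle ox // andbT; apply/eqP => e.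
    by have := circ_bound pa (esym e); have := lt_le_trans kx; move=> h /h; rewrite ltNge Rk.
  exists (Num.min (Num.min d1 r) (cabs (x - a) - r)); split.
    by rewrite !lt_min d10 r0 subr_gt0.
  move=> y; rewrite !lt_min => /andP[/andP[/Hd1 ky yr] ya]; split=> // b pb.
  have [->|ba] := pselect (b = a).
    by have := cabs_triangle y x a; rewrite (cabs_distC x y); lra.
  have := sep pb pa ba; have := cabs_triangle x b a; have := cabs_triangle y b x.
  rewrite (cabs_distC b y); lra.
exists (Num.min d1 r); split; first by rewrite !lt_min d10.
move=> y; rewrite lt_min => /andP[/Hd1 ky yr]; split=> // b pb.
rewrite leNgt; apply/negP => yb; apply: na; exists b; split=> //.
have := cabs_triangle y x b; rewrite (cabs_distC x y); lra.
Qed.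

Let path k x y := exists g : R -> C, [/\ rccont g, g 0 = x, g 1 = y &
  forall t, 0 <= t <= 1 -> W k (g t)].

Let path_refl k x : W k x -> path k x x.
Proof. by move=> Wx; exists (fun=> x); split=> //; exact: rccont_cst. Qed.

(** Clamping turns paths on [[0, 1]] into functions of all real parameters, so that paths are
    concatenated by adding increments. *)
Let clamp (t : R) : R := Num.min 1 (Num.max 0 t).

Let clamp_cont : continuous clamp.
Proof.
move=> t; apply: continuous_min; first exact: cvg_cst.
by apply: continuous_max; [exact: cvg_cst|exact: cvg_id].
Qed.

Let clamp01 t : 0 <= clamp t <= 1.
Proof. by rewrite /clamp le_min ler01 le_max lexx ge_min lexx. Qed.

Let clamp_id t : 0 <= t <= 1 -> clamp t = t.
Proof. by move=> /andP[t0 t1]; rewrite /clamp (max_r t0) (min_r t1). Qed.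

Let clamp_lo t : t <= 0 -> clamp t = 0.
Proof. by move=> t0; rewrite /clamp (max_l t0) (min_r ler01). Qed.

Let clamp_hi t : 1 <= t -> clamp t = 1.
Proof. by move=> t1; rewrite /clamp (max_r (le_trans ler01 t1)) (min_l t1). Qed.

Let rccont_repar (g : R -> C) (h : R -> R) : rccont g -> continuous h -> rccont (fun t => g (h t)).
Proof.
move=> cg ch t e e0; have [d [d0 Hd]] := cg (h t) e e0.
have /cvgrPdist_lt /(_ _ d0) [d' /= d0' Hd'] := ch t.
exists d'; split=> // s st; apply: Hd; rewrite distrC; apply: Hd'.
by rewrite /ball_ /= distrC.
Qed.

Let path_extend k x y y' : path k x y ->
  (forall t, 0 <= t <= 1 -> W k (y + (t%:C)%C * (y' - y))) -> path k x y'.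
Proof.
move=> [g [cg g0 g1 gW]] seg.
pose g' t := g (clamp (2 * t)) + (y' - y) * ((clamp (2 * t - 1) - 0)%:C)%C.
have cl2 (b : R) : continuous (fun t : R => clamp (2 * t + b)).
  move=> t; apply: (@continuous_comp _ _ _ (fun t : R => 2 * t + b) clamp); last exact: clamp_cont.
  apply: continuousD; last exact: cvg_cst.
  by apply: continuousM; [exact: cvg_cst|exact: cvg_id].
exists g'; split.
- apply: rccontD.
    by apply: (rccont_repar cg); have := cl2 0; under eq_fun do rewrite addr0.
  apply: rccontZ; apply: (@rccont_repar (fun s => ((s - 0)%:C)%C) (fun t => clamp (2 * t - 1))).
    exact: rccont_lin.
  exact: cl2.
- rewrite /g' mulr0 (clamp_lo (lexx _)) clamp_lo; last by lra.
  by rewrite subrr mulr0 addr0.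
- rewrite /g' mulr1 !clamp_hi ?ler1n //; last by lra.
  by rewrite g1 subr0 mulr1 addrC subrK.
- move=> t /andP[t0 t1]; rewrite /g' subr0; have [th|th] := leP t (1 / 2).
    rewrite (@clamp_lo (2 * t - 1)); last lra.
    by rewrite mulr0 addr0; apply: gW; exact: clamp01.
  rewrite clamp_hi; last lra.
  by rewrite g1 mulrC; apply: seg; exact: clamp01.
Qed.

Let ball_segment y y' d k : (forall u, cabs (u - y) < d -> W k u) -> cabs (y' - y) < d ->
  (forall t, 0 <= t <= 1 -> W k (y + (t%:C)%C * (y' - y))) /\
  (forall t, 0 <= t <= 1 -> W k (y' + (t%:C)%C * (y - y'))).
Proof.
move=> Wd yy; split=> t /andP[t0 t1]; apply: Wd.
  rewrite addrC addKr cabsM cabs_real ger0_norm //.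
  by apply: le_lt_trans yy; rewrite ler_piMl ?cabs_ge0.
have -> : y' + (t%:C)%C * (y - y') - y = ((1 - t)%:C)%C * (y' - y).
  by rewrite (rmorphB (real_complex R)); ring.
rewrite cabsM cabs_real ger0_norm ?subr_ge0 //.
by apply: le_lt_trans yy; rewrite ler_piMl ?cabs_ge0 // gerBl.
Qed.

(* If f were bounded on the component, Phragmen-Lindelof applied to F^n / (y - p) would
   force |f| <= k there. *)
Let unbounded_component p k x (K' : R) : poles f p -> R0 <= k -> W k x ->
  exists y, path k x y /\ K' < cabs (F y).
Proof.
move=> pp Rk Wx; apply: contrapT => H.
pose Om : set C := [set y | path k x y].
pose K2 := Num.max 1 K'.
have K20 : 0 < K2 by rewrite lt_max ltr01.
have OmK y : Om y -> cabs (F y) <= K2.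
  move=> py; rewrite /K2 le_max; apply/orP; right; rewrite leNgt; apply/negP => h.
  by apply: H; exists y.
have OmW y : Om y -> W k y by move=> [g [_ _ <- gW]]; apply: gW; rewrite ler01 lexx.
have Om_open y : Om y -> exists d : R, 0 < d /\ forall u, cabs (u - y) < d -> Om u.
  move=> Oy; have [d [d0 Hd]] := W_open Rk (OmW y Oy).
  exists d; split=> // u uy; apply: path_extend Oy _; exact: (ball_segment Hd uy).1.
have cl_off y : cclosure Om y -> off y.
  move=> cy a pa; apply/ler_addgt0Pr => e e0; have [u [Ou uy]] := cy e e0.
  have := (OmW u Ou).1 a pa; have := cabs_triangle y u a; lra.
have cl_K y : cclosure Om y -> cabs (F y) <= K2.
  move=> cy; apply/ler_addgt0Pr => e e0.
  have [d [d0 Hd]] := cdiff_cont (off_cdiff (cl_off y cy)) e0.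
  have [u [Ou uy]] := cy d d0; have := Hd u uy; have := OmK u Ou.
  have := cabs_le_sub (F y) (F u); rewrite (cabs_distC (F y)); lra.
have cl_k y : cclosure Om y -> ~ Om y -> cabs (F y) <= k.
  move=> cy nO; rewrite leNgt; apply/negP => ky; apply: nO.
  have Wy : W k y by split=> //; exact: cl_off.
  have [d [d0 Hd]] := W_open Rk Wy; have [u [Ou uy]] := cy d d0.
  by apply: path_extend Ou _; exact: (ball_segment Hd uy).2.
have k0 : 0 < k by apply: lt_le_trans Rk.
have xp : 0 < cabs (x - p) by apply: lt_le_trans r0 (Wx.1 p pp).
have Ox : Om x by exact: path_refl.
suff : cabs (F x) <= k by rewrite leNgt Wx.2.
apply: (@power_bound R _ _ (cabs (x - p) / r)); [exact: cabs_ge0|exact: ltW|move=> n].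
pose h y := F y ^+ n / (y - p).
(* Beyond this radius the denominator alone brings [K2^n / cabs (y - p)] below [k^n / r], the bound
   valid on the boundary of the component. *)
pose rho := cabs p + cabs x + 1 + K2 ^+ n * r / k ^+ n.
have kn0 : 0 < k ^+ n by rewrite exprn_gt0.
have Kn0 : 0 < K2 ^+ n by rewrite exprn_gt0.
have q0 : 0 < K2 ^+ n * r / k ^+ n by rewrite divr_gt0 // mulr_gt0.
have yp y : off y -> y - p != 0.
  by move=> /(_ p pp) rp; rewrite -cabs_gt0; exact: lt_le_trans rp.
have hd y : off y -> cdiff h y.
  move=> oy; apply: cdiffM; first by apply: (@cdiffX _ F); exact: off_cdiff.
  by apply: (@cdiffV _ (fun y => y - p)) (yp y oy) _; apply: cdiffB (cdiff_id _) (cdiff_cst _ _).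
pose A : set C := cclosure Om `&` [set y | cabs (y - 0) <= rho].
have Ax : A x.
  split; first exact: sub_cclosure.
  by rewrite /= subr0 /rho; have := cabs_ge0 p; lra.
have Ab y : A y -> cabs y <= rho by move=> [_]; rewrite /= subr0.
have Acl : cclosed A by apply: cclosedI; [exact: cclosed_closure|exact: cclosed_cball].
have Ah : ccont_on A h.
  by apply: ccont_at_on => y [cy _]; apply: cdiff_cont; apply: hd; exact: cl_off.
have [y [[cy yrho] ymax yni]] := max_principle Ax Ab Acl Ah.
have oy := cl_off y cy; have yp0 : 0 < cabs (y - p) by rewrite cabs_gt0 yp.
have hy : cabs (h y) <= k ^+ n / r.
  rewrite /h cabs_div cabsX ler_pdivrMr //.
  have [Oy|nO] := pselect (Om y); last first.
    rewrite mulrAC ler_pdivlMr //; apply: ler_pM; rewrite ?exprn_ge0 ?cabs_ge0 ?(ltW r0) //.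
      by rewrite lerXn2r ?nnegrE ?cabs_ge0 ?(ltW k0) // cl_k.
    by rewrite oy.
  have [ylt|yge] := ltP (cabs y) rho.
    exfalso; apply: yni; have [d [d0 Hd]] := Om_open y Oy.
    have ylt' : cabs (y - 0) < rho by rewrite subr0.
    have [d' [d0' Hd']] := ball_sub ylt'.
    exists (Num.min d d'); split; first by rewrite lt_min d0.
      move=> u; rewrite lt_min => /andP[/Hd Ou /Hd'/ltW ur]; split=> //; exact: sub_cclosure.
    move=> u /andP[_]; rewrite lt_min => /andP[/Hd Ou _]; apply: hd.
    by apply: cl_off; exact: sub_cclosure.
  have yp1 : K2 ^+ n * r / k ^+ n <= cabs (y - p).
    have := cabs_le_sub y p; rewrite /rho in yge; have := cabs_ge0 x; lra.
  apply: (@le_trans _ _ (K2 ^+ n)).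
    by rewrite lerXn2r ?nnegrE ?cabs_ge0 ?(ltW K20) // cl_K.
  by move: yp1; rewrite ler_pdivrMr // mulrAC ler_pdivlMr // [k ^+ n * _]mulrC.
have := le_trans (ymax x Ax) hy; rewrite /h cabs_div cabsX ler_pdivrMr // => /le_trans; apply.
by rewrite le_eqVlt; apply/orP; left; apply/eqP; ring.
Qed.

Let bounded_on_disc (K' : R) : exists B : R, forall y, off y -> cabs y <= K' -> cabs (F y) <= B.
Proof.
pose A : set C := off `&` [set y | cabs (y - 0) <= K'].
have Ab y : A y -> cabs y <= K' by move=> [_]; rewrite /= subr0.
have Acl : cclosed A by apply: cclosedI; [exact: off_closed|exact: cclosed_cball].
have AF : ccont_on A F by apply: ccont_at_on => y [oy _]; apply: cdiff_cont; exact: off_cdiff.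
have [B [_ HB]] := cabs_bounded Ab Acl AF.
by exists B => y oy yK; apply: HB; split=> //=; rewrite subr0.
Qed.

Lemma large_values_near_poles p : poles f p -> ~ asymptotic_value f None ->
  forall z w, f z = Some w -> R0 < cabs w -> exists a, poles f a /\ cabs (z - a) < r.
Proof.
move=> pp nav z w fz Rw; apply: contrapT => H; apply: nav.
have Wz : W R0 z.
  split; last by rewrite fz.
  by move=> a pa; rewrite leNgt; apply/negP => za; apply: H; exists a.
have Rn n : R0 <= R0 + n%:R by rewrite lerDl.
have step : forall ny : nat * C, exists gy : (R -> C) * C, W (R0 + ny.1%:R) ny.2 ->
    [/\ rccont gy.1, gy.1 0 = ny.2, gy.1 1 = gy.2,
      (forall t, 0 <= t <= 1 -> W (R0 + ny.1%:R) (gy.1 t)) & W (R0 + ny.1.+1%:R) gy.2].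
  move=> [n y] /=; have [Wy|nW] := pselect (W (R0 + n%:R) y); last by exists (fun=> 0, 0).
  have [u [[g [cg g0 g1 gW]] Fu]] := unbounded_component (R0 + n.+1%:R) pp (Rn n) Wy.
  exists (g, u) => _; split=> //; split=> //.
  by rewrite -g1; apply: (gW 1 _).1; rewrite ler01 lexx.
have [nx Hnx] := choice step.
pose zz := fix zz n := if n is n'.+1 then (nx (n', zz n')).2 else z.
have Wzz n : W (R0 + n%:R) (zz n).
  elim: n => [|n IH]; first by rewrite addr0.
  by have [] := Hnx (n, zz n) IH.
pose g n := (nx (n, zz n)).1.
have cg n : rccont (g n) by have [] := Hnx (n, zz n) (Wzz n).
have g0 n : g n 0 = zz n by have [] := Hnx (n, zz n) (Wzz n).
have g1 n : g n 1 = zz n.+1 by have [] := Hnx (n, zz n) (Wzz n).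
have gW n t : 0 <= t <= 1 -> W (R0 + n%:R) (g n t) by have [_ _ _ + _] := Hnx (n, zz n) (Wzz n); apply.
(* For [s] in [[n, n + 1]] the increments before [n] telescope to [zz n], the [n]-th path runs, and
   later terms vanish. So [G N] is continuous as a finite sum and independent of [N] once [N]
   exceeds [s]. *)
pose G N (s : R) := z + \sum_(j < N) (g j (clamp (s - j%:R)) - zz j).
have cG N : rccont (G N).
  rewrite /G; apply: rccontD (rccont_cst _) _; elim: N => [|N IH].
    by under eq_fun do rewrite big_ord0; exact: rccont_cst.
  under eq_fun do rewrite big_ord_recr /=; apply: rccontD => //.
  apply: rccontD (rccont_cst _); apply: rccont_repar (cg N) _ => s.
  apply: (@continuous_comp _ _ _ (fun s : R => s - N%:R) clamp); last exact: clamp_cont.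
  by apply: continuousB; [exact: cvg_id|exact: cvg_cst].
have Gval n s : n%:R <= s <= n.+1%:R -> forall N, (n < N)%N -> G N s = g n (s - n%:R).
  move=> /andP[ns sn] N nN.
  have Gn : G n s = zz n.
    rewrite /G; have : forall j, (j <= n)%N ->
        z + \sum_(i < j) (g i (clamp (s - i%:R)) - zz i) = zz j.
      elim=> [|j IH] jn; first by rewrite big_ord0 addr0.
      have c1 : clamp (s - j%:R) = 1.
        by apply: clamp_hi; rewrite lerBrDl natr1 (le_trans _ ns) // ler_nat.
      by rewrite big_ord_recr /= addrA IH ?(ltnW jn) // c1 g1 addrC subrK.
    exact.
  rewrite /G -(big_mkord xpredT (fun j => g j (clamp (s - j%:R)) - zz j)).
  rewrite (big_cat_nat _ (ltnW nN)) //= addrA big_mkord -/(G n s) Gn.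
  rewrite big_ltn // clamp_id; last by rewrite subr_ge0 ns lerBlDl natr1.
  rewrite big_nat_cond big1 ?addr0; first by rewrite addrC subrK.
  move=> j /andP[/andP[nj _] _]; rewrite clamp_lo ?g0 ?subrr //.
  by rewrite subr_le0 (le_trans sn) // ler_nat.
(* The quotient [t / (1 - t)] maps [[0, 1)] onto the half-line. The number of summands varies with
   [t], but [gamE] allows it to be frozen near a given point. *)
pose gam (t : R) := G (Num.truncn (t / (1 - t))).+1 (t / (1 - t)).
have gamE t N : 0 <= t < 1 -> t / (1 - t) < N%:R -> gam t = G N (t / (1 - t)).
  move=> /andP[t0 t1] tN; have q0 : 0 <= t / (1 - t) by rewrite divr_ge0 // subr_ge0 ltW.
  have /andP[n1 n2] := truncn_itv q0; set n := Num.truncn _ in n1 n2.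
  have nn : n%:R <= t / (1 - t) <= n.+1%:R by rewrite n1 ltW.
  rewrite /gam -/n (Gval n _ nn n.+1) // (Gval n _ nn N) //.
  by rewrite -(ltr_nat R) (le_lt_trans n1).
have gamW t n : 0 <= t < 1 -> n%:R <= t / (1 - t) -> W (R0 + n%:R) (gam t).
  move=> /andP[t0 t1] tn; have q0 : 0 <= t / (1 - t) by rewrite divr_ge0 // subr_ge0 ltW.
  have /andP[n1 n2] := truncn_itv q0; set k := Num.truncn _ in n1 n2.
  have nn : k%:R <= t / (1 - t) <= k.+1%:R by rewrite n1 ltW.
  rewrite /gam -/k (Gval k _ nn k.+1) //.
  have nk : (n <= k)%N by rewrite -ltnS -(ltr_nat R) (le_lt_trans tn).
  have in01 : 0 <= t / (1 - t) - k%:R <= 1 by rewrite subr_ge0 n1 lerBlDl natr1 ltW.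
  have [ow h] := gW k _ in01.
  by split=> //; apply: le_lt_trans h; rewrite lerD2l ler_nat.
have late (J : R) : exists d : R, 0 < d /\ forall t, 1 - d < t < 1 ->
    0 <= t < 1 /\ J <= t / (1 - t).
  pose J' := Num.max 1 J; have J'1 : 1 <= J' by rewrite le_max lexx.
  have J'J : J <= J' by rewrite le_max lexx orbT.
  exists (1 / (J' + 1)); split; first by rewrite divr_gt0 // ltr_wpDl // (le_trans ler01).
  move=> t /andP[t1 t2].
  have dj : (1 / (J' + 1)) * (J' + 1) = 1 by field; rewrite gt_eqF //; lra.
  have d1 : 1 / (J' + 1) <= 1 by rewrite ler_pdivrMr; lra.
  split; first by rewrite t2 andbT; lra.
  apply: le_trans J'J _; rewrite ler_pdivlMr ?subr_gt0 //.
  have J0 : 0 < J' + 1 by lra.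
  have := ltr_pM2r J0 (1 - t) (1 / (J' + 1)); rewrite dj => E.
  have : 1 - t < 1 / (J' + 1) by lra.
  rewrite -E; lra.
exists gam; split; [|split].
- move=> t /andP[t0 t1] e e0.
  have q0 : 0 <= t / (1 - t) by rewrite divr_ge0 // subr_ge0 ltW.
  pose N := (Num.truncn (t / (1 - t))).+1.
  have tN : t / (1 - t) < N%:R by have /andP[] := truncn_itv q0.
  have [d [d0 Hd]] := cG N (t / (1 - t)) e e0.
  have cq : {for t, continuous (fun u : R => u / (1 - u))}.
    apply: continuousM; first exact: cvg_id.
    apply: (@continuousV _ _ (fun u : R => 1 - u)); first by rewrite subr_eq0 eq_sym lt_eqF.
    by apply: continuousB; [exact: cvg_cst|exact: cvg_id].
  have m0 : 0 < Num.min d (N%:R - t / (1 - t)) by rewrite lt_min d0 subr_gt0.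
  move/cvgrPdist_lt: cq => /(_ _ m0) [d' /= d0' Hd'].
  exists d'; split=> // s /andP[s0 s1] st.
  have := Hd' s; rewrite /ball_ /= (distrC t s) => /(_ st).
  rewrite lt_min distrC => /andP[h1 h2].
  rewrite (gamE s N) ?s0 // ?(gamE t N) ?t0 //; first exact: Hd.
  by move: h2; rewrite ltr_norml => /andP[_]; lra.
(* Off the pole discs [f] is bounded on bounded sets, so growth of [f] along the path forces the
   path itself to infinity. *)
- move=> K'; have [B HB] := bounded_on_disc K'.
  have [d [d0 Hd]] := late (Num.truncn (Num.max 0 B)).+1%:R.
  exists d; split=> // t td; have [t01 tl] := Hd t td.
  have [ow h] := gamW t _ t01 tl; rewrite ltNge; apply/negP => /(HB _ ow); apply/negP.
  rewrite -ltNge; apply: lt_trans h.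
  have B0 : 0 <= Num.max 0 B by rewrite le_max lexx.
  have /andP[_ /lt_trans] := truncn_itv B0.
  have BB : B <= Num.max 0 B by rewrite le_max lexx orbT.
  move=> hB; apply: le_lt_trans BB _; apply: hB; rewrite ltrDr //.
- move=> e e0; have [d [d0 Hd]] := late (Num.truncn (2 / e)).+1%:R.
  exists d; split=> // t td; have [t01 tl] := Hd t td.
  have [ow h] := gamW t _ t01 tl.
  rewrite (Some_fin (off_def ow)) /chordal.
  set u := cabs _ in h *.
  have e20 : 0 <= 2 / e by rewrite divr_ge0 // ltW.
  have /andP[_ te] := truncn_itv e20.
  have u2 : 2 / e < u.
    apply: lt_trans te _; apply: lt_trans h; rewrite ltrDr //.
  have u0 : 0 < u by apply: le_lt_trans u2.
  have su : u <= Num.sqrt (1 + u ^+ 2).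
    by rewrite -{1}(ger0_norm (ltW u0)) -sqrtr_sqr ler_sqrt ?addr_ge0 ?sqr_ge0 // lerDr.
  have sq0 : 0 < Num.sqrt (1 + u ^+ 2) by apply: lt_le_trans su.
  rewrite ltr_pdivrMr // mulrC -ltr_pdivrMr //; exact: lt_le_trans su.
Qed.

End LargeValues.

(** * Finiteness of poles in discs and uniform localization *)

Section PoleLocation.
Variables (R : realType) (f : R[i] -> option R[i]) (P : set R[i]) (Rdag : R) (M : nat).
Variables (beta K : R).
Local Notation C := R[i].
Local Notation F := (fun x => fin (f x)).
Hypothesis pd : pole_data f P Rdag M beta K.

Lemma poles_separated a1 a2 : poles f a1 -> poles f a2 -> a1 <> a2 -> Rdag <= cabs (a1 - a2).
Proof.
move=> p1 p2 a12; rewrite leNgt; apply/negP => lt.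
have : (cball a1 Rdag `&` cball a2 Rdag) a1.
  by split; rewrite /cball /= ?subrr ?cabs0 //; exact: (pd_Rdag pd).
by rewrite (pd_sep pd p1 p2 a12).
Qed.

Lemma poles_finite (T : R) : finite_set [set a | poles f a /\ cabs a <= T].
Proof.
apply: contrapT => /infiniteP/card_leP[u].
pose v (n : nat) : C := set_val (u (to_setT n)).
have vP n : poles f (v n) /\ cabs (v n) <= T by exact: (set_valP (u (to_setT n))).
have [g [gn [l gl]]] := complex_bolzano (fun n => (vP n).2).
have [N HN] := gl _ (divr_gt0 (pd_Rdag pd) (ltr0Sn _ 1)).
pose m := maxn N (g N).+1.
have A1 := HN N (leqnn _); have A2 := HN m (leq_maxl _ _).
have ne : v (g m) <> v (g N).
  move=> /val_inj/('inj_u (mem_setT _) (mem_setT _)) /(congr1 set_val) /= /eqP.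
  by rewrite gtn_eqF //; apply: leq_trans (gn m); exact: leq_maxr.
have := poles_separated (vP (g m)).1 (vP (g N)).1 ne.
have := cabs_triangle l (v (g m)) (v (g N)); rewrite (cabs_distC l); lra.
Qed.

Lemma poles_seq (T : R) : exists s : seq C, uniq s /\
  forall a, a \in s <-> poles f a /\ cabs a <= T.
Proof.
have /finite_seqP[s es] := poles_finite T.
exists (undup s); split; first exact: undup_uniq.
move=> a; rewrite mem_undup; have := congr1 (fun A : set C => A a) es => /= ->.
by [].
Qed.

Lemma finite_bound (E : set C) (Q : C -> R -> Prop) : finite_set E ->
  (forall a x y, x <= y -> Q a x -> Q a y) -> (forall a, E a -> exists x, Q a x) ->
  exists x : R, 0 < x /\ forall a, E a -> Q a x.
Proof.
move=> /finite_seqP[s es] mono H.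
have : forall a, a \in s -> exists x, Q a x by move=> a as_; apply: H; rewrite es.
have -> : E = [set` s] by [].
elim: s {es} => [|a s IH] Hs; first by exists 1; split.
have [|x [x0 Hx]] := IH; first by move=> b bs; apply: Hs; rewrite inE bs orbT.
have [y Hy] := Hs a (mem_head _ _).
exists (Num.max x y); split; first by rewrite lt_max x0.
move=> b /=; rewrite inE => /orP[/eqP ->|bs].
  by apply: mono Hy; rewrite le_max lexx orbT.
by apply: mono (Hx b bs); rewrite le_max lexx.
Qed.

Hypothesis finP : finite_set (poles f `\` P).

(** These finitely many poles lack the uniform estimates; they lie in a bounded region and only
    enlarge constants. *)
Definition exceptional : set C := (poles f `\` P) `|` [set a | poles f a /\ cabs a <= 1].

Lemma exceptional_finite : finite_set exceptional.
Proof. by rewrite finite_setU; split=> //; exact: poles_finite. Qed.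

Lemma exceptional_or_good a : poles f a -> exceptional a \/ exists m, good_pole f P a m.
Proof.
move=> pa; have [a1|a1] := leP (cabs a) 1; first by left; right.
have [Pa|nP] := pselect (P a); last by left; left.
have [m [om _]] := pd_order pd Pa.
by right; exists m; split=> //; exact: ltW.
Qed.

Lemma circle_bound a (r : R) : (forall z, cabs (z - a) = r -> f z <> None) ->
  exists B : R, 0 < B /\ forall z, cabs (z - a) = r -> cabs (F z) <= B.
Proof.
move=> H; pose A : set C := [set x | cabs (x - a) <= r] `&` [set x | r <= cabs (x - a)].
have AP z : A z <-> cabs (z - a) = r.
  by split=> [[/= h1 h2]|h]; [apply/le_anti; rewrite h1|split; rewrite /= h].
have [|||B [B0 HB]] := @cabs_bounded R A F (cabs a + r).
- by move=> x [/= h _]; exact: cball_bound.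
- by apply: cclosedI; [exact: cclosed_cball|exact: cclosed_cobball].
- apply: ccont_at_on => x /AP/H/(Some_fin (f := f)) fx.
  have [e [e0 He]] := regular_ball (pd_mero pd) fx.
  by apply: cdiff_cont; apply: (He x _).2; rewrite subrr cabs0.
by exists B; split=> // z /AP /HB.
Qed.

Lemma pole_circle_bound (r : R) : 0 < r <= 1 -> r < Rdag -> exists R0 : R, 0 < R0 /\
  forall a z, poles f a -> cabs (z - a) = r -> cabs (F z) <= R0.
Proof.
move=> /andP[r0 r1] rR.
pose Q a (x : R) := forall z, cabs (z - a) = r -> cabs (F z) <= x.
have mono a x y : x <= y -> Q a x -> Q a y by move=> xy H z zr; exact: le_trans (H z zr) xy.
have Qex a : exceptional a -> exists x, Q a x.
  move=> ea; have pa : poles f a by case: ea => -[].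
  have [|B [_ HB]] := @circle_bound a r; last by exists B.
  move=> z zr /(mero_poles (pd_mero pd)) pz.
  have za : z <> a by move=> e; move: r0; rewrite -zr e subrr cabs0 ltxx.
  by have := poles_separated pz pa za; rewrite zr leNgt rR.
have [B [B0 HB]] := finite_bound exceptional_finite mono Qex.
have K0 : 0 < K by apply: lt_le_trans ltr01 (pd_K pd).
exists (Num.max B (K / r ^+ M)); split; first by rewrite lt_max B0.
move=> a z pa zr; rewrite le_max; have [/HB/(_ z zr) ->//|[m ga]] := exceptional_or_good pa.
apply/orP; right; rewrite leNgt; apply/negP => h.
have h0 : 0 < cabs (z - a) < Rdag by rewrite zr r0.
by have := large_value_near pd _ ga h0 h; rewrite r0 r1 zr ltxx => /(_ isT).
Qed.

Lemma location_good (r : R) p : 0 < r <= 1 -> r <= Rdag / 8 -> poles f p ->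
  ~ asymptotic_value f None -> exists R2 : R, 1 <= R2 /\
  forall z w, f z = Some w -> R2 < cabs z -> R2 < cabs w ->
  exists a m, good_pole f P a m /\ 0 < cabs (z - a) < r.
Proof.
move=> /[dup] rr /andP[r0 r1] r8 pp nas; have R0 := pd_Rdag pd.
have rR : r < Rdag by lra.
have [R1 [R10 HR1]] := pole_circle_bound rr rR.
have [S [S0 HS]] := @finite_bound _ (fun a x => cabs a <= x) exceptional_finite
  (fun a x y xy H => le_trans H xy) (fun a _ => ex_intro _ (cabs a) (lexx _)).
(* [R1] bounds [f] on all circles of radius [r] about poles, and [S + r] puts [z] out of reach of
   the exceptional poles. *)
exists (Num.max 1 (Num.max R1 (S + r))); split; first by rewrite le_max lexx.
move=> z w fz; rewrite !gt_max => /andP[_ /andP[_ zS]] /andP[_ /andP[wR _]].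
have sep a1 a2 : poles f a1 -> poles f a2 -> a1 <> a2 -> 8 * r <= cabs (a1 - a2).
  by move=> p1 p2 /(poles_separated p1 p2); lra.
have [a [pa za]] := large_values_near_poles (pd_mero pd) r0 R10 sep HR1 pp nas fz wR.
have za0 : 0 < cabs (z - a).
  rewrite cabs_gt0 subr_eq0; apply/eqP => e; move: fz; by rewrite e (poles_None pa).
have [/HS aS|[m ga]] := exceptional_or_good pa; last by exists a, m; rewrite za0 za.
by have := cabs_le_sub z a; lra.
Qed.

End PoleLocation.

(** * Counting poles *)

(** Read off from the integral as a supremum over simple functions, so that neither integrand has to
    be shown measurable. *)
Lemma ge0_integral_mono (d : measure_display) (T : measurableType d) (R : realType)
  (mu : {measure set T -> \bar R}) (D D' : set T) (g h : T -> \bar R) :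
  D' `<=` D -> (forall x, D x -> (0 <= h x)%E) -> (forall x, D' x -> (0 <= g x <= h x)%E) ->
  (\int[mu]_(x in D') g x <= \int[mu]_(x in D) h x)%E.
Proof.
move=> DD h0 gh; rewrite (ge0_integralE mu h0) ge0_integralE; last first.
  by move=> x /gh/andP[].
apply: le_ereal_sup => _ [u /= ug <-]; exists u => //= x; apply: le_trans (ug x) _.
rewrite /patch; case: ifPn => [|_].
  by rewrite inE => /[dup] D'x /DD Dx; rewrite mem_set //; case/andP: (gh x D'x).
by case: ifPn => //; rewrite inE => /h0.
Qed.

Section PoleCount.
Variables (R : realType) (f : R[i] -> option R[i]) (P : set R[i]) (Rdag : R) (M : nat).
Variables (beta K : R).
Local Notation C := R[i].
Local Notation F := (fun x => fin (f x)).
Hypothesis pd : pole_data f P Rdag M beta K.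

Let polepairs (t : R) := [set p : C * nat | pole_of_order f p.1 p.2 /\ (cabs p.1 <= t)%R].

Lemma pole_order_fun : exists o : C -> nat, forall a, poles f a -> pole_of_order f a (o a).
Proof.
have H a : {m | poles f a -> pole_of_order f a m}.
  apply: cid; have [[m ma]|n] := pselect (poles f a); first by exists m.
  by exists 0%N.
by exists (fun a => sval (H a)) => a; exact: (svalP (H a)).
Qed.

Lemma polepairs_finite t : finite_set (polepairs t).
Proof.
have [ord Ho] := pole_order_fun.
apply: (sub_finite_set _ (finite_image (fun a => (a, ord a)) (poles_finite pd t))).
move=> [a m] /= [oa at_]; exists a; first by split=> //; exists m.
have pa : poles f a by exists m.
by rewrite (pole_order_unique (Ho a pa) oa).
Qed.

Lemma npoles_fin t : npoles f t \is a fin_num.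
Proof.
rewrite /npoles esum_fset ?fsbig_finite //=; last 2 first.
- exact: polepairs_finite.
- exact: polepairs_finite.
by apply/sum_fin_numP => i _ _.
Qed.

Lemma npoles_mono t t' : t <= t' -> (npoles f t <= npoles f t')%E.
Proof.
move=> tt; apply: ge_ereal_sup => _ [X [Xf XS] <-].
by apply: esum_ge; exists X => //; split=> // p /XS[op pt]; split=> //; exact: le_trans pt tt.
Qed.

Lemma npoles_ge (s : seq C) T : uniq s -> (forall a, a \in s -> poles f a /\ cabs a <= T) ->
  ((size s)%:R%:E <= npoles f T)%E.
Proof.
move=> us sT; have [ord Ho] := pole_order_fun.
pose r := [seq (a, ord a) | a <- s].
have ur : uniq r by rewrite map_inj_uniq // => a b [].
apply: esum_ge; exists [set` r].
  split; first exact: finite_seq.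
  by move=> p /= /mapP[a /sT[pa aT] ->]; split=> //=; exact: Ho.
rewrite -fsbig_seq // big_map /=.
rewrite sumEFin lee_fin -sum1_size natr_sum big_seq [leRHS]big_seq.
by apply: ler_sum => a /sT[/Ho[a1 _] _]; rewrite ler_nat.
Qed.

Let N t : R := fine (npoles f t).

Let NE t : npoles f t = (N t)%:E. Proof. by rewrite /N fineK // npoles_fin. Qed.

Let N_mono t t' : t <= t' -> N t <= N t'.
Proof. by move=> /npoles_mono; rewrite !NE lee_fin. Qed.

(** Poles do not accumulate at [0], so for small positive [t] the numerator in [countN] vanishes and
    the factor [1 / t] is harmless. *)
Lemma npoles_near0 : exists dl : R, 0 < dl /\ forall t, t < dl -> (npoles f t <= npoles f 0)%E.
Proof.
have [||S [S0 HS]] := @finite_bound _ _ (fun a x => 0 < cabs a -> (cabs a)^-1 <= x)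
   (poles_finite pd 1).
- by move=> a x y xy H /H /le_trans; exact.
- by move=> a _; exists (cabs a)^-1.
exists (Num.min 1 S^-1); split; first by rewrite lt_min ltr01 invr_gt0.
move=> t; rewrite lt_min => /andP[t1 tS].
apply: ge_ereal_sup => _ [X [Xf XS] <-].
apply: esum_ge; exists X => //; split=> // p /XS[op pt]; split=> //.
rewrite leNgt; apply/negP => p0.
have := HS p.1 (conj (ex_intro _ p.2 op) (le_trans pt (ltW t1))) p0.
by rewrite invf_ple ?posrE // leNgt (le_lt_trans pt tS).
Qed.

Lemma countN_ge r : 2 <= r -> exists x : R, countN f r = x%:E /\ (N (r / 2) - N 0) / 2 <= x.
Proof.
move=> r2; have r0 : 0 < r by lra.
have [dl [dl0 Hdl]] := npoles_near0.
rewrite /countN; set I := (\int[_]_(t in _) _)%E.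
have IE : I = (\int[@lebesgue_measure R]_(t in `]0%R, r]%classic) ((N t - N 0) / t)%:E)%E.
  by apply: eq_integral => t _; rewrite !NE -EFinB -EFinM.
have g0 t : `]0%R, r]%classic t -> (0 <= ((N t - N 0) / t)%:E)%E.
  rewrite /= in_itv /= => /andP[t0 tr]; rewrite lee_fin divr_ge0 ?subr_ge0 ?(ltW t0) //.
  by apply: N_mono; exact: ltW.
have Nr0 : 0 <= N r - N 0 by rewrite subr_ge0 N_mono // ltW.
(* This bound only ensures that the integral is finite, so that passing to a real number loses
   nothing. *)
have I1 : (I <= ((N r - N 0) / dl * r)%:E)%E.
  apply: (@le_trans _ _ (\int[@lebesgue_measure R]_(t in `]0%R, r]%classic)
      cst (((N r - N 0) / dl)%:E) t)%E).
    rewrite IE; apply: ge0_integral_mono => // t /[dup] /g0 gt0; rewrite /= in_itv /= => /andP[t0 tr].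
      by rewrite lee_fin divr_ge0 // ltW.
    rewrite gt0 lee_fin /=; have [tdl|dlt] := ltP t dl.
      have -> : N t - N 0 = 0.
        by apply/eqP; rewrite subr_eq0 eq_le (N_mono (ltW t0)) andbT -lee_fin -!NE Hdl.
      by rewrite mul0r divr_ge0 // ltW.
    apply: ler_pM; rewrite ?invr_ge0 ?subr_ge0 ?N_mono ?(ltW t0) //.
      by rewrite lerB // N_mono.
    by rewrite lef_pV2.
  rewrite integral_cst //= lebesgue_measure_itv /= lte_fin r0 oppr0 adde0.
  by rewrite -EFinM.
(* On the upper half of the interval the count is at least its value at [r / 2], and [1 / t] is at
   least [1 / r]. *)
have I2 : (((N (r / 2) - N 0) / 2)%:E <= I)%E.
  have -> : (((N (r / 2) - N 0) / 2)%:E = \int[@lebesgue_measure R]_(t in `](r / 2)%R, r]%classic)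
      cst (((N (r / 2) - N 0) / r)%:E) t)%E.
    rewrite integral_cst //= lebesgue_measure_itv /= lte_fin ifT; last by lra.
    rewrite -EFinB -EFinM; congr EFin; field; lra.
  rewrite IE; apply: ge0_integral_mono => //.
    by move=> t; rewrite /= !in_itv /= => /andP[t1 ->]; rewrite andbT; lra.
  move=> t; rewrite /= in_itv /= => /andP[t1 tr].
  have h0 : 0 <= N (r / 2) - N 0 by rewrite subr_ge0 N_mono //; lra.
  rewrite !lee_fin divr_ge0 //=; last exact: ltW.
  apply: ler_pM => //; rewrite ?invr_ge0 ?(ltW r0) //.
    by rewrite lerB // N_mono // ltW.
  rewrite lef_pV2 // posrE; lra.
have If : I \is a fin_num.
  rewrite fin_numElt (lt_le_trans _ I2) ?ltNyr // (le_lt_trans I1) //; exact: ltry.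
exists (fine I + N 0 * ln r); split; first by rewrite -{1}(fineK If) NE -EFinM -EFinD.
have : (N (r / 2) - N 0) / 2 <= fine I by rewrite -lee_fin fineK.
have : 0 <= N 0 * ln r.
  rewrite mulr_ge0 ?ln_ge0 //; last by lra.
  by rewrite -lee_fin -NE; apply: esum_ge0 => p _; rewrite lee_fin.
lra.
Qed.

(** [charT] takes the finite part of an extended real, so an infinite term would be read as zero;
    hence the care about poles on the circle. *)
Lemma prox_fin r : (forall z, cabs z = r -> f z <> None) -> 0 <= r ->
  exists x : R, prox f r = x%:E /\ 0 <= x.
Proof.
move=> H r0.
have [|B [B0 HB]] := @circle_bound _ _ _ _ _ _ _ pd 0 r.
  by move=> z; rewrite subr0; exact: H.
have cr t : cabs (circ r t) = r.
  rewrite /circ /cabs !exprMn -mulrDr cos2Dsin2 mulr1 sqrtr_sqr ger0_norm //.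
have tp : 0 < twopi R by rewrite /twopi mulr_gt0 // pi_gt0.
rewrite /prox; set I := (\int[_]_(t in _) _)%E.
have I0 : (0 <= I)%E.
  apply: integral_ge0 => t _; case: (f _) => // w; rewrite lee_fin /logplus le_max lexx //.
have I1 : (I <= (Num.max 0 (ln B) * twopi R)%:E)%E.
  apply: (@le_trans _ _ (\int[@lebesgue_measure R]_(t in `[0%R, twopi R]%classic)
      cst ((Num.max 0 (ln B))%:E) t)%E).
    apply: ge0_integral_mono => //.
      by move=> t _; rewrite lee_fin le_max lexx.
    move=> t _; have := H _ (cr t); have := HB (circ r t); rewrite subr0 => /(_ (cr t)).
    case: (f _) => //= w wB _; rewrite !lee_fin /logplus le_max lexx /= ge_max le_max lexx /=.
    have [w0|w0] := ltP 0 (cabs w); last by rewrite ln0 // le_max lexx.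
    by rewrite le_max ler_ln ?posrE ?wB ?orbT.
  by rewrite integral_cst //= lebesgue_measure_itv /= lte_fin tp oppr0 adde0 -EFinM.
have If : I \is a fin_num.
  rewrite fin_numElt (lt_le_trans _ I0) ?ltNyr // (le_lt_trans I1) //; exact: ltry.
exists ((twopi R)^-1 * fine I); split; first by rewrite EFinM fineK.
by rewrite mulr_ge0 ?invr_ge0 ?(ltW tp) // fine_ge0.
Qed.

Lemma charT_ge r : (forall z, cabs z = r -> f z <> None) -> 2 <= r ->
  (N (r / 2) - N 0) / 2 <= charT f r.
Proof.
move=> H r2; have [|x [ex x0]] := prox_fin H; first by lra.
have [y [ey hy]] := countN_ge r2; rewrite /charT ex ey /=; lra.
Qed.

Lemma charT_le rho q : has_order f rho -> rho < q -> 0 < q -> exists r0 : R, 2 <= r0 /\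
  forall r, r0 <= r -> charT f r <= r `^ q.
Proof.
move=> ho rq q0.
have : (limsup_infty (fun r => (ln (charT f r) / ln r)%R) < q%:E)%E by rewrite ho lte_fin.
move=> /ereal_inf_lt[_ [r0 _ <-] h].
exists (Num.max r0 2); split; first by rewrite le_max lexx orbT.
move=> r; rewrite ge_max => /andP[r0r r2].
have [c0|c0] := ltP 0 (charT f r); last by apply: le_trans c0 (powR_ge0 _ _).
have lr : 0 < ln r by apply: ln_gt0; lra.
have h1 : ln (charT f r) / ln r < q.
  rewrite -lte_fin; apply: le_lt_trans h; apply: ereal_sup_ubound; exists r => //.
rewrite -ler_ln ?posrE ?powR_gt0 //; last by lra.
by rewrite ln_powR -ler_pdivrMr // ltW.
Qed.

Lemma pole_count rho q : has_order f rho -> rho < q -> 0 < q -> exists B : R, 0 < B /\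
  forall (T : R) (s : seq C), 1 <= T -> uniq s -> (forall a, a \in s -> poles f a /\ cabs a <= T) ->
  (size s)%:R <= B * T `^ q.
Proof.
move=> ho rq q0; have [r0 [r2 Hr]] := charT_le ho rq q0.
have N00 : 0 <= N 0 by rewrite -lee_fin -NE; apply: esum_ge0 => p _; rewrite lee_fin.
have B0 : 0 < (4 * r0) `^ q by rewrite powR_gt0; lra.
exists (2 * (4 * r0) `^ q + N 0); split; first by lra.
move=> T s T1 us sT; pose r1 := r0 * T * 2.
have r01 : r0 <= r1 by rewrite /r1; nra.
(* Poles lie on finitely many circles with radius in this interval, and the interval has positive
   length. *)
have [r [/andP[rr1 rr2] Hn]] : exists r, r1 <= r <= 2 * r1 /\ forall z, cabs z = r -> f z <> None.
  apply: contrapT => H.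
  have [s2 [_ Hs2]] := poles_seq pd (2 * r1).
  have fin2 : finite_set `[r1, 2 * r1]%classic.
    apply: (sub_finite_set _ (finite_image (@cabs R) (finite_seq s2))).
    move=> x; rewrite /= in_itv /= => /andP[x1 x2].
    apply: contrapT => nx; apply: H; exists x; rewrite x1 x2; split=> // z zx fz.
    apply: nx; exists z => //=; apply/Hs2; split; first exact: mero_poles (pd_mero pd) _ fz.
    by rewrite zx.
  have : lebesgue_measure (`[r1, 2 * r1]%classic : set R) = 0%E.
    by apply: countable_lebesgue_measure0; exact: finite_set_countable.
  rewrite lebesgue_measure_itv /= lte_fin ifT; last by lra.
  by rewrite -EFinB => -[]; lra.
have r22 : 2 <= r by lra.
have := charT_ge Hn r22.
have := Hr r (le_trans r01 rr1).
have NT : (size s)%:R <= N (r / 2).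
  rewrite -lee_fin -NE; apply: le_trans (npoles_ge us sT) (npoles_mono _).
  by move: rr1; rewrite /r1; nra.
have : r `^ q <= (4 * r0) `^ q * T `^ q.
  rewrite -powRM; [|lra|lra].
  apply: ge0_ler_powR; rewrite ?nnegrE; rewrite ?/r1 in rr2 *; [lra|lra|nra|lra].
have : 1 <= T `^ q by rewrite -(powRr0 T); apply: ler_powR => //; exact: ltW.
move: ((4 * r0) `^ q) (T `^ q) (charT f r) (r `^ q) B0 => b x y w b0 x1 h1 h2 h3.
have : N 0 <= N 0 * x by rewrite ler_peMr.
nra.
Qed.

End PoleCount.

(** * The upper bound *)

Section ContentTools.
Variable R : realType.
Local Notation C := R[i].

Lemma hle_diam (s D : R) (A : set C) : 0 < s -> 0 <= D ->
  (forall a b, A a -> A b -> cabs (a - b) <= D) -> hle s A (D `^ s).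
Proof.
move=> s0 D0 AD e e0.
exists (fun i => if i is 0%N then A else set0), (fun i => if i is 0%N then D else 0); split.
  by split=> [z Az|[|i]] //; exists 0%N.
move=> [|n]; first by rewrite big_ord0 addr_ge0 ?powR_ge0 // ltW.
rewrite big_ord_recl big1 => [|i _]; last by rewrite /= powR0 // gt_eqF.
by rewrite addr0 lerDl ltW.
Qed.

Lemma null_halving (s H : R) (A : set C) : (forall n, hle s A (H * 2^-1 ^+ n)) -> null s A.
Proof.
move=> HA e e0; have e2 : 0 < e / 2 by rewrite divr_gt0.
have [n Hn] := half_seq_lt H e2.
have [U [d [UA Ud]]] := HA n _ e2; exists U, d; split=> // k.
by apply: le_trans (Ud k) _; lra.
Qed.

Lemma pow2_powR (j : nat) (e : R) : (2 ^+ j) `^ e = (2 `^ e) ^+ j.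
Proof. by rewrite -(powR_mulrn j (powR_ge0 2 e)) -(powR_mulrn j (ler0n R 2)) -!powRrM mulrC. Qed.

Lemma dyadic_shell (x : R) : 1 <= x -> exists j : nat, 2 ^+ j <= x < 2 ^+ j.+1.
Proof.
move=> x1; have ex : exists j : nat, x < 2 ^+ j.
  have [j Hj] := half_seq_lt x (ltr01 : 0 < 1 :> R); exists j.
  by move: Hj; rewrite exprVn ltr_pdivrMr ?exprn_gt0 // mul1r.
case: (ex_minnP ex) => -[|j] lt mn; first by move: lt; rewrite expr0 ltNge x1.
by exists j; rewrite lt andbT leNgt; apply/negP => /mn; rewrite ltnn.
Qed.

Lemma geometric_lt (u x e : R) : 0 < u < 1 -> 0 < e -> exists n, x * u ^+ n < e.
Proof.
move=> /andP[u0 u1] e0; have [k Hk] : exists k : nat, u ^+ k <= 2^-1.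
  have u1' : 1 < u^-1 by rewrite invf_gt1.
  pose h := u^-1 - 1; have h0 : 0 < h by rewrite subr_gt0.
  exists (Num.truncn (h^-1)).+1; set k := _.+1.
  have kh : 1 <= h * k%:R.
    rewrite mulrC -ler_pdivrMr // mul1r ltW //.
    by have /andP[] := truncn_itv (ltW (divr_gt0 ltr01 h0)); rewrite mul1r.
  have : 1 + h * k%:R <= u^-1 ^+ k.
    have -> : u^-1 = 1 + h by rewrite /h; ring.
    elim: {kh}k => [|k IH]; first by rewrite mulr0 addr0 expr0.
    rewrite exprS -natr1; move: IH; set y := (1 + h) ^+ k => IH.
    have k0 : 0 <= k%:R :> R by rewrite ler0n.
    nra.
  rewrite exprVn => H; rewrite -[u ^+ k]invrK lef_pV2 ?posrE ?invr_gt0 ?exprn_gt0 //.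
  by move: kh; lra.
have [x0|x0] := leP x 0.
  by exists 0%N; rewrite expr0 mulr1 (le_lt_trans x0).
have [n Hn] := half_seq_lt x e0; exists (k * n)%N; apply: le_lt_trans Hn.
rewrite ler_pM2l // exprM lerXn2r ?nnegrE ?invr_ge0 //; exact: exprn_ge0 (ltW u0).
Qed.

Lemma geometric_sumle (u D : R) (j0 : nat) : 0 < u < 1 -> 0 <= D ->
  sumle (fun j => D * u ^+ (j0 + j)) (D * (1 - u)^-1 * u ^+ j0).
Proof.
move=> /andP[u0 u1] D0 n; rewrite -mulr_sumr -mulrA ler_wpM2l //.
under eq_bigr do rewrite exprD.
rewrite -mulr_sumr mulrC ler_wpM2r ?exprn_ge0 ?(ltW u0) //.
have v0 : 0 < 1 - u by rewrite subr_gt0.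
rewrite -(ler_pM2l v0) mulfV ?gt_eqF // -opprB mulNr -subrX1 opprB gerBl.
by rewrite exprn_ge0 // ltW.
Qed.

(** The index list is fixed before the centre and the scale, so the number of cells is the same at
    every pole. *)
Lemma disc_cells (A k : R) : 0 < A -> 0 < k -> exists l : seq (nat * nat),
  forall (a : C) (p : R), 0 < p -> exists cell : nat * nat -> set C,
  (forall z, cabs (z - a) <= A * p -> exists b, b \in l /\ cell b z) /\
  (forall b z z', cell b z -> cell b z' -> cabs (z - z') < k * p).
Proof.
(* Squares of side [h = k p / 2] have diameter below [k p], and [2 A p / h = 4 A / k] of them span
   the disc. *)
move=> A0 k0; pose n := (Num.truncn (4 * A / k)).+1.
exists [seq (i, j) | i <- iota 0 n, j <- iota 0 n] => a p p0.
have h0 : 0 < k * p / 2 by rewrite divr_gt0 // mulr_gt0.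
pose h := k * p / 2; pose idx (x : R) := Num.truncn ((x + A * p) / h).
pose cell (b : nat * nat) : set C := [set z | [/\ cabs (z - a) <= A * p,
  idx (Re (z - a)) = b.1 & idx (Im (z - a)) = b.2]].
have nneg x : `|x| <= A * p -> 0 <= (x + A * p) / h.
  by move=> /ler_normlP[h1 _]; rewrite divr_ge0 ?(ltW h0) //; lra.
have idxn x : `|x| <= A * p -> (idx x < n)%N.
  move=> xA; rewrite ltnS; apply: le_truncn.
  rewrite ler_pdivrMr // (_ : 4 * A / k * h = 2 * (A * p)); last by rewrite /h; field; lra.
  by move: xA => /ler_normlP[_]; lra.
have idxd x y : `|x| <= A * p -> `|y| <= A * p -> idx x = idx y -> `|x - y| < h.
  move=> /nneg/truncn_itv; rewrite -/(idx x) => hx /nneg/truncn_itv; rewrite -/(idx y) => hy e.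
  move: hx hy; rewrite e !ler_pdivlMr // !ltr_pdivrMr // -natr1 => hx hy.
  by rewrite ltr_norml; apply/andP; split; nra.
exists cell; split.
  move=> z zA; exists (idx (Re (z - a)), idx (Im (z - a))); split; last by split.
  apply/allpairsP; exists (idx (Re (z - a)), idx (Im (z - a))).
  rewrite !mem_iota !add0n /=; split=> //; apply: idxn; apply: le_trans zA.
    exact: Re_le_cabs.
  exact: Im_le_cabs.
move=> b z z' [zA z1 z2] [zA' z1' z2'].
have -> : z - z' = (z - a) - (z' - a) by ring.
apply: le_lt_trans (cabs_ReIm _) _.
have := idxd _ _ (le_trans (Re_le_cabs _) zA) (le_trans (Re_le_cabs _) zA') (etrans z1 (esym z1')).
have := idxd _ _ (le_trans (Im_le_cabs _) zA) (le_trans (Im_le_cabs _) zA') (etrans z2 (esym z2')).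
by rewrite !Re_sub !Im_sub /h; lra.
Qed.

End ContentTools.

Section UpperBound.
Variables (R : realType) (f : R[i] -> option R[i]) (P : set R[i]) (Rdag : R) (M : nat).
Variables (beta K : R).
Local Notation C := R[i].
Local Notation F := (fun x => fin (f x)).
Hypothesis pd : pole_data f P Rdag M beta K.
Local Notation bet a := (cabs a `^ (- beta)).

(** A dyadic shell holds on the order of [2^(j q)] poles of weight about [2^(-j sg)], so the shells
    sum geometrically with ratio [u = 2^(q - sg)]. The constants precede [j0], which is chosen later
    to make the tail small. *)
Lemma hle_shells (q B sg : R) : 0 < B -> 0 < q -> q < sg ->
  (forall (T : R) (s : seq C), 1 <= T -> uniq s -> (forall a, a \in s -> poles f a /\ cabs a <= T) ->
    (size s)%:R <= B * T `^ q) ->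
  exists B' u : R, 0 < B' /\ 0 < u < 1 /\
  forall (s D : R) j0 (A_ : C -> set C), 0 < s -> 0 <= D ->
  (forall b, poles f b -> 2 ^+ j0 <= cabs b -> hle s (A_ b) (D * cabs b `^ (- sg))) ->
  hle s [set z | exists b, [/\ poles f b, 2 ^+ j0 <= cabs b & A_ b z]] (D * B' * u ^+ j0).
Proof.
move=> B0 q0 qs cnt; pose u : R := 2 `^ (q - sg).
have u0 : 0 < u by rewrite powR_gt0.
have u1 : u < 1.
  rewrite /u -opprB powRN invf_lt1 ?powR_gt0 //.
  have : 1 `^ (sg - q) < 2 `^ (sg - q).
    by apply: gt0_ltr_powR; rewrite ?nnegrE ?subr_gt0 ?ltr1n.
  by rewrite powR1.
have uu : 0 < u < 1 by rewrite u0.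
pose B2 := B * 2 `^ q; have B20 : 0 < B2 by rewrite mulr_gt0 // powR_gt0.
exists (B2 / (1 - u)), u; split; first by rewrite divr_gt0 // subr_gt0.
split=> // s D j0 A_ s0 D0 HA.
have DB : 0 <= D * B2 by rewrite mulr_ge0 // ltW.
apply: (@hle_bigcup _ s _ (fun j => [set z | exists b, [/\ poles f b,
    2 ^+ (j0 + j) <= cabs b <= 2 ^+ (j0 + j).+1 & A_ b z]])
    (fun j => D * B2 * u ^+ (j0 + j))).
- move=> z [b [pb bj Az]].
  have [|j /andP[j1 j2]] := @dyadic_shell _ (cabs b).
    by apply: le_trans bj; rewrite exprn_ege1 // ler1n.
  have jj : (j0 <= j)%N.
    rewrite -ltnS -(ltr_eXn2l (_ : 1 < 2 :> R)) ?ltr1n //; exact: le_lt_trans bj j2.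
  by exists (j - j0)%N => //; exists b; rewrite subnKC // j1 (ltW j2).
- move=> j; set J := (j0 + j)%N.
  have [l [ul Hl]] := poles_seq pd (2 ^+ J.+1).
  pose l' := [seq b <- l | 2 ^+ J <= cabs b].
  have lP b : b \in l' -> poles f b /\ 2 ^+ J <= cabs b.
    by rewrite mem_filter => /andP[bJ /Hl[pb _]].
  have J1 : 1 <= 2 ^+ J :> R by rewrite exprn_ege1 // ler1n.
  have JJ : 2 ^+ j0 <= 2 ^+ J :> R by rewrite ler_eXn2l ?ltr1n // leq_addr.
  have := @hle_seq _ s _ l' A_ (fun b => D * cabs b `^ (- sg)) s0
    (fun b bl => HA b (lP b bl).1 (le_trans JJ (lP b bl).2)).
  apply: hle_sub.
    move=> z [b [pb /andP[b1 b2] Az]]; exists b; split=> //.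
    by rewrite mem_filter b1 /=; apply/Hl.
  apply: (@le_trans _ _ (\sum_(b <- l') D * (2 ^+ J) `^ (- sg))).
    rewrite big_seq [leRHS]big_seq; apply: ler_sum => b /lP[_ bJ].
    have b0 : 0 < cabs b := lt_le_trans (lt_le_trans ltr01 J1) bJ.
    have J0 : 0 < 2 ^+ J :> R := lt_le_trans ltr01 J1.
    rewrite ler_wpM2l // !powRN lef_pV2 ?posrE ?powR_gt0 //.
    apply: ge0_ler_powR; rewrite ?nnegrE ?(ltW J0) ?(ltW b0) //.
    exact: ltW (lt_trans q0 qs).
  rewrite big_const_seq count_predT iter_addr addr0 -(mulr_natr (D * _)).
  have : (size l')%:R <= B * (2 ^+ J.+1) `^ q.
    apply: cnt; [by rewrite exprn_ege1 // ler1n|exact: filter_uniq|].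
    by move=> a; rewrite mem_filter => /andP[_ /Hl].
  rewrite -(mulrA D B2) -(mulrA D (_ `^ _)) => h; rewrite ler_wpM2l //.
  have -> : B2 * u ^+ J = (2 ^+ J) `^ (- sg) * (B * (2 ^+ J.+1) `^ q).
    rewrite !pow2_powR exprS /u addrC powRD; last by rewrite pnatr_eq0 implybT.
    by rewrite exprMn /B2; ring.
  by rewrite ler_wpM2l // powR_ge0.
- have := geometric_sumle j0 uu DB; congr sumle; ring.
Qed.

Definition orbit_beyond (c : nat -> C) (R1 : R) : set C :=
  [set y | forall n, exists w, Fseq f c n y = Some w /\ R1 < cabs w].

Lemma Fseq_shift (c : nat -> C) n y v : f y = Some v ->
  Fseq f c n.+1 y = Fseq f (fun k => c k.+1) n (v + c 1%N).
Proof.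
move=> fy; elim: n => [|n IH]; first by rewrite /= fy.
by rewrite [LHS]/= -/(Fseq f c n.+1 y) IH.
Qed.

Lemma orbit_beyond_shift c R1 y : orbit_beyond c R1 y -> R1 < cabs y /\
  exists v, f y = Some v /\ orbit_beyond (fun k => c k.+1) R1 (v + c 1%N).
Proof.
move=> H; split; first by have [w [[<-]]] := H 0%N.
have [w [/= + _]] := H 1%N; case fy : (f y) => [v|//] _; exists v; split=> // n.
by have := H n.+1; rewrite (Fseq_shift c n fy).
Qed.

(** In the contraction factor the weight [|a|^(-beta s / m)] of the source pole splits off; the
    weight of the target and the scale combine to a power of [cabs b]. Since orders are at most [M]
    and [1 <= cabs b], that power is at most the one summed over the poles. *)
Lemma transfer_weight (s : R) a m b mb (H : R) : 0 < s -> 0 <= H ->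
  good_pole f P a m -> good_pole f P b mb ->
  (pscale beta a m (cabs b) / cabs b) `^ s * (H * bet b `^ (s / mb%:R))
  <= H * bet a `^ (s / m%:R) * cabs b `^ (- (s * (beta + M%:R + 1) / M%:R)).
Proof.
move=> s0 H0 ga gb; have [_ _ b1] := gb; set X := cabs b in b1 *.
have X0 : 0 < X by exact: lt_le_trans ltr01 b1.
have /andP[m1 mM] := good_pole_order pd ga; have /andP[n1 nM] := good_pole_order pd gb.
have ba := bet_gt0 beta ga.
have mi : M%:R^-1 <= m%:R^-1 :> R by rewrite lef_pV2 ?posrE ?ltr0n ?ler_nat // (leq_trans m1).
have ni : M%:R^-1 <= mb%:R^-1 :> R by rewrite lef_pV2 ?posrE ?ltr0n ?ler_nat // (leq_trans m1).
have be0 := pd_beta pd.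
have -> : (pscale beta a m X / X) `^ s = bet a `^ (s / m%:R) * X `^ (- (s / m%:R + s)).
  rewrite /pscale powRM ?powR_ge0 ?invr_ge0 ?(ltW X0) // -powRrM -/(bet a).
  rewrite powRM ?powR_ge0 ?invr_ge0 ?(ltW X0) // -!powR_inv1 ?(ltW X0) // -!powRrM.
  rewrite -mulrA -powRD; last by rewrite (gt_eqF X0) implybT.
  by congr (_ `^ _ * _ `^ _); ring.
have -> : X `^ (- beta) `^ (s / mb%:R) = X `^ (- (beta * s / mb%:R)).
  by rewrite -powRrM; congr (_ `^ _); ring.
set w := bet a `^ (s / m%:R); have w0 : 0 <= w by exact: powR_ge0.
have -> : w * X `^ (- (s / m%:R + s)) * (H * X `^ (- (beta * s / mb%:R))) =
  H * w * X `^ (- (s / m%:R + s) - beta * s / mb%:R).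
  by rewrite powRD ?(gt_eqF X0) ?implybT //; ring.
rewrite ler_wpM2l ?mulr_ge0 //; apply: ler_powR => //.
have M0 : M%:R != 0 :> R by rewrite pnatr_eq0 -lt0n (leq_trans m1).
have -> : s * (beta + M%:R + 1) / M%:R = s * beta * M%:R^-1 + s + s * M%:R^-1 by field.
have h1 : s * M%:R^-1 <= s * m%:R^-1 by rewrite ler_pM2l.
have h2 : s * beta * M%:R^-1 <= s * beta * mb%:R^-1 by rewrite ler_wpM2l // mulr_ge0 // ltW.
rewrite (mulrC beta s); lra.
Qed.

Hypothesis finP : finite_set (poles f `\` P).

(** The start of the halving recursion: values of modulus at least one confine [A] to the disc of
    radius [K |a|^(-beta / m)] about the pole. *)
Lemma near_pole_content (s : R) a m (A : set C) : 0 < s -> good_pole f P a m ->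
  (forall y, A y -> 0 < cabs (y - a) < Rdag /\ 1 <= cabs (F y)) ->
  hle s A ((2 * K) `^ s * bet a `^ (s / m%:R)).
Proof.
move=> s0 ga HA; have K1 := pd_K pd; have K0 : 0 < K by exact: lt_le_trans ltr01 K1.
have /andP[m1 mM] := good_pole_order pd ga; have ba := bet_gt0 beta ga.
pose t := bet a `^ (m%:R^-1); have t0 : 0 < t by rewrite powR_gt0.
have tm : t ^+ m = bet a.
  rewrite /t -powR_mulrn ?powR_ge0 // -powRrM mulVf ?powRr1 ?powR_ge0 //.
  by rewrite pnatr_eq0 -lt0n.
have yt y : A y -> cabs (y - a) <= K * t.
  move=> /HA[y0 y1]; have [_ /andP[_ h]] := near_pole_value pd ga y0.
  have /andP[d0 _] := y0; have dm : 0 < cabs (y - a) ^+ m by rewrite exprn_gt0.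
  have : cabs (y - a) ^+ m <= K * bet a.
    by move: (le_trans y1 h); rewrite mulrA ler_pdivlMr // mul1r.
  move=> h'; rewrite -(@ler_pXn2r _ m) ?nnegrE ?cabs_ge0 ?mulr_ge0 ?(ltW K0) ?(ltW t0) //.
  apply: le_trans h' _; rewrite exprMn tm ler_pM2r // -[leLHS]expr1.
  by apply: ler_weXn2l.
have -> : (2 * K) `^ s * bet a `^ (s / m%:R) = (2 * (K * t)) `^ s.
  rewrite (mulrC s) (powRrM (bet a)) -/t (mulrA 2).
  by rewrite (powRM s (mulr_ge0 (ler0n R 2) (ltW K0)) (ltW t0)).
apply: hle_diam => //; first by rewrite mulr_ge0 // mulr_ge0 ?(ltW K0) ?(ltW t0).
move=> x y /yt hx /yt hy; apply: le_trans (cabs_triangle a x y) _.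
by rewrite (cabs_distC a); lra.
Qed.

Lemma orbit_beyond_null (r q B s : R) p : 0 < r <= 1 -> r <= Rdag / 8 -> poles f p ->
  ~ asymptotic_value f None -> 0 < s -> 0 < B -> 0 < q -> q < s * (beta + M%:R + 1) / M%:R ->
  (forall (T : R) (s : seq C), 1 <= T -> uniq s -> (forall a, a \in s -> poles f a /\ cabs a <= T) ->
    (size s)%:R <= B * T `^ q) ->
  exists R1 : R, 0 < R1 /\ forall c : nat -> C, (forall n, (1 <= n)%N -> cabs (c n) <= 1) ->
  null s (orbit_beyond c R1).
Proof.
move=> rr r8 pp nas s0 B0 q0 qs cnt; have /andP[r0 r1] := rr.
have Rd := pd_Rdag pd; have K1 := pd_K pd; have K0 : 0 < K by exact: lt_le_trans ltr01 K1.
have [R2 [R21 loc]] := location_good pd finP rr r8 pp nas.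
have [kp [K6 [kp0 [K60 sl]]]] := scale_lipschitz pd.
have K40 : 0 < 4 * K by rewrite mulr_gt0.
have [l cells] := @disc_cells R _ _ K40 kp0.
have [B' [u [B'0 [u1 shells]]]] := hle_shells B0 q0 qs cnt.
set sg := s * _ / _ in qs shells.
pose N : R := (size l)%:R; have N0 : 0 <= N by rewrite ler0n.
have K6s : 0 < K6 `^ s by rewrite powR_gt0.
have reorder (k y h n : R) : k * y * h * n = n * k * (y * h) by ring.
(* Together the number of cells, the Lipschitz constant and the tail of the pole sum must not exceed
   one half; [R1] then forces every pole visited after one step into that tail. *)
have [j0 Hj0] := @geometric_lt _ u (N * K6 `^ s * B') 2^-1 u1 (ltac:(by rewrite invr_gt0)).
pose R1 := Num.max (R2 + 1) (Num.max (2 ^+ j0 + 1) 9).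
have R1P : [/\ R2 + 1 <= R1, 2 ^+ j0 + 1 <= R1 & 9 <= R1].
  by rewrite !le_max !lexx !orbT.
move: R1 R1P => R1 [R1a R1b R1c]; exists R1; split; first by lra.
pose piece c a := orbit_beyond c R1 `&` [set y | 0 < cabs (y - a) < r].
pose cok (c : nat -> C) := forall n, (1 <= n)%N -> cabs (c n) <= 1.
have cokS c : cok c -> cok (fun k => c k.+1) by move=> h n _; exact: h.
have orbP c y : cok c -> orbit_beyond c R1 y -> [/\ f y = Some (F y), R1 < cabs y,
    R1 - 1 < cabs (F y) & orbit_beyond (fun k => c k.+1) R1 (F y + c 1%N)].
  move=> cc /orbit_beyond_shift[yR [v [fy ov]]]; rewrite fy /=; split=> //.
  have [vR _] := orbit_beyond_shift ov.
  by have := cabsD v (c 1%N); have := cc 1%N (leqnn _); lra.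
have located c y : cok c -> orbit_beyond c R1 y -> exists a m, good_pole f P a m /\ piece c a y.
  move=> cc oy; have [fy yR FR _] := orbP c y cc oy.
  have [||a [m [ga ya]]] := loc _ _ fy; [lra|lra|].
  by exists a, m; split.
(* The induction runs over all sequences [c] at once, because one step of the orbit shifts the
   sequence. *)
have small n : forall c a m, cok c -> good_pole f P a m ->
    hle s (piece c a) ((2 * K) `^ s * 2^-1 ^+ n * bet a `^ (s / m%:R)).
  elim: n => [|n IH] c a m cc ga.
    rewrite expr0 mulr1; apply: near_pole_content => // y [/(orbP _ _ cc)[_ _ FR _] /= /andP[y0 yr]].
    by rewrite y0; split; lra.
  set H := (2 * K) `^ s * 2^-1 ^+ n in IH.
  have H0 : 0 <= H by rewrite mulr_ge0 ?powR_ge0 // exprn_ge0 // invr_ge0.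
  pose c' k := c k.+1; pose A_ b := [set y | [/\ 0 < cabs (y - a) < r, orbit_beyond c R1 y,
    exists mb, good_pole f P b mb & piece c' b (F y + c 1%N)]].
  set w := bet a `^ _; have w0 : 0 <= w by exact: powR_ge0.
  pose D := N * K6 `^ s * H * w.
  have D0 : 0 <= D := mulr_ge0 (mulr_ge0 (mulr_ge0 N0 (ltW K6s)) H0) w0.
  have HA b : poles f b -> 2 ^+ j0 <= cabs b -> hle s (A_ b) (D * cabs b `^ (- sg)).
    move=> _ bj; have [[mb gb]|ngb] := pselect (exists mb, good_pole f P b mb); last first.
      apply: (hle_sub (B := set0) _ _ (null_set0 s0)); first by move=> y [_ _ /ngb].
      by rewrite mulr_ge0 // powR_ge0.
    have X1 : 1 <= cabs b by case: gb.
    have X0 : 0 < cabs b by exact: lt_le_trans ltr01 X1.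
    have p0 := pscale_gt0 beta ga X0.
    have [cell [cov cd]] := cells a _ p0.
    have AP y : A_ b y -> 0 < cabs (y - a) <= Rdag / 2 /\ cabs b / 4 <= cabs (F y) <= 4 * cabs b.
      move=> [/andP[y0 yr] oy _ [oy1 /= /andP[_ yb]]]; rewrite y0; split; first by lra.
      have [_ _ FR _] := orbP _ _ cc oy; have := cc 1%N (leqnn _) => c1.
      have := cabs_le_sub (F y) b; have := cabs_le_sub b (F y); rewrite (cabs_distC b).
      have -> : F y - b = (F y + c 1%N - b) - c 1%N by ring.
      have := cabsB (F y + c 1%N - b) (c 1%N) => h1 h2 h3.
      apply/andP; split; lra.
    have hcell i : i \in l -> hle s (A_ b `&` cell i)
        ((K6 * (pscale beta a m (cabs b) / cabs b)) `^ s * (H * bet b `^ (s / mb%:R))).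
      move=> _; apply: (hle_lip (phi := fun y => F y + c 1%N) s0 _ (IH c' b mb (cokS _ cc) gb)).
      - by rewrite mulr_ge0 ?(ltW K60) // divr_ge0 // ltW.
      - by move=> y [[_ _ _]].
      - move=> y y' [/AP[ya yX] yc] [/AP[ya' yX'] yc'].
        have -> : F y + c 1%N - (F y' + c 1%N) = F y - F y' by ring.
        by apply: (sl a m (cabs b) y y' ga X0 ya ya' yX yX').1; exact: cd yc yc'.
    apply: (hle_sub _ _ (hle_seq s0 hcell)).
      move=> y /[dup] Ay /AP[ya yX]; have [|i [il yi]] := cov y; last by exists i.
      by apply: (scale_bounds pd ga _ X0 yX).2; case/andP: ya => -> ?; lra.
    rewrite big_const_seq count_predT iter_addr addr0 -(mulr_natr (_ `^ s * _)) -/N.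
    rewrite powRM ?(ltW K60) ?divr_ge0 ?(ltW p0) ?(ltW X0) //.
    have := transfer_weight s0 H0 ga gb; rewrite -/w -/sg => tw.
    have -> : D * cabs b `^ (- sg) = N * K6 `^ s * (H * w * cabs b `^ (- sg)) by rewrite /D; ring.
    by rewrite reorder; exact: ler_wpM2l (mulr_ge0 N0 (ltW K6s)) _ _ tw.
  apply: (hle_sub _ _ (shells s D j0 A_ s0 D0 HA)).
    move=> y [oy ya]; have [fy yR FR oy1] := orbP _ _ cc oy.
    have [b [mb [gb yb]]] := located _ _ (cokS _ cc) oy1.
    have pb : poles f b by case: gb => Pb _ _; exact: (pd_poles pd).
    exists b; split=> //; last by split=> //; exists mb.
    have [yR2 _] := orbit_beyond_shift oy1.
    have := cabs_le_sub (F y + c 1%N) b; case: yb => _ /= /andP[_]; lra.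
  rewrite exprS (_ : D * B' * u ^+ j0 = N * K6 `^ s * B' * u ^+ j0 * (H * w)); last by rewrite /D; ring.
  rewrite [leRHS](_ : _ = 2^-1 * (H * w)); last by rewrite /H; ring.
  exact: ler_wpM2r (mulr_ge0 H0 w0) _ _ (ltW Hj0).
(* The piece at each single pole is now null; [hle_shells] with [D = 0] merely takes the union over
   the poles. *)
move=> c cc; have j0' : 0 <= 0 :> R by [].
have Hn b : poles f b -> 2 ^+ 0%N <= cabs b ->
    hle s (piece c b `&` [set _ | exists m, good_pole f P b m]) (0 * cabs b `^ (- sg)).
  move=> pb _; rewrite mul0r; have [[m gb]|ngb] := pselect (exists m, good_pole f P b m); last first.
    by apply: null_sub (null_set0 s0) => y [_ /= /ngb].
  apply: (@null_halving _ _ ((2 * K) `^ s * bet b `^ (s / m%:R))) => n.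
  apply: (hle_sub _ _ (small n c b m cc gb)); first by move=> y [].
  by rewrite mulrAC.
have := shells s 0 0%N _ s0 j0' Hn; rewrite !mul0r; apply: null_sub.
move=> y oy; have [a [m [ga ya]]] := located c y cc oy.
have [Pa _ a1] := ga.
exists a; split; [exact: (pd_poles pd)|by rewrite expr0|by split=> //; exists m].
Qed.

End UpperBound.

(** * The lower bounds *)

Section Shadowing.
Variables (R : realType) (f : R[i] -> option R[i]) (P : set R[i]) (Rdag : R) (M : nat).
Variables (beta K : R).
Local Notation C := R[i].
Local Notation F := (fun x => fin (f x)).
Hypothesis pd : pole_data f P Rdag M beta K.

(** The bound [3 / 4 * r], rather than [r], survives limits and keeps them strictly inside the disc
    on which the next branch acts. *)
Definition contracting_branch (r : R) (a b c : C) (G : C -> C) :=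
  (forall y, cabs (y - b) < r ->
     [/\ 0 < cabs (G y - a), cabs (G y - a) <= 3 / 4 * r & f (G y) = Some (y - c)]) /\
  (forall y y', cabs (y - b) < r -> cabs (y' - b) < r -> cabs (G y - G y') <= 2^-1 * cabs (y - y')).

Lemma inverse_branch (r : R) : 0 < r <= 1 -> r <= Rdag / 8 -> exists R3 : R, 0 < R3 /\
  forall a m b c, good_pole f P a m -> R3 <= cabs b -> cabs c <= r ->
  exists G, contracting_branch r a b c G.
Proof.
move=> /andP[r0 r1] r8; have Rd := pd_Rdag pd.
have rr2 : r <= Rdag / 2 by lra.
have [R1 [R10 EB]] := expanding_branch pd r0 rr2 r0.
(* The preimage of [b - c] is found within [r / 4] of the pole; the branch shrinks a disc of radius
   [r] to radius at most [r / 2] around it, which gives [3 / 4 * r] in total. *)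
pose S := 4 * K / (r / 4) ^+ M.
exists (Num.max R1 S + r); split; first by rewrite addr_gt0 // lt_max R10.
move=> a m b c ga bR cr.
have bc : Num.max R1 S <= cabs (b - c).
  by have := cabs_le_sub b (b - c); rewrite (_ : b - (b - c) = c); [move: bR; set mx := Num.max _ _; lra|ring].
have [bc1 bc2] : R1 <= cabs (b - c) /\ S <= cabs (b - c).
  by move: bc; rewrite ge_max => /andP.
have r4 : 0 < r / 4 <= 1 by apply/andP; split; lra.
have r4R : r / 4 < Rdag by lra.
have [x [/andP[x0 xr] fx]] := pole_surjective pd r4 r4R ga bc2.
have x0r : 0 < cabs (x - a) < r by rewrite x0; lra.
have [|s [s0 [Wa Wc Ws]]] := EB a m x ga x0r; first by rewrite fx.
have Wx : branch_domain f x s r x by split; rewrite !subrr cabs0.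
have Fx : F x = b - c by rewrite fx.
have Gex y : {g | cabs (y - b) < r -> branch_domain f x s r g /\ F g = y - c}.
  apply: cid; have [yb|yb] := ltP (cabs (y - b)) r; last by exists 0.
  have [|g [Wg Fg]] := Ws (y - c); last by exists g.
  by rewrite /= fx /= (_ : y - c - (b - c) = y - b) //; ring.
exists (fun y => sval (Gex y)); split.
  move=> y yb; case: (Gex y) => g /= /(_ yb)[Wg Fg].
  have /andP[g0 gR] := Wa g Wg; split=> //; last first.
    by have [nf _] := near_pole_value pd ga (Wa g Wg); rewrite (Some_fin nf) Fg.
  apply: le_trans (cabs_triangle x g a) _.
  have := Wc g x Wg Wx; rewrite Fg Fx (_ : y - c - (b - c) = y - b); last by ring.
  by lra.
move=> y y' yb yb'; case: (Gex y) => g /= /(_ yb)[Wg Fg]; case: (Gex y') => g' /= /(_ yb')[Wg' Fg'].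
have := Wc g g' Wg Wg'; rewrite Fg Fg' (_ : y - c - (y' - c) = y - y') //; ring.
Qed.

Fixpoint pulled (G : nat -> C -> C) (b : nat -> C) (n k : nat) : C :=
  if n is n'.+1 then G k (pulled G b n' k.+1) else b k.

(** Points pulled back from time [k + n] to time [k] converge geometrically in [n], and continuity
    of the branches makes the limits at different times one orbit. *)
Lemma shadowing (r : R) (b c : nat -> C) : 0 < r ->
  (forall k, exists G, contracting_branch r (b k) (b k.+1) (c k.+1) G) ->
  exists l : nat -> C, forall k, [/\ 0 < cabs (l k - b k) < r, f (l k) = Some (l k.+1 - c k.+1)
    & Fseq f c k (l 0%N) = Some (l k)].
Proof.
move=> r0 /(_ _)/cid HG; pose G k := sval (HG k).
have GP k : contracting_branch r (b k) (b k.+1) (c k.+1) (G k) by exact: (svalP (HG k)).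
clearbody G; pose Z k n := pulled G b n k.
have Zin n : forall k, cabs (Z k n - b k) <= 3 / 4 * r.
  elim: n => [|n IH] k; first by rewrite /Z /= subrr cabs0; lra.
  have Zk : cabs (Z k.+1 n - b k.+1) < r by have := IH k.+1; lra.
  by have [_ h _] := (GP k).1 _ Zk.
have Zr n k : cabs (Z k n - b k) < r by have := Zin n k; lra.
have step k n : cabs (Z k n.+1 - Z k n) <= r * 2^-1 ^+ n.
  elim: n k => [|n IH] k.
    by rewrite expr0 mulr1; apply: ltW; exact: (Zr 1%N k).
  apply: le_trans ((GP k).2 _ _ (Zr n.+1 k.+1) (Zr n k.+1)) _.
  by rewrite exprS mulrCA ler_pM2l ?invr_gt0 //; exact: IH.
have lim k : {l | ccvg (Z k) l} by apply: cid; exact: geom_cauchy (step k).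
pose l k := sval (lim k); have lP k : ccvg (Z k) (l k) by exact: (svalP (lim k)).
have lin k : cabs (l k - b k) <= 3 / 4 * r by exact: (cclosed_cball (fun n => Zin n k) (lP k)).
have lr k : cabs (l k - b k) < r by have := lin k; lra.
have Gl k : G k (l k.+1) = l k.
  apply: (@ccvg_unique _ (fun n => Z k (n + 1)%N)); last exact: ccvg_shift (lP k).
  move=> e e0; have [N HN] := lP k.+1 _ e0; exists N => n Nn; rewrite addn1.
  apply: le_lt_trans ((GP k).2 _ _ (Zr n k.+1) (lr k.+1)) _.
  by have := HN n Nn; have := cabs_ge0 (Z k.+1 n - l k.+1); lra.
have lf k : f (l k) = Some (l k.+1 - c k.+1).
  by have [_ _] := (GP k).1 _ (lr k.+1); rewrite Gl.
exists l => k; split=> //.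
  by rewrite lr andbT; have [+ _ _] := (GP k).1 _ (lr k.+1); rewrite Gl.
by elim: k => [//|k IH]; rewrite /= IH lf /= subrK.
Qed.

Lemma shadow_point (r : R) : 0 < r <= 1 -> r <= Rdag / 8 -> exists R3 : R, 0 < R3 /\
  forall (b : nat -> C) m (c : nat -> C), (forall k, good_pole f P (b k) m) ->
  (forall k, R3 <= cabs (b k)) -> (forall n, (1 <= n)%N -> cabs (c n) <= r) ->
  exists l : nat -> C, forall k, [/\ 0 < cabs (l k - b k) < r, f (l k) = Some (l k.+1 - c k.+1)
    & Fseq f c k (l 0%N) = Some (l k)].
Proof.
move=> rr r8; have [R3 [R30 H]] := inverse_branch rr r8.
exists R3; split=> // b m c gb bR cr; apply: shadowing; first by case/andP: rr.
by move=> k; apply: (H _ m) => //; exact: cr.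
Qed.

End Shadowing.

(** * Scales with many poles *)

Section Scales.
Variables (R : realType) (f : R[i] -> option R[i]) (P : set R[i]) (Rdag : R) (M : nat).
Variables (beta K : R).
Local Notation C := R[i].
Local Notation F := (fun x => fin (f x)).
Hypothesis pd : pole_data f P Rdag M beta K.
Hypothesis finP : finite_set (poles f `\` P).

Lemma sum_subset (T : eqType) (s1 s2 : seq T) (g : T -> R) : uniq s1 -> uniq s2 ->
  {subset s1 <= s2} -> (forall a, 0 <= g a) -> \sum_(a <- s1) g a <= \sum_(a <- s2) g a.
Proof.
move=> u1 u2 sub g0.
have : perm_eq s1 [seq a <- s2 | a \in s1].
  apply: uniq_perm => //; first exact: filter_uniq.
  by move=> a; rewrite mem_filter; case: (boolP (a \in s1)) => // /sub ->.
move=> pe; rewrite (perm_big _ pe) /= big_filter [leLHS]big_mkcond.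
by apply: ler_sum => a _; case: ifP.
Qed.

Definition good_scale (m : nat) (t : R) (j : nat) := exists l : seq C, [/\ uniq l,
  forall b, b \in l -> good_pole f P b m /\ 2 ^+ j <= cabs b <= 2 ^+ j.+1 &
  (2 ^+ j) `^ t <= (size l)%:R].

(** If all scales beyond [J] were bad, a shell would contribute at most [2^(j (t - t'))] to the pole
    series with exponent [t'], apart from a finite initial part; the series would converge although
    [t' < rho]. *)
Lemma good_scale_infinite rho m t : mult_class_exponent f rho m -> 0 < t < rho ->
  forall J, exists j, (J <= j)%N /\ good_scale m t j.
Proof.
move=> mc /andP[t0 tr] J; apply: contrapT => nex.
pose t' := (t + rho) / 2; have [tt' tr'] : t < t' /\ t' < rho by rewrite /t'; split; lra.
have [S [S0 HS]] := @finite_bound _ _ (fun a x => cabs a <= x) (exceptional_finite pd finP)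
  (fun a x y xy H => le_trans H xy) (fun a _ => ex_intro _ (cabs a) (lexx _)).
have [J0 [JJ0 SJ0]] : exists J0, (J <= J0)%N /\ S < 2 ^+ J0.
  have [j Hj] := half_seq_lt S (ltr01 : 0 < 1 :> R); exists (maxn J j); rewrite leq_maxl; split=> //.
  move: Hj; rewrite exprVn ltr_pdivrMr ?exprn_gt0 // mul1r => /lt_le_trans; apply.
  by rewrite ler_eXn2l ?ltr1n // leq_maxr.
have dex (a : C) : {d : nat | 1 <= cabs a -> 2 ^+ d <= cabs a < 2 ^+ d.+1}.
  apply: cid; have [a1|a1] := leP 1 (cabs a); last by exists 0%N.
  by have [d Hd] := dyadic_shell a1; exists d.
pose d (a : C) := sval (dex a); have dP (a : C) : 1 <= cabs a -> 2 ^+ d a <= cabs a < 2 ^+ (d a).+1.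
  exact: (svalP (dex a)).
clearbody d; pose g (a : C) : R := cabs a `^ (- t').
have g0 a : 0 <= g a by exact: powR_ge0.
have [ss [uss Hss]] := poles_seq pd (2 ^+ J0).
pose v : R := 2 `^ (t - t'); have v0 : 0 < v by rewrite powR_gt0.
have v1 : v < 1.
  rewrite /v -opprB powRN invf_lt1 ?powR_gt0 //.
  have : 1 `^ (t' - t) < 2 `^ (t' - t).
    by apply: gt0_ltr_powR; rewrite ?nnegrE ?subr_gt0 ?ltr1n.
  by rewrite powR1.
pose B := \sum_(a <- ss) g a + 1 / (1 - v).
have J01 : 1 <= 2 ^+ J0 :> R by rewrite exprn_ege1 // ler1n.
suff : (\esum_(a in [set a | pole_of_order f a m]) ((cabs a) `^ (- t'))%:E <= B%:E)%E.
  by rewrite (mc t').2 // leye_eq.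
apply: ge_ereal_sup => _ [X [Xf XS] <-].
have [xs [uxs eX]] : exists xs : seq C, uniq xs /\ X = [set` xs].
  have /finite_seqP[xs ->] := Xf; exists (undup xs); split; first exact: undup_uniq.
  by apply/seteqP; split=> a; rewrite /= mem_undup.
rewrite eX -fsbig_seq // sumEFin lee_fin.
have xsP a : a \in xs -> pole_of_order f a m by move=> ax; apply: XS; rewrite eX.
rewrite (bigID (fun a => cabs a < 2 ^+ J0)) /=; apply: lerD.
  rewrite -big_filter; apply: sum_subset => //; first exact: filter_uniq.
  move=> a; rewrite mem_filter => /andP[aJ /xsP pa]; apply/Hss; split; last exact: ltW.
  by exists m.
pose n := (\max_(a <- xs) d a)%N.
have dn a : a \in xs -> (d a <= n)%N by move=> ax; exact: (leq_bigmax_seq _ ax).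
rewrite (partition_big (fun a => inord (d a) : 'I_n.+1) xpredT) //=.
apply: (@le_trans _ _ (\sum_(j < n.+1) 1 * v ^+ (0 + j))); last first.
  have := @geometric_sumle _ v 1 0%N _ ler01 n.+1; rewrite v0 v1 expr0 mulr1; exact.
apply: ler_sum => j _; rewrite mul1r add0n.
rewrite -big_filter; set l := [seq _ <- _ | _].
have lP a : a \in l -> [/\ pole_of_order f a m, 2 ^+ J0 <= cabs a & d a = j].
  rewrite mem_filter => /andP[/andP[+ /eqP dj] ax]; rewrite -leNgt => aJ; split=> //.
    exact: xsP.
  by rewrite -dj inordK // ltnS; exact: dn.
have lP2 a : a \in l -> good_pole f P a m /\ 2 ^+ j <= cabs a <= 2 ^+ j.+1.
  move=> /lP[pa aJ dj]; have a1 := le_trans J01 aJ.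
  have /andP[h1 h2] := dP a a1; rewrite -dj h1 (ltW h2); split=> //.
  have [/HS|[m' ga]] := @exceptional_or_good _ f P Rdag M beta K pd a (ex_intro _ m pa).
    by move=> /(le_trans aJ); rewrite leNgt SJ0.
  by rewrite (_ : m = m') //; case: ga => _ /(pole_order_unique pa).
have ul : uniq l by exact: filter_uniq.
have szl : (size l)%:R <= (2 ^+ j) `^ t.
  have [jJ|Jj] := ltnP j J0.
    rewrite (_ : l = [::]) ?powR_ge0 //; apply/eqP; rewrite -(negbK (_ == _)); apply/negP.
    case: l lP {lP2 ul} => // a l /(_ a (mem_head _ _))[_ aJ dj] _.
    have /andP[_] := dP a (le_trans J01 aJ); rewrite dj ltNge => /negP; apply.
    by apply: le_trans aJ; rewrite ler_eXn2l ?ltr1n.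
  rewrite leNgt; apply/negP => h; apply: nex; exists j; split; first exact: leq_trans Jj.
  by exists l; split=> //; exact: ltW.
apply: (@le_trans _ _ (\sum_(a <- l) (2 ^+ j) `^ (- t'))).
  rewrite big_seq [leRHS]big_seq; apply: ler_sum => a /lP2[[_ _ a1] /andP[aj _]].
  have j0 : 0 < 2 ^+ j :> R by rewrite exprn_gt0.
  have a0 : 0 < cabs a := lt_le_trans ltr01 a1.
  rewrite /g !powRN lef_pV2 ?posrE ?powR_gt0 //.
  apply: ge0_ler_powR; rewrite ?nnegrE ?(ltW j0) ?(ltW a0) //.
  exact: ltW (lt_trans t0 tt').
rewrite big_const_seq count_predT iter_addr addr0 -(mulr_natl (_ `^ _)).
have -> : v ^+ j = (2 ^+ j) `^ t * (2 ^+ j) `^ (- t').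
  by rewrite !pow2_powR -exprMn -powRD ?pnatr_eq0 ?implybT.
by rewrite ler_wpM2r // powR_ge0.
Qed.

End Scales.

(* Each scale is the largest good one that the linear bound allows. *)
Lemma slow_sequence (good : nat -> Prop) : (forall J, exists j, (J <= j)%N /\ good j) ->
  forall J, exists js : nat -> nat, [/\ forall n, good (js n), forall n, (J <= js n)%N,
    forall n, (js n <= js 0 + n)%N & forall L, exists n0, forall n, (n0 <= n)%N -> (L <= js n)%N].
Proof.
move=> inf J; have [j0 [Jj0 gj0]] := inf J.
pose js := fix js n := if n is n'.+1 then
  if `[< good (j0 + n'.+1)%N >] then (j0 + n'.+1)%N else js n' else j0.
have jsP n : good (js n) /\ (J <= js n)%N /\ (js n <= j0 + n)%N.
  elim: n => [|n [IH1 [IH2 IH3]]] /=; first by rewrite addn0.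
  case: ifPn => [/asboolP g|_]; last by split=> //; split=> //; rewrite addnS leqW.
  by split=> //; split=> //; apply: leq_trans Jj0 (leq_addr _ _).
exists js; split; try by move=> n; have [? []] := jsP n.
move=> L; have [j [Lj gj]] := inf (maxn L j0.+1).
have j0j : (j0 < j)%N by apply: leq_trans Lj; exact: leq_maxr.
exists (j - j0)%N => n jn; apply: leq_trans (leq_trans (leq_maxl L j0.+1) Lj) _.
elim: n jn => [|n IH]; first by rewrite leqn0 subn_eq0 leqNgt j0j.
rewrite leq_eqVlt => /orP[/eqP e|jn]; rewrite /=.
  have ej : (j0 + n.+1)%N = j by rewrite -e subnKC // ltnW.
  by rewrite ej asboolT.
case: ifP => _; last exact: IH.
by rewrite -leq_subLR; exact: ltnW jn.
Qed.

Section CantorProduct.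
Variable R : realType.

(** One step may jump over many scales, so single factors are uncontrolled. In the product the
    ratios of scales telescope to at most [2^n], and the spare [2^e] at each step pays for it. *)
Lemma telescoping_product (N js : nat -> nat) (e_ : nat -> R) (s e : R) : 0 <= e ->
  (forall k, 0 < e_ k) -> (forall n, (js n <= js 0 + n)%N) ->
  (forall k, 2 `^ e * (2 ^+ js k) `^ e <= (2 ^+ js k.+1) `^ e * ((N k)%:R * e_ k `^ s)) ->
  forall n, 1 <= \prod_(k < n) (N k)%:R * (\prod_(k < n) e_ k) `^ s.
Proof.
move=> e0 ep jsn H n.
have Xp k : 0 < (2 ^+ js k) `^ e :> R by rewrite powR_gt0 // exprn_gt0.
have Ep k : 0 < \prod_(i < k) e_ i by apply: prodr_gt0 => i _.
have Q : (2 `^ e) ^+ n * (2 ^+ js 0%N) `^ e <=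
    (2 ^+ js n) `^ e * (\prod_(k < n) (N k)%:R * (\prod_(k < n) e_ k) `^ s).
  elim: n => [|n IH]; first by rewrite !big_ord0 powR1 expr0 mul1r !mulr1.
  rewrite !big_ord_recr /= powRM ?(ltW (Ep n)) ?(ltW (ep n)) // exprS.
  set p := \prod_(k < n) (N k)%:R in IH *; set w := (\prod_(k < n) e_ k) `^ s in IH *.
  have p0 : 0 <= p by apply: prodr_ge0 => i _; rewrite ler0n.
  have w0 : 0 <= w by exact: powR_ge0.
  apply: (@le_trans _ _ (2 `^ e * ((2 ^+ js n) `^ e * (p * w)))).
    by rewrite -mulrA ler_pM2l // powR_gt0.
  rewrite mulrA [leRHS](_ : _ = (2 ^+ js n.+1) `^ e * ((N n)%:R * e_ n `^ s) * (p * w)); last by ring.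
  by rewrite ler_wpM2r ?mulr_ge0.
have Xn : (2 ^+ js n) `^ e <= (2 `^ e) ^+ n * (2 ^+ js 0%N) `^ e.
  rewrite -pow2_powR -powRM ?exprn_ge0 // -exprD addnC; apply: ge0_ler_powR => //.
  - by rewrite nnegrE exprn_ge0.
  - by rewrite nnegrE exprn_ge0.
  - by rewrite ler_eXn2l ?ltr1n.
by have := le_trans Xn Q; rewrite -[leLHS]mulr1 ler_pM2l.
Qed.

(** The branching [X^t] meets the loss [X^(-beta s / m) Y^(-e)] of the gap. The power of [Y] is left
    to telescope, and the positive surplus [dl] absorbs the constants and one doubling of the
    scale. *)
Lemma transfer_gap (X Y K6 beta s t : R) (m N : nat) : 0 < X -> 0 < Y -> 0 < K6 -> (0 < m)%N ->
  let e := s / m%:R + s in let dl := t - beta * s / m%:R - e in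
  X `^ t <= N%:R -> 2 `^ e <= 2 `^ (- (beta * s / m%:R)) * K6 `^ (- s) * X `^ dl ->
  2 `^ e * X `^ e <= Y `^ e * (N%:R *
    (((2 * X) `^ (- beta) / Y) `^ (m%:R^-1) / (K6 * Y)) `^ s).
Proof.
move=> X0 Y0 K60 m0 e dl XN H.
have inv_pow (x y : R) : 0 < x -> x^-1 `^ y = x `^ (- y).
  by move=> x0; rewrite -powR_inv1 ?ltW // -powRrM mulN1r.
have -> : (((2 * X) `^ (- beta) / Y) `^ (m%:R^-1) / (K6 * Y)) `^ s =
    2 `^ (- (beta * s / m%:R)) * X `^ (- (beta * s / m%:R)) * (K6 `^ (- s) * Y `^ (- e)).
  have KY : 0 < K6 * Y by rewrite mulr_gt0.
  rewrite (powRM s (powR_ge0 _ _)) ?invr_ge0 ?(ltW KY) // inv_pow // -powRrM.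
  rewrite (powRM _ (powR_ge0 _ _)) ?invr_ge0 ?(ltW Y0) // inv_pow // -powRrM.
  rewrite (powRM _ (ltW K60) (ltW Y0)) (powRM _ (ler0n R 2) (ltW X0)).
  have -> : - beta * (m%:R^-1 * s) = - (beta * s / m%:R) by ring.
  have -> : - e = - (m%:R^-1 * s) + - s by rewrite /e; ring.
  by rewrite (powRD (x := Y)) ?(gt_eqF Y0) ?implybT //; ring.
set x := X `^ (- (beta * s / m%:R)); set k2 := 2 `^ (- _) in H *; set k6 := K6 `^ (- s) in H *.
have -> : Y `^ e * (N%:R * (k2 * x * (k6 * Y `^ (- e)))) = N%:R * (k2 * k6 * x).
  have : Y `^ e * Y `^ (- e) = 1 by rewrite powRN mulfV // gt_eqF // powR_gt0.
  move: (Y `^ e) (Y `^ (- e)) => y y' yy.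
  have -> : y * (N%:R * (k2 * x * (k6 * y'))) = y * y' * (N%:R * (k2 * k6 * x)) by ring.
  by rewrite yy mul1r.
have k0 : 0 <= k2 * k6 * x by rewrite !mulr_ge0 // powR_ge0.
apply: le_trans (ler_wpM2r k0 XN).
have -> : X `^ t * (k2 * k6 * x) = k2 * k6 * X `^ dl * X `^ e.
  have Xn : X != 0 by rewrite gt_eqF.
  rewrite -[RHS]mulrA -powRD ?Xn ?implybT // /x mulrCA [X `^ t * _]mulrC.
  rewrite (_ : dl + e = - (beta * s / m%:R) + t); last by rewrite /dl; ring.
  by rewrite powRD ?Xn ?implybT //; ring.
by rewrite ler_wpM2r // powR_ge0.
Qed.

End CantorProduct.

(** * A Cantor set of escaping radial points *)

Section LowerBound.
Variables (R : realType) (f : R[i] -> option R[i]) (P : set R[i]) (Rdag : R) (M : nat).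
Variables (beta K : R).
Local Notation C := R[i].
Local Notation F := (fun x => fin (f x)).
Hypothesis pd : pole_data f P Rdag M beta K.

Lemma pow2_large (x : R) : exists J : nat, forall j, (J <= j)%N -> x < 2 ^+ j.
Proof.
have [J HJ] := half_seq_lt x (ltr01 : 0 < 1 :> R); exists J => j Jj.
move: HJ; rewrite exprVn ltr_pdivrMr ?exprn_gt0 // mul1r => /lt_le_trans; apply.
by rewrite ler_eXn2l ?ltr1n.
Qed.

Lemma pow2_powR_large (x dl : R) : 0 < dl -> exists J : nat, forall j, (J <= j)%N -> x <= (2 ^+ j) `^ dl.
Proof.
move=> dl0; have [|J HJ] := @geometric_lt _ (2 `^ (- dl)) x 1 _ ltr01.
  rewrite powR_gt0 // powRN invf_lt1 ?powR_gt0 //.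
  have : 1 `^ dl < 2 `^ dl :> R by apply: gt0_ltr_powR; rewrite ?nnegrE ?ltr1n.
  by rewrite powR1.
exists J => j Jj; apply: (@le_trans _ _ ((2 ^+ J) `^ dl)).
  move: HJ; rewrite powRN exprVn pow2_powR ltr_pdivrMr ?exprn_gt0 ?powR_gt0 // mul1r.
  exact: ltW.
by apply: ge0_ler_powR; rewrite ?nnegrE ?exprn_ge0 ?(ltW dl0) // ler_eXn2l ?ltr1n.
Qed.

Lemma cantor_lower (r s t r0 : R) (m : nat) (c : nat -> C) : 0 < r <= 1 -> r <= Rdag / 8 ->
  0 < s -> (0 < m)%N -> s * (beta + m%:R + 1) / m%:R < t ->
  (forall J, exists j, (J <= j)%N /\ good_scale f P m t j) ->
  (forall n, (1 <= n)%N -> cabs (c n) <= r) ->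
  ~ null s (Iinf (Fseq f c) `&` escaping (Fseq f c) (radialJ (Fseq f c)) r0).
Proof.
move=> rr r8 s0 m0 st scales cr; have /andP[rp r1] := rr.
have Rd := pd_Rdag pd; have be0 := pd_beta pd.
have [R3 [R30 shadow]] := shadow_point pd rr r8.
have rr2 : r <= Rdag / 2 by lra.
have [R1 [R10 track]] := tracked_radial pd rp rr2.
have [kp [K6 [_ [K60 sl]]]] := scale_lipschitz pd.
have mR : 0 < m%:R :> R by rewrite ltr0n.
pose e := s / m%:R + s; have e0 : 0 < e by rewrite addr_gt0 // divr_gt0.
pose dl := t - beta * s / m%:R - e.
have dl0 : 0 < dl.
  have -> : dl = t - s * (beta + m%:R + 1) / m%:R by rewrite /dl /e; field; lra.
  by rewrite subr_gt0.
have t0 : 0 < t by apply: le_lt_trans st; rewrite divr_ge0 ?(ltW mR) // mulr_ge0 ?(ltW s0) //; lra.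
pose kap := 2 `^ (- (beta * s / m%:R)) * K6 `^ (- s).
have kap0 : 0 < kap by rewrite mulr_gt0 ?powR_gt0.
have [J1 HJ1] := pow2_large (R3 + R1 + `|r0| + 16).
have [J2 HJ2] := pow2_powR_large (2 `^ e / kap) dl0.
have [J3 HJ3] := pow2_powR_large 2 t0.
have [js [gjs Jjs jsn jsinf]] := slow_sequence scales (maxn J1 (maxn J2 J3)).
have {gjs} /choice[L HL] := gjs.
pose X n : R := 2 ^+ js n; pose N n := size (L n).
have X0 n : 0 < X n by rewrite exprn_gt0.
have X1 n : R3 + R1 + `|r0| + 16 < X n.
  by apply: HJ1; apply: leq_trans (Jjs n); exact: leq_maxl.
have X2 n : 2 `^ e <= kap * X n `^ dl.
  rewrite mulrC -ler_pdivrMr //; apply: HJ2; apply: leq_trans (Jjs n).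
  by rewrite leq_max leq_maxl orbT.
have NX n : X n `^ t <= (N n)%:R by have [] := HL n.
have N2 n : (1 < N n)%N.
  rewrite -(ltr_nat R); apply: lt_le_trans (NX n).
  apply: lt_le_trans (HJ3 (js n) _); first by rewrite ltr1n.
  by apply: leq_trans (Jjs n); rewrite !leq_max leqnn !orbT.
pose b (x : nat -> nat) k : C := nth 0 (L k) (x k).
have bP x k : valid N x -> good_pole f P (b x k) m /\ X k <= cabs (b x k) <= 2 * X k.
  move=> vx; have [_ + _] := HL k; rewrite exprS; apply; exact: mem_nth.
have lex x : exists l : nat -> C, valid N x -> forall k, [/\ 0 < cabs (l k - b x k) < r,
    f (l k) = Some (l k.+1 - c k.+1) & Fseq f c k (l 0%N) = Some (l k)].
  have [vx|nv] := pselect (valid N x); last by exists (fun=> 0).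
  have [||l Hl] := shadow (b x) m c _ _ cr; last by exists l.
    by move=> k; have [] := bP x k vx.
  move=> k; have [_ /andP[bX _]] := bP x k vx; apply: le_trans bX.
  by have := X1 k; have := normr_ge0 r0; lra.
have {lex} /choice[l lP] := lex.
have near x k : valid N x -> [/\ 0 < cabs (l x k - b x k) <= Rdag / 2,
    X k.+1 / 4 <= cabs (F (l x k)) <= 4 * X k.+1 & R1 <= cabs (F (l x k))].
  move=> vx; have [/andP[l0 lr] fl _] := lP x vx k.
  have [/andP[_ lr'] _ _] := lP x vx k.+1.
  have [_ /andP[b1 b2]] := bP x k.+1 vx.
  rewrite l0 fl /=; set y := l x k.+1 - c k.+1.
  have yb : cabs (y - b x k.+1) <= 2.
    rewrite (_ : y - _ = l x k.+1 - b x k.+1 - c k.+1); last by rewrite /y; ring.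
    by apply: le_trans (cabsB _ _) _; have := cr k.+1 isT; lra.
  have h1 := cabs_le_sub y (b x k.+1); have := cabs_le_sub (b x k.+1) y.
  rewrite (cabs_distC (b x k.+1)) => h2; have Xk := X1 k.+1; have := normr_ge0 r0 => r00.
  by split; [lra|apply/andP; split; lra|lra].
have far x k : valid N x -> X k - 1 < cabs (l x k).
  move=> vx; have [/andP[_ lr] _ _] := lP x vx k; have [_ /andP[b1 _]] := bP x k vx.
  by have := cabs_le_sub (b x k) (l x k); rewrite (cabs_distC (b x k)); lra.
(* A lower bound for the contraction at any pole of the level, whose modulus is at most
   [2 * X k]. *)
pose e_ k := ((2 * X k) `^ (- beta) / X k.+1) `^ (m%:R^-1) / (K6 * X k.+1).
have ep k : 0 < e_ k.
  rewrite divr_gt0 ?mulr_gt0 // powR_gt0 // divr_gt0 // powR_gt0 // mulr_gt0 //.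
(* Itineraries that separate at level [n] use poles at distance at least [Rdag]; the orbits stay
   within [Rdag / 8] of them, so more than [Rdag / 2] is left before pulling back. *)
pose g n := Rdag / 2 * \prod_(k < n) e_ k.
have Ep n : 0 < \prod_(k < n) e_ k by apply: prodr_gt0 => i _.
apply: (@cantor_not_null R N N2 s _ g (fun x => l x 0%N) ((Rdag / 2) `^ s)) => //.
- by rewrite powR_gt0 // divr_gt0.
- move=> x vx.
  have tr : tracked f P c r R1 (l x 0%N).
    move=> n; have [ln fl Fl] := lP x vx n; have [gb _] := bP x n vx.
    by exists (l x n), (b x n), m; split=> //; have [] := near x n vx.
  have [J rad] := track c _ tr; split.
    split=> //; split; first exact: tracked_defined tr.
    move=> B; have [j Hj] := pow2_large (B + 1); have [n0 Hn0] := jsinf j.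
    exists n0 => n /Hn0/Hj XB; have [_ _ Fl] := lP x vx n.
    by exists (l x n); split=> //; have := far x n vx; rewrite /X; lra.
  split=> // n _; have [_ _ Fl] := lP x vx n; exists (l x n); split=> //.
  have := far x n vx; have := X1 n; have := ler_norm r0; lra.
- move=> x y n vx vy agree ne.
  have step k : (k < n)%N -> e_ k * cabs (l x k.+1 - l y k.+1) <= cabs (l x k - l y k).
    move=> kn; have exy : b y k = b x k by rewrite /b agree.
    have [ga /andP[b1 b2]] := bP x k vx.
    have [lx1 lx2 _] := near x k vx; have [] := near y k vy; rewrite exy => ly1 ly2 _.
    have [_] := sl (b x k) m (X k.+1) (l x k) (l y k) ga (X0 _) lx1 ly1 lx2 ly2.
    have [_ -> _] := lP x vx k; have [_ -> _] := lP y vy k => /=.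
    rewrite (_ : l x k.+1 - c k.+1 - _ = l x k.+1 - l y k.+1); last by ring.
    have p0 := pscale_gt0 beta ga (X0 k.+1); set p := pscale _ _ _ _ in p0 *.
    set D := cabs (l x k.+1 - _); set d := cabs _; have D0 : 0 <= D by exact: cabs_ge0.
    have KX : 0 < K6 * X k.+1 by rewrite mulr_gt0.
    have KXi : 0 < (K6 * X k.+1)^-1 by rewrite invr_gt0.
    have ep' : e_ k <= p / (K6 * X k.+1).
      rewrite /e_ (ler_pM2r KXi) /p /pscale.
      have ba : 0 < cabs (b x k) by exact: lt_le_trans (X0 k) b1.
      have X2k : 0 < 2 * X k by rewrite mulr_gt0.
      apply: ge0_ler_powR.
      + by rewrite invr_ge0 ltW.
      + by rewrite nnegrE divr_ge0 ?powR_ge0 // ltW.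
      + by rewrite nnegrE divr_ge0 ?powR_ge0 // ltW.
      + rewrite ler_pM2r ?invr_gt0 // !powRN lef_pV2 ?posrE ?powR_gt0 //.
        by apply: ge0_ler_powR; rewrite ?nnegrE ?(ltW ba) ?(ltW X2k).
    move=> h; apply: le_trans (ler_wpM2r D0 ep') _.
    apply: (@le_trans _ _ (p / (K6 * X k.+1) * (K6 * (X k.+1 / p) * d))).
      by rewrite ler_wpM2l // divr_ge0 ?(ltW p0) ?(ltW KX).
    rewrite le_eqVlt; apply/orP; left; apply/eqP; field.
    by rewrite !gt_eqF.
  have prod i : (i <= n)%N -> (\prod_(k < i) e_ k) * cabs (l x i - l y i) <= cabs (l x 0%N - l y 0%N).
    elim: i => [|i IH] ilen; first by rewrite big_ord0 mul1r.
    apply: le_trans (IH (ltnW ilen)); rewrite big_ord_recr /= -mulrA (ler_pM2l (Ep i)).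
    exact: step.
  apply: le_trans (prod n (leqnn _)); rewrite /g mulrC (ler_pM2l (Ep n)).
  have [/andP[_ lx] _ _] := lP x vx n; have [/andP[_ ly] _ _] := lP y vy n.
  have bne : b x n <> b y n.
    move=> /eqP; have [ul _ _] := HL n.
    by rewrite nth_uniq ?vx ?vy //; exact/negP/eqP.
  have [[Px _ _] _] := bP x n vx; have [[Py _ _] _] := bP y n vy.
  have := poles_separated pd (pd_poles pd Px) (pd_poles pd Py) bne.
  have := cabs_triangle (l x n) (b x n) (b y n); have := cabs_triangle (l y n) (l x n) (b y n).
  by rewrite (cabs_distC (b x n) (l x n)); lra.
- by move=> n; rewrite mulr_gt0 // divr_gt0.
- have Rd2 : 0 <= Rdag / 2 by rewrite divr_ge0 // ltW.
  move=> n; rewrite /g (powRM s Rd2 (ltW (Ep n))) mulrCA ler_peMr ?powR_ge0 //.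
  apply: (telescoping_product (js := js) (e := e)) => //; first exact: ltW.
  by move=> k; exact: (@transfer_gap R (X k) (X k.+1) K6 beta s t m (N k) (X0 k) (X0 k.+1) K60 m0 (NX k) (X2 k)).
Qed.

End LowerBound.

(** * Comparison of the dimensions *)

Section Assembly.
Variables (R : realType) (f : R[i] -> option R[i]) (P : set R[i]) (Rdag : R) (M : nat).
Variables (beta K : R).
Local Notation C := R[i].
Local Notation F := (fun x => fin (f x)).
Hypothesis pd : pole_data f P Rdag M beta K.

Lemma Fseq_add (c : nat -> C) k n z w : Fseq f c k z = Some w ->
  Fseq f c (k + n) z = Fseq f (fun j => c (k + j)%N) n w.
Proof. by move=> e; elim: n => [|n IH]; rewrite ?addn0 // addnS /= IH addnS. Qed.

Lemma null_forward (c : nat -> C) (s : R) (E : set C) k : 0 < s -> null s E ->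
  null s [set w | exists z, E z /\ Fseq f c k z = Some w].
Proof.
move=> s0 nE; elim: k => [|k IH].
  by apply: null_sub nE => w [z [Ez [<-]]].
apply: null_sub (null_image (pd_mero pd) (c k.+1) s0 IH) => w [z [Ez]].
move=> /FseqS_inv[y [Fy /(Some_fin (f := f)) fy ->]].
by exists y, (F y); split=> //; exists z.
Qed.

Lemma null_backward (c : nat -> C) (s : R) (B : set C) k p : poles f p -> 0 < s -> null s B ->
  null s [set z | exists w, Fseq f c k z = Some w /\ B w].
Proof.
move=> pp s0; elim: k B => [|k IH] B nB.
  by apply: null_sub nB => z [w [[->]]].
have := IH _ (null_preimage (pd_mero pd) (c k.+1) s0 nB (mero_nonconstant (pd_mero pd) pp)).
apply: null_sub => z [w [/FseqS_inv[y [Fy /(Some_fin (f := f)) fy ->]] Bw]].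
by exists y; split=> //; exists (F y).
Qed.

Lemma escaping_sub_beyond (c : nat -> C) (J : set C) R1 :
  escaping (Fseq f c) J R1 `<=`
  [set z | exists w, Fseq f c 1 z = Some w /\ orbit_beyond f (fun j => c (1 + j)%N) R1 w].
Proof.
move=> z [_ H]; have [w [Fw _]] := H 1%N isT; exists w; split=> // n.
by rewrite -(Fseq_add n Fw); exact: H.
Qed.

Hypothesis finP : finite_set (poles f `\` P).

(** Each preimage lies near the same large pole and is itself large enough to be pulled back again,
    so the process never stops. *)
Lemma pull_back_orbit (r R1 : R) a m (c : nat -> C) : 0 < r <= 1 -> r <= Rdag / 8 ->
  good_pole f P a m -> R1 + 1 <= cabs a -> 4 * K / r ^+ M + 1 <= R1 ->
  (forall n, (1 <= n)%N -> cabs (c n) <= r) ->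
  forall k w, R1 < cabs w -> exists z, Fseq f c k z = Some w /\
    forall n, (n < k)%N -> exists y, [/\ Fseq f c n z = Some y, 0 < cabs (y - a) < r, R1 < cabs y
      & R1 - 1 <= cabs (F y)].
Proof.
move=> rr r8 ga aR KR cr; have /andP[r0 r1] := rr; have Rd := pd_Rdag pd.
have rR : r < Rdag by lra.
elim=> [|k IH] w wR; first by exists w.
have ck := cr k.+1 isT.
have wc : R1 - 1 <= cabs (w - c k.+1).
  have := cabs_le_sub w (w - c k.+1); rewrite (_ : w - (w - c k.+1) = c k.+1); [lra|ring].
have [|y [/andP[y0 yr] fy]] := @pole_surjective _ _ _ _ _ _ _ pd r a m (w - c k.+1) rr rR ga.
  by lra.
have yR : R1 < cabs y.
  by have := cabs_le_sub a y; rewrite (cabs_distC a); lra.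
have [z [Fz Hz]] := IH y yR; exists z; split; first by rewrite /= Fz fy /= subrK.
move=> n; rewrite ltnS leq_eqVlt => /orP[/eqP ->|/Hz//].
by exists y; rewrite y0 yr fy.
Qed.

(** The tail of an escaping orbit from time [k] is governed by the shifted sequence. Pulling its
    starting point back by exactly [k] steps realigns the indices of [c], and the new orbit is large
    from the beginning, hence tracked and in the Julia set. *)
Lemma null_Iinf (r s r0 : R) (c : nat -> C) : 0 < r <= 1 -> r <= Rdag / 8 ->
  ~ asymptotic_value f None -> (forall B : R, exists a m, good_pole f P a m /\ B <= cabs a) ->
  (forall n, (1 <= n)%N -> cabs (c n) <= r) -> 0 < s ->
  null s (escaping (Fseq f c) (Julia (Fseq f c)) r0) -> null s (Iinf (Fseq f c)).
Proof.
move=> rr r8 nas big cr s0 nE; have /andP[rp r1] := rr; have Rd := pd_Rdag pd.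
have rr2 : r <= Rdag / 2 by lra.
have [R2 [R20 track]] := tracked_radial pd rp rr2.
have [p [mp [[Pp _ _] _]]] := big 0; have pp := pd_poles pd Pp.
have [R3 [R31 loc]] := location_good pd finP rr r8 pp nas.
have K0 : 0 < K := lt_le_trans ltr01 (pd_K pd).
pose S := 4 * K / r ^+ M; have S0 : 0 < S by rewrite divr_gt0 ?exprn_gt0 ?mulr_gt0.
have [R1 [h1 h2 h3 h4]] : exists R1 : R, [/\ R2 + 1 <= R1, R3 + 1 <= R1, S + 1 <= R1 & r0 <= R1].
  exists (R2 + R3 + S + `|r0| + 1); have := ler_norm r0; have := normr_ge0 r0.
  by move=> n0 n1; split; lra.
have [a [m [ga aR]]] := big (R1 + 1).
apply: (@null_bigcup _ s _ (fun k => [set z | exists w, Fseq f c k z = Some w /\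
    orbit_beyond f (fun j => c (k + j)%N) R1 w])).
  move=> z [_ [_ zoo]]; have [k Hk] := zoo R1; exists k => //.
  have [w [Fw _]] := Hk k (leqnn _); exists w; split=> // n.
  by rewrite -(Fseq_add n Fw); apply: Hk; exact: leq_addr.
move=> k; apply: (null_backward c k pp s0); apply: null_sub (null_forward c k s0 nE) => w ow.
have wR : R1 < cabs w by have [v [[<-]]] := ow 0%N.
have [z [Fz Hz]] := pull_back_orbit rr r8 ga aR h3 cr k wR.
exists z; split=> //.
have beyond n : exists y, [/\ Fseq f c n z = Some y, R1 < cabs y &
    exists a m, [/\ good_pole f P a m, 0 < cabs (y - a) < r & R2 <= cabs (F y)]].
  have [nk|kn] := ltnP n k.
    have [y [Fy ya yR Fyl]] := Hz n nk; exists y; split=> //; exists a, m; split=> //; lra.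
  have := ow (n - k)%N; rewrite -(Fseq_add _ Fz) subnKC // => -[y [Fy yR]].
  have := ow (n - k).+1; rewrite -(Fseq_add _ Fz) addnS subnKC // => -[v [Fv vR]].
  exists y; split=> //; move: Fv => /FseqS_inv[y' []]; rewrite Fy => -[<-] fy ev.
  have Fl : R1 - 1 < cabs (F y).
    by have := cabsD (F y) (c n.+1); rewrite -ev; have := cr n.+1 isT; lra.
  have [||a' [m' [ga' ya']]] := loc _ _ (Some_fin fy); [lra|lra|].
  by exists a', m'; split=> //; lra.
have tr : tracked f P c r R2 z.
  by move=> n; have [y [Fy _ [a' [m' [ga' ya' Fl]]]]] := beyond n; exists y, a', m'.
have [Jz _] := track c z tr; split=> // n _; have [y [Fy yR _]] := beyond n.
by exists y; split=> //; lra.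
Qed.

Lemma null_escaping (r rho s : R) : 0 < r <= 1 -> r <= Rdag / 8 -> 0 < rho -> has_order f rho ->
  ~ asymptotic_value f None -> (forall B : R, exists a m, good_pole f P a m /\ B <= cabs a) ->
  rho * M%:R / (beta + M%:R + 1) < s -> exists R1 : R, 0 < R1 /\
  forall c : nat -> C, (forall n, (1 <= n)%N -> cabs (c n) <= r) ->
  null s (escaping (Fseq f c) (Julia (Fseq f c)) R1).
Proof.
move=> rr r8 rho0 ho nas big rs; have /andP[rp r1] := rr.
have [p [mp [gp _]]] := big 0; have pp : poles f p by case: gp => Pp _ _; exact: (pd_poles pd).
have M0 : (0 < M)%N by have /andP[/leq_trans] := good_pole_order pd gp; exact.
have MR : 0 < M%:R :> R by rewrite ltr0n.
have be0 := pd_beta pd; have D0 : 0 < beta + M%:R + 1 by lra.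
have s0 : 0 < s by apply: le_lt_trans rs; rewrite divr_ge0 ?mulr_ge0 ?(ltW rho0) ?(ltW MR) ?(ltW D0).
pose sg := s * (beta + M%:R + 1) / M%:R.
have sgr : rho < sg by rewrite /sg ltr_pdivlMr // -ltr_pdivrMr.
(* An exponent above the order, for the pole count, and below [sg], for the convergence of the shell
   sums. *)
pose q := (rho + sg) / 2; have [q1 q2] : rho < q /\ q < sg by rewrite /q; split; lra.
have q0 : 0 < q := lt_trans rho0 q1.
have [B [B0 cnt]] := pole_count pd ho q1 q0.
have [R1 [R10 H]] := orbit_beyond_null pd finP rr r8 pp nas s0 B0 q0 q2 cnt.
exists R1; split=> // c cr; apply: null_sub (@escaping_sub_beyond c _ R1) _.
apply: (null_backward c 1 pp s0); apply: H => n _.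
by apply: le_trans r1; exact: cr.
Qed.

End Assembly.

Theorem theorem2p7 (R : realType) (f0 : R[i] -> option R[i]) (rho : R) :
  transcendental_meromorphic f0 -> 0 < rho -> has_order f0 rho ->
  (* (1) infinity is not an asymptotic value *)
  ~ asymptotic_value f0 None ->
  forall (Rstar : R) (Pstar : set R[i]),
  0 < Rstar -> Pstar `<=` poles f0 -> finite_set (poles f0 `\` Pstar) ->
  (* (2) dist(Sing(f0^{-1}), a) > R^* *)
  (forall a, Pstar a -> exists r : R, Rstar < r /\
     forall w, Sing f0 w -> r <= cabs (w - a)) ->
  forall Rdag : R, 0 < Rdag ->
  (* (3) disjoint balls around distinct poles *)
  (forall a1 a2, poles f0 a1 -> poles f0 a2 -> a1 <> a2 ->
     cball a1 Rdag `&` cball a2 Rdag = set0) ->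
  forall (M : nat) (beta : R), 0 <= beta ->
  (* (4) multiplicities bounded and the asymptotic estimates *)
  (forall a, Pstar a -> exists m, pole_of_order f0 a m /\ (1 <= m <= M)%N) ->
  (exists K : R, 1 <= K /\
     forall a m, Pstar a -> pole_of_order f0 a m ->
     forall z, cball a Rdag z -> z != a ->
       (exists w, f0 z = Some w /\
          K^-1 * ((cabs a) `^ (- beta) / cabs (z - a) ^+ m) <= cabs w /\
          cabs w <= K * ((cabs a) `^ (- beta) / cabs (z - a) ^+ m)) /\
       (forall l, is_cderiv (fun x => fin (f0 x)) z l ->
          K^-1 * (m%:R * (cabs a) `^ (- beta) / cabs (z - a) ^+ m.+1) <= cabs l /\
          cabs l <= K * (m%:R * (cabs a) `^ (- beta) / cabs (z - a) ^+ m.+1))) ->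
  forall Ms : nat, is_Mstar f0 rho M Ms ->
  exists eps : R, 0 < eps /\
    forall c : nat -> R[i], (forall n, (1 <= n)%N -> cabs (c n) < eps) ->
      [/\ ((rho * Ms%:R / (beta + Ms%:R + 1))%:E <= HD (Iinf (Fseq f0 c)))%E,
          (HD (Iinf (Fseq f0 c)) <= ED (Fseq f0 c))%E,
          (ED (Fseq f0 c) <= (rho * M%:R / (beta + M%:R + 1))%:E)%E,
          ((rho * Ms%:R / (beta + Ms%:R + 1))%:E <= EHD (Fseq f0 c))%E &
          (EHD (Fseq f0 c) <= ED (Fseq f0 c))%E].
Proof.
move=> [mero _] rho0 ho nas Rstar P _ Pp finP _ Rdag Rd sep M beta be0 ord [K [K1 est]] Ms.
move=> [/andP[Ms1 MsM] [mc _]].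
have pd : pole_data f0 P Rdag M beta K by split.
have MsR : 0 < Ms%:R :> R by rewrite ltr0n.
(* Divergence of the pole series below [rho] supplies arbitrarily large good poles, in particular
   the existence of a pole. *)
have big (B : R) : exists a m, good_pole f0 P a m /\ B <= cabs a.
  have [J HJ] := pow2_large B.
  have rho2 : 0 < rho / 2 < rho by apply/andP; split; lra.
  have [j [Jj [l [_ Hl sz]]]] := good_scale_infinite pd finP mc rho2 J.
  case: l Hl sz => [_|a l /(_ a (mem_head _ _))[ga /andP[aj _]] _].
    by rewrite leNgt powR_gt0 // exprn_gt0.
  by exists a, Ms; split=> //; apply: le_trans aj; exact: ltW (HJ j Jj).
(* The same number serves as radius of the pole discs and as bound on the perturbations:
   [8 r <= Rdag] separates the discs, and [r <= 1] makes bounds uniform in the order. *)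
pose r := Num.min 1 (Rdag / 8).
have rp : 0 < r by rewrite lt_min ltr01 divr_gt0.
have rr : 0 < r <= 1 by rewrite rp ge_min lexx.
have r8 : r <= Rdag / 8 by rewrite ge_min lexx orbT.
exists r; split=> // c clt.
have cr n : (1 <= n)%N -> cabs (c n) <= r by move=> n1; exact: ltW (clt n n1).
(* One Cantor set lies in both the escaping set and the radial points beyond [r0], so it serves both
   lower bounds. *)
have low (r0 s : R) : 0 < s -> s < rho * Ms%:R / (beta + Ms%:R + 1) ->
    ~ null s (Iinf (Fseq f0 c) `&` escaping (Fseq f0 c) (radialJ (Fseq f0 c)) r0).
  move=> s0 st; pose u := s * (beta + Ms%:R + 1) / Ms%:R.
  have D0 : 0 < beta + Ms%:R + 1 by lra.
  have u0 : 0 < u by rewrite divr_gt0 // mulr_gt0.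
  have ur : u < rho by rewrite ltr_pdivrMr // -ltr_pdivlMr.
  have [t1 t2] : u < (u + rho) / 2 /\ 0 < (u + rho) / 2 < rho by split; [|apply/andP; split]; lra.
  exact: (cantor_lower pd rr r8 s0 Ms1 t1 (good_scale_infinite pd finP mc t2) cr).
split.
- by apply: HD_ge => s s0 /(low 0 s s0) nn /(null_sub (@subIsetl _ _ _)).
- apply: le_ereal_inf_tmp => _ [r0 _ <-]; apply: HD_mono => s s0.
  exact: (null_Iinf pd finP rr r8 nas big cr s0).
- apply/lee_addgt0Pr => e e0.
  have se : rho * M%:R / (beta + M%:R + 1) < rho * M%:R / (beta + M%:R + 1) + e by rewrite ltrDl.
  have [R1 [R10 H]] := null_escaping pd finP rr r8 rho0 ho nas big se.
  apply: (@le_trans _ _ (HD (escaping (Fseq f0 c) (Julia (Fseq f0 c)) R1))).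
    by apply: ereal_inf_lbound; exists R1.
  rewrite -EFinD; apply: HD_le_null; last exact: H.
  have MR : 0 <= M%:R :> R by rewrite ler0n.
  have D0 : 0 <= beta + M%:R + 1 by lra.
  by rewrite ltr_wpDl // divr_ge0 // mulr_ge0 // ltW.
- apply: le_ereal_inf_tmp => _ [r0 _ <-].
  by apply: HD_ge => s s0 /(low r0 s s0) nn /(null_sub (@subIsetr _ _ _)).
- apply: le_ereal_inf_tmp => _ [r0 r00 <-].
  apply: (@le_trans _ _ (HD (escaping (Fseq f0 c) (radialJ (Fseq f0 c)) r0))).
    by apply: ereal_inf_lbound; exists r0.
  apply: HD_mono => s _; apply: null_sub => z [[Jz _] h]; split=> //.
Qed.
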